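(* Let $\Omega\subset\mathbb{R}^n$ be a bounded open set with Lipschitz boundary and let $f:\mathbb{R}^n\to\mathbb{R}$ be a continuous function such that $f(\xi)\ge\gamma(|\xi|)$ for all $\xi\in\mathbb{R}^n$, where $\gamma:\mathbb{R}^+\to\mathbb{R}^+$ is a continuous increasing function with $\lim_{t\to+\infty}\gamma(t)=+\infty$. Let $u_0\in W^{1,\infty}(\Omega)$ and consider $$(P)\quad \inf\Big\{\operatorname*{ess\,sup}_{x\in\Omega}f(\nabla u(x)):\ u\in u_0+W^{1,\infty}_0(\Omega)\Big\},\qquad (P^{\rm lc})\quad \inf\Big\{\operatorname*{ess\,sup}_{x\in\Omega}f^{\rm lslc}(\nabla u(x)):\ u\in u_0+W^{1,\infty}_0(\Omega)\Big\}.$$ Assume that problem $(P^{\rm lc})$ admits a solution $\overline{u}\in C^1_{piec}(\Omega)$. Then, if $f^{\rm lslc}$ is constant in each connected component of the set $\{\xi\in\mathbb{R}^n:\ f^{\rm lslc}(\xi)<f(\xi)\}$, problem $(P)$ has a solution.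
   Context: Notation and definitions. $\mathbb{R}^+=[0,+\infty)$. Functions $u$ are scalar valued. $W^{1,\infty}_0(\Omega)$ is the closure of $C_0^\infty(\Omega)$ in $W^{1,1}(\Omega)$ intersected with $W^{1,\infty}(\Omega)$. $C^1_{piec}(\Omega)$ is the set of piecewise $C^1$ functions: those $u\in W^{1,\infty}(\Omega)$ for which there exist at most countably many pairwise disjoint open sets $\omega_h\subset\Omega$ with $|\Omega\setminus\bigcup_h\omega_h|=0$ and $u$ of class $C^1$ on each $\omega_h$. A function $g:\mathbb{R}^n\to[-\infty,+\infty]$ is level convex if its sublevel sets $L_c(g)=\{\xi: g(\xi)\le c\}$ are convex for every $c\in\mathbb{R}$, and lower semicontinuous if they are all closed. The lower semicontinuous level convex envelope of $f$ is $$f^{\rm lslc}(\xi)=\sup\{g(\xi):\ g:\mathbb{R}^n\to[-\infty,+\infty],\ g\text{ lower semicontinuous and level convex},\ g\le f\}.$$ A solution of a minimization problem is an admissible $u$ at which the infimum is attained. *)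

(* Defs.v *)
From HB Require Import structures.
From mathcomp Require Import all_boot all_order all_algebra.
From mathcomp Require Import all_classical all_reals all_analysis.
From mathcomp Require Import ess_sup_inf.

Set Implicit Arguments.
Unset Strict Implicit.
Unset Printing Implicit Defensive.

Import Order.TTheory GRing.Theory Num.Theory.
Import numFieldNormedType.Exports.

Local Open Scope classical_set_scope.
Local Open Scope ring_scope.

(** * Lebesgue measure on R^n

    R^n is ['rV[R]_n].  The library norm on it is the sup norm (it generates
    the usual topology); the Euclidean norm is [enorm] below.  The sigma-algebra
    is the one generated by the coordinate functions, i.e. the Borel one, and
    [leb n] is built by induction on [n] as a product measure. *)

Definition rV_display : measure_display. Proof. by constructor. Qed.

Section measurable_rV.
Context {R : realType}.
Variable n : nat.

Definition coor (i : 'I_n) (x : 'rV[R]_n) : R := x ord0 i.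

Let rV_set0 : g_sigma_preimage coor set0.
Proof. exact: sigma_algebra0. Qed.

Let rV_setC A : g_sigma_preimage coor A -> g_sigma_preimage coor (~` A).
Proof. exact: sigma_algebraC. Qed.

Let rV_bigcup (F : (set 'rV[R]_n)^nat) :
  (forall i, g_sigma_preimage coor (F i)) ->
  g_sigma_preimage coor (\bigcup_i (F i)).
Proof. exact: sigma_algebra_bigcup. Qed.

HB.instance Definition _ := @isMeasurable.Build rV_display
  'rV[R]_n (g_sigma_preimage coor) rV_set0 rV_setC rV_bigcup.

End measurable_rV.

Lemma measurable_coor (R : realType) n (i : 'I_n) :
  measurable_fun [set: 'rV[R]_n] (coor i).
Proof.
move=> _ Y mY; rewrite setTI; apply: sub_sigma_algebra => /=.
rewrite -bigcup_seq/=; exists i => /=; first by rewrite mem_index_enum.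
by exists Y => //; rewrite setTI.
Qed.

Lemma measurable_fun_coorP d (T : measurableType d) (R : realType) n
    (f : T -> 'rV[R]_n) :
  (forall i, measurable_fun [set: T] (coor i \o f)) ->
  measurable_fun [set: T] f.
Proof.
move=> mf; have sub : g_sigma_preimage (fun i => coor i \o f) `<=` measurable.
  apply: smallest_sub; first exact: sigma_algebra_measurable.
  case: n => [|n] in f mf *; first by rewrite big_ord0.
  rewrite -bigcup_mkord_ord; apply: bigcup_sub => i Ii.
  by move=> A [B mB <-]; exact: mf.
move=> _ A mA; apply: sub; rewrite g_sigma_preimage_comp.
by exists A.
Qed.

Section cons_rV.
Context {R : realType}.
Variable n : nat.

Definition cons_rV (xy : R * 'rV[R]_n) : 'rV[R]_n.+1 :=
  \row_i (if unlift ord0 i is Some j then xy.2 ord0 j else xy.1).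

Definition uncons_rV (x : 'rV[R]_n.+1) : R * 'rV[R]_n :=
  (x ord0 ord0, \row_j x ord0 (lift ord0 j)).

Lemma cons_rVK : cancel cons_rV uncons_rV.
Proof.
case=> x y; congr pair; first by rewrite mxE unlift_none.
by apply/rowP => j; rewrite !mxE liftK.
Qed.

Lemma uncons_rVK : cancel uncons_rV cons_rV.
Proof.
move=> x; apply/rowP => i; rewrite mxE.
by case: unliftP => [j ->|->] //; rewrite mxE.
Qed.

Lemma measurable_cons_rV : measurable_fun [set: R * 'rV[R]_n] cons_rV.
Proof.
apply: measurable_fun_coorP => i.
have [j ->|->] := unliftP ord0 i.
- rewrite (_ : _ \o _ = coor j \o snd).
    by apply: measurableT_comp => //; exact: measurable_coor.
  by apply/funext => xy; rewrite /coor/= mxE liftK.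
- rewrite (_ : _ \o _ = fst) //.
  by apply/funext => xy; rewrite /coor/= mxE unlift_none.
Qed.

Lemma measurable_uncons_rV : measurable_fun [set: 'rV[R]_n.+1] uncons_rV.
Proof.
apply/measurable_fun_pairP; split => /=.
  exact: (@measurable_coor R n.+1 ord0).
apply: measurable_fun_coorP => j.
rewrite (_ : _ \o _ = coor (lift ord0 j)); first exact: measurable_coor.
by apply/funext => x; rewrite /coor/= mxE.
Qed.

End cons_rV.

Section leb_succ.
Local Open Scope ereal_scope.
Context {R : realType}.
Variables (n : nat) (mu : {sigma_finite_measure set 'rV[R]_n -> \bar R}).

Definition leb_succ : set 'rV[R]_n.+1 -> \bar R :=
  pushforward ((@lebesgue_measure R) \x mu) (@cons_rV R n).

HB.instance Definition _ := Measure.copy leb_succ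
  (measure_function_pushforward__canonical__measure_function_Measure
    ((@lebesgue_measure R) \x mu) (@measurable_cons_rV R n)).

Let leb_succ_sigma_finite : sigma_finite setT leb_succ.
Proof.
have /sigma_finiteP[F [UF ndF Foo]] := sigma_finiteT (@lebesgue_measure R).
have /sigma_finiteP[G [UG ndG Goo]] := sigma_finiteT mu.
exists (fun k => @uncons_rV R n @^-1` (F k `*` G k)).
  rewrite -preimage_bigcup (_ : \bigcup_i _ = setT) ?preimage_setT//.
  apply/seteqP; split=> // -[x y] _.
  have [i _ Fx] : (\bigcup_i F i) x by rewrite -UF.
  have [j _ Gy] : (\bigcup_i G i) y by rewrite -UG.
  exists (maxn i j) => //; split => /=.
    by move: x Fx; exact/subsetPset/ndF/leq_maxl.
  by move: y Gy; exact/subsetPset/ndG/leq_maxr.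
move=> k; have [mF Fk] := Foo k; have [mG Gk] := Goo k; split.
  rewrite -[X in measurable X]setTI; apply: measurable_uncons_rV => //.
  exact: measurableX.
rewrite /leb_succ /pushforward -comp_preimage.
rewrite (_ : _ \o _ = id); last by apply/funext; exact: cons_rVK.
by rewrite product_measure1E// lte_mul_pinfty// ge0_fin_numE.
Qed.

HB.instance Definition _ := Measure_isSigmaFinite.Build _ _ _ leb_succ
  leb_succ_sigma_finite.

End leb_succ.

Fixpoint leb {R : realType} (n : nat) :
    {sigma_finite_measure set 'rV[R]_n -> \bar R} :=
  match n with
  | 0 => \d_(0 : 'rV[R]_0)
  | k.+1 => leb_succ (@leb R k)
  end.

Lemma leb_box (R : realType) n (a b : 'rV[R]_n) :
  (forall i, a ord0 i <= b ord0 i) ->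
  leb n [set x | forall i, a ord0 i <= x ord0 i <= b ord0 i]
  = (\prod_i (b ord0 i - a ord0 i))%:E.
Proof.
elim: n a b => [|n IH] a b ab.
  rewrite big_ord0 /= diracE mem_set//= => -[]//.
rewrite big_ord_recl /= /leb_succ /pushforward.
pose a' : 'rV[R]_n := \row_j a ord0 (lift ord0 j).
pose b' : 'rV[R]_n := \row_j b ord0 (lift ord0 j).
rewrite (_ : _ @^-1` _ = `[a ord0 ord0, b ord0 ord0]%classic `*`
   [set x : 'rV[R]_n | forall i, a' ord0 i <= x ord0 i <= b' ord0 i]); last first.
  apply/seteqP; split=> [[x y]/= H|[x y] /= [Hx Hy] i].
    split=> [|i] /=; first by have := H ord0; rewrite mxE unlift_none in_itv.
    by have := H (lift ord0 i); rewrite !mxE liftK.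
  rewrite mxE; have [j ->|->] := unliftP ord0 i; last by move: Hx; rewrite in_itv.
  by have := Hy j; rewrite !mxE.
rewrite product_measure1E//=.
  rewrite lebesgue_measure_itv/= lte_fin IH; last by move=> i; rewrite !mxE.
  under [X in (_ * X%:E)%E]eq_bigr => i _ do rewrite !mxE.
  have [ab0|] := ltP; first by rewrite -EFinB -EFinM.
  rewrite le_eqVlt ltNge ab orbF => /eqP ->.
  by rewrite mul0e subrr mul0r.
rewrite (_ : mkset _ = \bigcap_(i in [set: 'I_n])
   (coor i @^-1` `[a' ord0 i, b' ord0 i]%classic)).
  apply: fin_bigcap_measurable => // i _.
  by rewrite -[X in measurable X]setTI; exact: measurable_coor.
apply/seteqP; split=> x /= H i; first by move=> _; rewrite /= in_itv; exact: H.
by have := H i I; rewrite /= in_itv.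
Qed.

Section defs.
Context {R : realType} {n : nat}.
Local Notation V := 'rV[R]_n.
Implicit Types (Omega U : set V) (u v phi : V -> R) (g : V -> V).

Definition dot (x y : V) : R := \sum_i x ord0 i * y ord0 i.

Definition enorm (x : V) : R := Num.sqrt (dot x x).

(** Near each boundary point, [Omega] is the set of points lying above the
    graph of a Lipschitz function over the hyperplane orthogonal to some unit
    vector [nu]; only the values of [phi] on that hyperplane matter. *)
Definition lipschitz_boundary Omega : Prop :=
  forall p, (closure Omega `\` Omega°) p ->
  exists (nu : V) (phi : V -> R) (r : R),
    [/\ dot nu nu = 1, 0 < r, lipschitz phi &
        forall x, enorm (x - p) < r ->
          (Omega x <-> phi (x - dot x nu *: nu) < dot x nu)].

Definition partial (i : 'I_n) u : V -> R := 'D_(delta_mx ord0 i) u.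

(** [u] is of class C^k on the open set [U]. *)
Fixpoint class_C (k : nat) U u : Prop :=
  {in U, continuous u} /\
  if k is k'.+1 then
    forall i, (forall x, U x -> derivable u x (delta_mx ord0 i)) /\
              class_C k' U (partial i u)
  else True.

(** C_0^infty(Omega) *)
Definition test_fun Omega : set (V -> R) := [set phi |
  (forall k, class_C k setT phi) /\
  compact (closure [set x | phi x != 0]) /\
  closure [set x | phi x != 0] `<=` Omega].

Definition locally_integrable_on Omega u : Prop :=
  forall K, compact K -> K `<=` Omega -> (leb n).-integrable K (EFin \o u).

Definition weak_gradient Omega u g : Prop :=
  forall i, locally_integrable_on Omega (coor i \o g) /\
  forall phi, test_fun Omega phi ->
    (\int[leb n]_(x in Omega) (u x * partial i phi x)%:E =
     - \int[leb n]_(x in Omega) (coor i (g x) * phi x)%:E)%E.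

(** The weak gradient, unique up to a null set, chosen among its
    representatives; it is the junk value 0 when there is none. *)
Definition grad Omega u : V -> V :=
  xget (fun=> 0) [set g | weak_gradient Omega u g].

Definition Lp (p : \bar R) Omega : set (V -> R) :=
  [set u | u \_ Omega \in Lfun (leb n) p].

(** W^{1,p}(Omega) and its norm *)
Definition W1 (p : \bar R) Omega : set (V -> R) :=
  [set u | Lp p Omega u /\
     exists g, weak_gradient Omega u g /\ forall i, Lp p Omega (coor i \o g)].

Definition W1_norm (p : \bar R) Omega u : \bar R :=
  ('N[leb n]_p[EFin \o (u \_ Omega)] +
   \sum_i 'N[leb n]_p[EFin \o ((coor i \o grad Omega u) \_ Omega)])%E.

(** The closure of C_0^infty(Omega) in W^{1,1}(Omega), intersected with
    W^{1,infty}(Omega). *)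
Definition W10_infty Omega : set (V -> R) :=
  [set u | W1 1%E Omega u /\
     forall e : R, 0 < e ->
       exists2 phi, test_fun Omega phi & (W1_norm 1%E Omega (u \- phi)%R < e%:E)%E]
  `&` W1 +oo%E Omega.

Definition C1piec Omega : set (V -> R) :=
  [set u | W1 +oo%E Omega u /\
     exists omega : (set V)^nat,
       [/\ forall h, open (omega h) /\ omega h `<=` Omega,
           trivIset setT omega,
           leb n (Omega `\` \bigcup_h omega h) = 0%E &
           forall h, class_C 1 (omega h) u]].

Implicit Types F G : V -> \bar R.

Definition sublevel F (c : R) : set V := [set xi | (F xi <= c%:E)%E].

Definition level_convex F : Prop := forall c, convex_set (sublevel F c).

Definition lower_semicont F : Prop := forall c, closed (sublevel F c).

Definition lslc F : V -> \bar R := fun xi =>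
  ereal_sup [set G xi | G in
    [set G | [/\ lower_semicont G, level_convex G &
                 forall eta, (G eta <= F eta)%E]]].

(** ess sup over Omega of F(grad u): outside [Omega] the function is given the
    value -oo, which does not contribute. *)
Definition energy F Omega u : \bar R :=
  ess_sup (leb n) (patch (cst -oo%E) Omega (F \o grad Omega u)).

Definition admissible Omega (u0 : V -> R) : set (V -> R) :=
  [set u0 \+ w | w in W10_infty Omega].

Definition solution F Omega (u0 u : V -> R) : Prop :=
  admissible Omega u0 u /\
  energy F Omega u = ereal_inf (energy F Omega @` admissible Omega u0).

End defs.

(* Main.v *)
From HB Require Import structures.
Require Import Defs.
From mathcomp Require Import all_boot all_order all_algebra.
From mathcomp Require Import all_classical all_reals all_analysis.
From mathcomp Require Import ess_sup_inf measurable_realfun.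
From mathcomp Require Import ring lra.

Set Implicit Arguments.
Unset Strict Implicit.
Unset Printing Implicit Defensive.

Import Order.TTheory GRing.Theory Num.Theory.
Import numFieldNormedType.Exports.

Local Open Scope classical_set_scope.
Local Open Scope ring_scope.

(** Let [m] be the infimum of the relaxed problem, attained at [ubar].  Since the
    envelope of [f] is at most [f], it suffices to find an admissible [u] such that
    [f (grad u) <= m] almost everywhere.

    The gradient of [ubar] takes its values in the sublevel set of level [m] of the
    envelope.  Consider a value [xi0] of this gradient at which [f] exceeds [m].
    Near [xi0] the envelope is less than [f], hence constant by hypothesis, and the
    sublevel set contains a ball around [xi0].  In every direction this set is no
    wider than the set [f <= m], because half-spaces are level convex
    ([lslc_support]).  So [xi0] is interior to the convex hull of finitely many
    points [xi] with [f xi <= m] ([lslc_const_span]).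

    Let [x0] be a point where [ubar] is continuously differentiable with gradient
    [xi0].  The cone with apex [x0] given by the maximum of the linear forms [xi]
    grows faster than [ubar] in all directions.  Lowered by a small height, it
    therefore crosses the graph of [ubar] along the boundary of a small compact
    neighbourhood of [x0], and replacing [ubar] by the cone inside moves the gradient
    to the points [xi] ([pyramid_exists]).  As [ubar] need not be affine near [x0],
    these neighbourhoods have no prescribed shape; but they occupy a proportion of
    the cubes around [x0] that is bounded below locally uniformly, and a Vitali
    argument exhausts by disjoint ones, up to a null set, the open set where [f] has
    to be decreased ([exhaustion_cover]).

    Each correction is Lipschitz with compact carrier in [Omega], so that its
    mollifications show that it is in W_0^{1,1} ([lipschitz_grad_W11_0]).  The sum of
    the corrections is bounded, with bounded gradient, and is the limit in W^{1,1} of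
    its partial sums ([lipschitz_grad_series]); it is therefore in W_0^{1,infty}, and
    subtracting it from [ubar] gives [u].

    Gradients here are weak gradients, chosen up to null sets.  They are unique by
    the fundamental lemma of the calculus of variations ([test_functions_separate])
    and agree with the classical ones wherever the function is continuously
    differentiable ([class_C1_weak_gradient]). *)

(** * Cubes, boxes and the Borel sets of R^n *)

Section leb_basics.
Context {R : realType} {n : nat}.
Local Notation V := 'rV[R]_n.
Local Notation mu := (@leb R n).
Implicit Types (x y a b : V) (A : set V).

Lemma normrV_leP x (r : R) : 0 <= r ->
  (`|x| <= r) <-> (forall i, `|x ord0 i| <= r).
Proof.
move=> r0; rewrite [`|x|]/Num.norm /= mx_normrE; split.
  move=> /bigmax_leP[_ H] i; exact: (H (ord0, i) isT).
by move=> H; apply/bigmax_leP; split=> // -[i j] _ /=; rewrite (ord1 i).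
Qed.

Lemma normrV_ltP x (r : R) : 0 < r ->
  (`|x| < r) <-> (forall i, `|x ord0 i| < r).
Proof.
move=> r0; rewrite [`|x|]/Num.norm /= mx_normrE; split.
  move=> /bigmax_ltP[_ H] i; exact: (H (ord0, i) isT).
by move=> H; apply/bigmax_ltP; split=> // -[i j] _ /=; rewrite (ord1 i).
Qed.

Lemma le_coord_norm x i : `|x ord0 i| <= `|x|.
Proof. by have /normrV_leP := lexx `|x|; apply. Qed.

Definition box a b : set V := [set x | forall i, a ord0 i <= x ord0 i <= b ord0 i].

Lemma measurable_box a b : measurable (box a b).
Proof.
rewrite (_ : box a b = \bigcap_(i in [set: 'I_n])
   (coor i @^-1` `[a ord0 i, b ord0 i]%classic)).
  apply: fin_bigcap_measurable => // i _.
  by rewrite -[X in measurable X]setTI; exact: measurable_coor.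
apply/seteqP; split=> x /= H i; first by move=> _; rewrite /= in_itv; exact: H.
by have := H i I; rewrite /= in_itv.
Qed.

(** Closed balls of the sup norm: their Lebesgue measure is explicit, which
    makes them the pieces of the covering arguments. *)
Definition cube x (r : R) : set V := [set y | `|y - x| <= r].

Lemma cubeE x (r : R) : 0 <= r ->
  cube x r = box (x - const_mx r) (x + const_mx r).
Proof.
move=> r0; apply/seteqP; split=> y /=.
  move=> /normrV_leP-/(_ r0) H i; have := H i.
  by rewrite !mxE ler_distl.
by move=> H; apply/normrV_leP => // i; have := H i; rewrite !mxE ler_distl.
Qed.

Lemma measurable_cube x (r : R) : 0 <= r -> measurable (cube x r).
Proof. by move=> r0; rewrite cubeE//; exact: measurable_box. Qed.

Lemma leb_cube x (r : R) : 0 <= r -> mu (cube x r) = ((r *+ 2) ^+ n)%:E.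
Proof.
move=> r0; rewrite cubeE// leb_box; last first.
  by move=> i; rewrite !mxE lerD2l; apply: le_trans (r0); rewrite oppr_le0.
congr EFin; rewrite -[in RHS](card_ord n) -prodr_const; apply: eq_bigr => i _.
rewrite !mxE mulr2n; ring.
Qed.

Lemma box_sub_cube a b : box a b `<=` cube 0 (`|a| + `|b|).
Proof.
move=> x H; rewrite /cube /= subr0; apply/normrV_leP; first exact: addr_ge0.
move=> i; have := H i; have := le_coord_norm a i; have := le_coord_norm b i.
rewrite !ler_norml => /andP[? ?] /andP[? ?] /andP[? ?].
have := normr_ge0 a; have := normr_ge0 b; lra.
Qed.

Lemma open_cube A x : open A -> A x -> exists2 r : R, 0 < r & cube x r `<=` A.
Proof.
move=> oA Ax; have /nbhs_ballP[e /= e0 eA] : nbhs x A by apply: open_nbhs_nbhs.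
exists (e / 2); first by rewrite divr_gt0.
move=> y /= yx; apply: eA; rewrite -ball_normE /= distrC.
by apply: (le_lt_trans yx); rewrite ltr_pdivrMr// ltr_pMr// ltr1n.
Qed.

(** Cubes with rational centres and radii [1/k]. The doubled cube leaves room to
    approximate from outside, by test functions, the indicators of boxes
    contained in the small one. *)
Lemma cube_basis : exists (c : nat -> V) (r : nat -> R), (forall k, 0 < r k) /\
  forall A x, open A -> A x ->
    exists k, cube (c k) (r k) x /\ cube (c k) (r k *+ 2) `<=` A.
Proof.
pose q k := odflt (0 : 'rV[rat]_n, 0%N) (unpickle k).
exists (fun k => map_mx (@ratr R) (q k).1), (fun k => (q k).2.+1%:R^-1).
split=> [k|A x oA Ax]; first by rewrite invr_gt0.
have /nbhs_ballP[e /= e0 eA] : nbhs x A by apply: open_nbhs_nbhs.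
have [k _ /(_ k (leqnn k)) ke] := near_infty_natSinv_lt (PosNum (divr_gt0 e0 (ltr0Sn R 2))).
set d : R := k.+1%:R^-1 in ke; have d0 : 0 < d by rewrite invr_gt0.
have /choice[p pP] : forall i, exists q : rat, `|x ord0 i - ratr q| < d.
  move=> i; have [|p] := @rat_in_itvoo R (x ord0 i - d) (x ord0 i + d).
    by rewrite ltrD2l gtrN.
  by rewrite in_itv /= => H; exists p; rewrite distrC ltr_distl.
have xq : `|x - map_mx (@ratr R) (\row_i p i)| < d.
  by apply/normrV_ltP => // i; rewrite !mxE; exact: pP.
exists (pickle (\row_i p i, k)); rewrite /q pickleK /= -/d; split; first exact: ltW.
move=> y /= yq; apply: eA; rewrite -ball_normE /= distrC.
rewrite -(subrKA (map_mx (@ratr R) (\row_i p i))).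
apply: (le_lt_trans (ler_normD _ _)); rewrite /cube /= in yq.
rewrite [X in _ + X]distrC; rewrite /= ltr_pdivlMr// in ke.
apply: lt_le_trans (ltW ke); rewrite mulr2n in yq; rewrite (_ : d * 3 = (d + d) + d); last by ring.
exact: ler_ltD.
Qed.

Lemma compact_cube x (r : R) : compact (cube x r).
Proof.
apply: bounded_closed_compact.
  exists (`|x| + `|r|); split; first by [].
  move=> M HM y /= yx; rewrite -(subrK x y); apply: le_trans (ler_normD _ _) _.
  apply: le_trans (ltW HM); rewrite addrC lerD2l; apply: le_trans yx (ler_norm _).
rewrite (_ : cube x r = (fun y : V => `|y - x|) @^-1` [set z | z <= r])//.
apply: preimage_closed; last exact: closed_le.
move=> y _; apply: (@continuous_comp _ _ _ (fun y : V => y - x) (fun z : V => `|z|)).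
  by apply: continuousB; [exact: cvg_id|exact: cst_continuous].
exact: norm_continuous.
Qed.

Lemma open_sigma_compact A : open A -> exists D : nat -> set V,
  (forall k, [/\ compact (D k), measurable (D k) & D k `<=` A]) /\ \bigcup_k D k = A.
Proof.
move=> oA; have [c [r [r0 H]]] := cube_basis.
have cK k : cube (c k) (r k) `<=` cube (c k) (r k *+ 2).
  by move=> x cx; apply: le_trans cx _; rewrite mulr2n lerDl ltW.
pose D k := [set y | cube (c k) (r k) y /\ cube (c k) (r k *+ 2) `<=` A].
exists D; split=> [k|]; last first.
  apply/seteqP; split=> [x [k _ [/= /cK cx]]|x Ax]; first exact.
  by have [k [h1 h2]] := H _ _ oA Ax; exists k.
have [cA|cA] := pselect (cube (c k) (r k *+ 2) `<=` A).
  have -> : D k = cube (c k) (r k) by apply/seteqP; split=> [y []|y].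
  split; [exact: compact_cube|by apply: measurable_cube; exact: ltW|].
  exact: subset_trans (cK k) cA.
have -> : D k = set0 by apply/seteqP; split=> [y []|y].
by split=> //; exact: compact0.
Qed.

Lemma open_rV_measurable A : open A -> measurable A.
Proof.
move=> /open_sigma_compact[D [DP <-]].
by apply: bigcupT_measurable => k; have [] := DP k.
Qed.

Lemma closed_rV_measurable A : closed A -> measurable A.
Proof. by move=> /closed_openC/open_rV_measurable/measurableC; rewrite setCK. Qed.

Lemma compact_rV_closed A : compact A -> closed A.
Proof. by apply: compact_closed; exact: norm_hausdorff. Qed.

Lemma compact_rV_measurable A : compact A -> measurable A.
Proof. by move=> /compact_rV_closed/closed_rV_measurable. Qed.

Lemma open_continuous_measurable_rV A (f : V -> R) : open A ->
  {in A, continuous f} -> measurable_fun A f.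
Proof.
move=> oA cf; apply: (measurability _ (RGenOpens.measurableE R)).
move=> _ [_ [a [b ->] <-]]; apply: open_rV_measurable.
rewrite openE => x [Ax fx]; apply: filterI; first exact: open_nbhs_nbhs.
apply: cf; first exact: mem_set.
by apply: open_nbhs_nbhs; split => //; exact: interval_open.
Qed.

Lemma continuous_rV_measurable (f : V -> R) :
  continuous f -> measurable_fun setT f.
Proof. by move=> cf; apply: open_continuous_measurable_rV => //; exact: openT. Qed.

Lemma bounded_sub_cube A : bounded_set A -> exists2 r : R, 0 < r & A `<=` cube 0 r.
Proof.
move=> [M [_ HM]]; exists (`|M| + 1); first by rewrite ltr_wpDl.
move=> x Ax; rewrite /cube /= subr0.
by apply: (HM (`|M| + 1)) => //; apply: le_lt_trans (ler_norm M) _; rewrite ltrDl.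
Qed.

Lemma bounded_leb_lty A : measurable A -> bounded_set A -> (mu A < +oo)%E.
Proof.
move=> mA /bounded_sub_cube[r r0 Ar].
apply: (@le_lt_trans _ _ (mu (cube 0 r))).
  by apply: le_measure => //; rewrite inE//; apply: measurable_cube; exact: ltW.
by rewrite leb_cube ?ltry//; exact: ltW.
Qed.

Lemma compact_leb_lty A : compact A -> (mu A < +oo)%E.
Proof.
move=> cA; apply: bounded_leb_lty; first exact: compact_rV_measurable.
exact: compact_bounded.
Qed.

(** Closed boxes are a pi-system generating the Borel sets of R^n, and
    exhausting the space: measures are determined by their values on boxes. *)
Definition boxes : set (set V) := [set A | exists a b, A = box a b].

Lemma boxes_setI : setI_closed boxes.
Proof.
move=> _ _ [a [b ->]] [c [d ->]].
exists (\row_i Num.max (a ord0 i) (c ord0 i)), (\row_i Num.min (b ord0 i) (d ord0 i)).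
apply/seteqP; split => [x [H1 H2] i|x H].
  have /andP[h1 h2] := H1 i; have /andP[h3 h4] := H2 i.
  by rewrite !mxE ge_max le_min h1 h2 h3 h4.
split=> i; have := H i; rewrite !mxE ge_max le_min.
  by move=> /andP[/andP[-> _] /andP[-> _]].
by move=> /andP[/andP[_ ->] /andP[_ ->]].
Qed.

Let e_ (k : nat) : V := const_mx k%:R.

Lemma bigcup_box : \bigcup_k box (- e_ k) (e_ k) = [set: V].
Proof.
apply/seteqP; split => // x _.
exists (Num.trunc `|x|).+1 => // i; rewrite !mxE -ler_norml.
apply: le_trans (le_coord_norm _ _) _; exact/ltW/truncnS_gt.
Qed.

(** The half-spaces [r <= x_i] generate the Borel sets, and each is a countable
    union of boxes. *)
Lemma rV_measurableE : @measurable _ V = <<s boxes >>.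
Proof.
apply/seteqP; split; last first.
  apply: smallest_sub; first exact: sigma_algebra_measurable.
  by move=> _ [a [b ->]]; exact: measurable_box.
apply: smallest_sub; first exact: smallest_sigma_algebra.
rewrite -bigcup_seq; apply: bigcup_sub => i _ _ [Y mY <-].
have : measurable_fun [set: g_sigma_algebraType boxes]
  (@coor R _ (i) : g_sigma_algebraType boxes -> R).
  apply: (measurability _ (RGenCInfty.measurableE R)).
  move=> _ [_ [r ->] <-]; rewrite setTI.
  rewrite (_ : _ @^-1` _ = \bigcup_k box
    (\row_j (if j == i then r else - k%:R)) (const_mx k%:R)).
    apply: bigcupT_measurable => k; apply: sub_sigma_algebra.
    by exists (\row_j (if j == i then r else - k%:R)), (const_mx k%:R).
  apply/seteqP; split => [x|x [k _ /(_ (i))]]; last first.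
    by rewrite !mxE eqxx /= in_itv /= andbT => /andP[].
  rewrite /= in_itv /= andbT => rx.
  exists (Num.trunc `|x|).+1 => // j; rewrite !mxE.
  have : `|x ord0 j| <= (Num.trunc `|x|).+1%:R.
    by apply: le_trans (le_coord_norm _ _) _; exact/ltW/truncnS_gt.
  by rewrite ler_norml => /andP[h1 ->]; rewrite andbT; case: ifPn => [/eqP ->|].
by move=> /(_ measurableT Y mY).
Qed.

Lemma measure_unique_box (m1 m2 : {measure set V -> \bar R}) :
  (forall a b, m1 (box a b) = m2 (box a b)) ->
  (forall a b, (m1 (box a b) < +oo)%E) ->
  forall A, measurable A -> m1 A = m2 A.
Proof.
move=> m12 m1oo; apply: (@measure_unique _ _ _ boxes
  (fun k => box (- e_ k) (e_ k)) rV_measurableE boxes_setI _ bigcup_box).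
- by move=> i; exists (- e_ i), (e_ i).
- by move=> _ [a [b ->]].
- by move=> k.
Qed.

End leb_basics.

(** * Level sets, translations and hyperplanes *)

Section leb_generic.
Context {R : realType} {n : nat}.
Local Notation V := 'rV[R]_n.
Local Notation mu := (@leb R n).

(** The graph of [h] is negligible in R^{n+1}, because its vertical sections are
    points; hence almost all of its horizontal sections, which are the level
    sets of [h], are negligible. *)
Lemma leb_level_set0 (h : V -> R) (alpha beta : R) :
  measurable_fun setT h -> alpha < beta ->
  exists2 t, alpha < t < beta & mu [set x | h x = t] = 0%E.
Proof.
move=> mh ab.
pose G : set (V * R) := [set p | h p.1 = p.2].
have mG : measurable G.
  rewrite (_ : G = (fun p : V * R => h p.1 == p.2) @^-1` [set true]).
    rewrite -[X in measurable X]setTI.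
    have H : measurable_fun [set: V * R] (fun p : V * R => h p.1 == p.2).
      apply: measurable_fun_eqr => //.
      exact: measurableT_comp.
    exact: H.
  by apply/seteqP; split => [p /= /eqP|p /= /eqP].
have E : (\int[mu]_x (@lebesgue_measure R \o xsection G) x =
    \int[@lebesgue_measure R]_y (mu \o ysection G) y)%E.
  have := indic_fubini_tonelli mu (@lebesgue_measure R) mG.
  have -> : fubini_F (@lebesgue_measure R) (EFin \o \1_G) =
    (@lebesgue_measure R) \o xsection G by exact: indic_fubini_tonelli_FE.
  move=> ->; apply: eq_integral => y _.
  exact: (congr1 (@^~ y) (indic_fubini_tonelli_GE mu mG)).
have H0 : (\int[@lebesgue_measure R]_y `|(mu \o ysection G) y| = 0)%E.
  transitivity (\int[@lebesgue_measure R]_y (mu \o ysection G) y)%E.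
    by apply: eq_integral => y _; rewrite gee0_abs.
  rewrite -E; apply: integral0_eq => x _ /=.
  rewrite (_ : xsection G x = [set h x]); first exact: lebesgue_measure_set1.
  by apply/seteqP; split => y; rewrite /xsection /= inE /G /=.
have mY := measurable_fun_ysection mu mG.
have [N [mN N0 NP]] := (ae_eq_integral_abs (@lebesgue_measure R) measurableT mY).1 H0.
apply: contrapT => Hn.
have abN : `]alpha, beta[%classic `<=` N.
  move=> t /=; rewrite in_itv /= => tab; apply: NP => /= /(_ I) Ht.
  apply: Hn; exists t => //; rewrite -Ht; congr (mu _).
  by apply/seteqP; split => y; rewrite /ysection /= inE /G /=.
have mI : measurable (`]alpha, beta[%classic : set R) by exact: measurable_itv.
have : @lebesgue_measure R `]alpha, beta[%classic = 0%E.
  apply/eqP; rewrite eq_le measure_ge0 andbT -N0.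
  by apply: le_measure => //; rewrite inE.
rewrite lebesgue_measure_itv /= lte_fin ab -EFinB => -[] /eqP.
by rewrite subr_eq0 => /eqP ba; move: ab; rewrite ba ltxx.
Qed.

Lemma measurable_shift (v : V) : measurable_fun setT (fun x : V => x + v).
Proof.
apply: measurable_fun_coorP => i.
rewrite (_ : _ \o _ = fun x => coor i x + v ord0 i).
  by apply: measurable_funD => //; exact: measurable_coor.
by apply/funext => x; rewrite /coor /= mxE.
Qed.

Let shifted (v : V) : {measure set V -> \bar R} :=
  measure_function_pushforward__canonical__measure_function_Measure mu
    (measurable_shift v).

Lemma leb_box_shift (v a b : V) :
  mu [set x | box a b (x + v)] = mu (box a b).
Proof.
rewrite (_ : mkset _ = box (a - v) (b - v)); last first.
  by apply/seteqP; split=> x /= H i; have := H i; rewrite !mxE lerBlDr lerBrDr.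
have [ab|/existsNP[i /negP]] := pselect (forall i, a ord0 i <= b ord0 i).
  rewrite !leb_box//; last by move=> i; rewrite !mxE lerD2r.
  congr EFin; apply: eq_bigr => i _; rewrite !mxE; ring.
rewrite -ltNge => bai.
have box0 (c d : V) : d ord0 i < c ord0 i -> box c d = set0.
  move=> dc; apply/seteqP; split => // x /(_ i)/andP[h1 h2].
  by have := le_lt_trans (le_trans h1 h2) dc; rewrite ltxx.
by rewrite !box0 ?measure0// !mxE ltrD2r.
Qed.

(** A translate of a box is a box with the same edge lengths, and a measure is
    determined by its values on boxes. *)
Lemma leb_shift (v : V) (A : set V) : measurable A ->
  mu [set x | A (x + v)] = mu A.
Proof.
move=> mA; rewrite -[LHS]/(shifted v A).
apply: measure_unique_box mA => a b; rewrite /= /pushforward.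
  exact: leb_box_shift.
rewrite (leb_box_shift v a b); apply: (@le_lt_trans _ _ (mu (cube 0 (`|a| + `|b|)))).
  apply: le_measure; rewrite ?inE; [exact: measurable_box|exact: measurable_cube|].
  exact: box_sub_cube.
by rewrite leb_cube ?ltry// addr_ge0.
Qed.

Lemma ge0_integral_shift (v : V) (f : V -> \bar R) :
  measurable_fun setT f -> (forall x, 0 <= f x)%E ->
  (\int[mu]_x f (x + v)%R = \int[mu]_x f x)%E.
Proof.
move=> mf f0; transitivity (\int[shifted v]_x f x)%E.
  by rewrite ge0_integral_pushforward//; exact: measurable_shift.
by apply: eq_measure_integral => A mA _; exact: leb_shift.
Qed.

Lemma integrable_shift (v : V) (f : V -> R) :
  mu.-integrable setT (EFin \o f) ->
  mu.-integrable setT (EFin \o (fun x => f (x + v))).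
Proof.
move=> /integrableP[mf foo].
have mf' : measurable_fun setT (fun x : V => (f (x + v))%:E).
  by apply: (measurableT_comp mf); exact: measurable_shift.
apply/integrableP; split => //.
rewrite (ge0_integral_shift v (f := fun x => `|(EFin \o f) x|%E))//.
exact: measurableT_comp.
Qed.

Lemma Rintegral_shift (v : V) (f : V -> R) :
  mu.-integrable setT (EFin \o f) ->
  \int[mu]_x f (x + v) = \int[mu]_x f x.
Proof.
move=> intf; congr fine; transitivity (\int[shifted v]_x (f x)%:E)%E.
  rewrite integral_pushforward//; first exact: measurable_shift.
    by case/integrableP : intf.
  exact: integrable_shift.
by apply: eq_measure_integral => A mA _; exact: leb_shift.
Qed.

Lemma dotDl (x y z : V) : dot (x + y) z = dot x z + dot y z.
Proof. by rewrite /dot -big_split; apply: eq_bigr => i _; rewrite mxE mulrDl. Qed.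

Lemma dotZl (k : R) (x z : V) : dot (k *: x) z = k * dot x z.
Proof. by rewrite /dot mulr_sumr; apply: eq_bigr => i _; rewrite mxE mulrA. Qed.

Lemma dotC (x y : V) : dot x y = dot y x.
Proof. by apply: eq_bigr => i _; rewrite mulrC. Qed.

Lemma dotDr (x y z : V) : dot z (x + y) = dot z x + dot z y.
Proof. by rewrite dotC dotDl !(dotC z). Qed.

Lemma dotZr (k : R) (x z : V) : dot z (k *: x) = k * dot z x.
Proof. by rewrite dotC dotZl (dotC z). Qed.

Lemma dotNl (x y : V) : dot (- x) y = - dot x y.
Proof. by rewrite -scaleN1r dotZl mulN1r. Qed.

Lemma dotNr (x y : V) : dot y (- x) = - dot y x.
Proof. by rewrite dotC dotNl dotC. Qed.

Lemma dotBl (x y z : V) : dot (x - y) z = dot x z - dot y z.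
Proof. by rewrite dotDl dotNl. Qed.

Lemma dotBr (x y z : V) : dot z (x - y) = dot z x - dot z y.
Proof. by rewrite dotDr dotNr. Qed.

Lemma dot_ge0 (x : V) : 0 <= dot x x.
Proof. by apply: sumr_ge0 => i _; rewrite -expr2 sqr_ge0. Qed.

Lemma dot_gt0 (x : V) : x != 0 -> 0 < dot x x.
Proof.
move=> x0; rewrite lt_neqAle dot_ge0 andbT eq_sym; apply: contra x0 => /eqP H.
apply/eqP/rowP => i; rewrite mxE.
have /eqP : x ord0 i * x ord0 i = 0.
  apply: (psumr_eq0P (P := xpredT) (F := fun i => x ord0 i * x ord0 i)) => // j _.
  by rewrite -expr2 sqr_ge0.
by rewrite mulf_eq0 orbb => /eqP.
Qed.

Lemma dot_deltar (x : V) i : dot x (delta_mx ord0 i) = x ord0 i.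
Proof.
rewrite /dot (bigD1 i)//= mxE !eqxx mulr1 big1 ?addr0// => j ji.
by rewrite mxE eqxx (negPf ji) mulr0.
Qed.

Lemma le_norm_dot (x y : V) : `|dot x y| <= n%:R * `|x| * `|y|.
Proof.
apply: le_trans (ler_norm_sum _ _ _) _.
apply: le_trans (_ : \sum_(i < n) (`|x| * `|y|) <= _).
  by apply: ler_sum => i _; rewrite normrM ler_pM// le_coord_norm.
by rewrite sumr_const card_ord -[leLHS]mulr_natl -mulrA lexx.
Qed.

Lemma lip_continuous (f : V -> R) (L : R) :
  (forall x y, `|f x - f y| <= L * `|x - y|) -> continuous f.
Proof.
move=> fL x; apply/(cvgrPdist_le (FF := nbhs_filter x)) => e e0.
have L0 : 0 < `|L| + 1 by rewrite ltr_wpDl.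
near=> y; apply: le_trans (fL _ _) _.
apply: le_trans (_ : (`|L| + 1) * `|x - y| <= _).
  by rewrite ler_wpM2r// (le_trans (ler_norm L))// lerDl.
rewrite -ler_pdivlMl// mulrC; near: y.
have e'0 : 0 < e / (`|L| + 1) by rewrite divr_gt0.
by have /(cvgrPdist_le (FF := nbhs_filter x))/(_ _ e'0) := @cvg_id _ (nbhs x).
Unshelve. all: by end_near. Qed.

Lemma continuous_dot (a : V) : continuous (dot a).
Proof.
apply: (@lip_continuous _ (n%:R * `|a|)) => x y.
by rewrite -dotBr; exact: le_norm_dot.
Qed.

(** Some parallel hyperplane is negligible by [leb_level_set0], and all of them
    are translates of each other. *)
Lemma leb_hyperplane0 (a : V) (t : R) : a != 0 -> mu [set x | dot a x = t] = 0%E.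
Proof.
move=> a0; have mdot : measurable_fun setT (dot a).
  by apply: continuous_rV_measurable; exact: continuous_dot.
have [s _ <-] := leb_level_set0 mdot (@ltr01 R).
have mA : measurable [set x | dot a x = s].
  by rewrite -[X in measurable X]setTI; exact: (mdot measurableT [set s]).
rewrite -(leb_shift (((s - t) / dot a a) *: a) mA); congr (mu _).
apply/seteqP; split => x /=; rewrite dotDr dotZr divfK ?gt_eqF ?dot_gt0//; lra.
Qed.

End leb_generic.

(** * Derivatives along the axes *)

Section derivative_bounds.
Context {R : realType}.

(** First order expansion along [v], with no quotient: in this form the
    derivatives of translates and of Lipschitz functions can be estimated with
    explicit constants, and [h = 0] is not a special case. *)
Lemma is_deriveP (W : normedModType R) (f : W -> R) (x v : W) (l : R) :
  is_derive x v f l <-> (forall e, 0 < e -> exists2 d, 0 < d &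
    forall h, `|h| < d -> `|f (x + h *: v) - f x - h * l| <= e * `|h|).
Proof.
have E h : h != 0 -> `|l - h^-1 *: ((f \o shift x) (h *: v) - f x)| * `|h| =
    `|f (x + h *: v) - f x - h * l|.
  move=> h0; rewrite -normrM distrC mulrBl /= (addrC (h *: v)).
  by rewrite [_ *: _]mulrC mulfVK// (mulrC l).
split=> [fl e e0|H].
  have cm : h^-1 *: ((f \o shift x) (h *: v) - f x) @[h --> 0^'] --> l.
    have /cvg_ex[m cm] : derivable f x v by exact: (ex_derive (is_derive := fl)).
    by rewrite -(derive_val (is_derive := fl)) [X in _ --> X](cvg_lim _ cm).
  move: cm => /cvgrPdist_le/(_ e e0)[d /= d0 dP].
  exists d => // h hd; have [->|h0] := eqVneq h 0.
    by rewrite scale0r addr0 subrr mul0r subr0 normr0 mulr0.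
  have := dP h; rewrite /= sub0r normrN => /(_ hd h0).
  by rewrite -E// ler_pM2r ?normr_gt0.
have cm : h^-1 *: ((f \o shift x) (h *: v) - f x) @[h --> 0^'] --> l.
  apply/cvgrPdist_le => e e0; have [d d0 dP] := H e e0.
  exists d => //= h; rewrite /= sub0r normrN => hd h0.
  by have := dP h hd; rewrite -E// ler_pM2r ?normr_gt0.
by split; [apply/cvg_ex; exists l|apply: cvg_lim cm].
Qed.

Lemma is_derive_line (W : normedModType R) (f : W -> R) (x v : W) (t l : R) :
  is_derive (x + t *: v) v f l -> is_derive t (1 : R) (fun s => f (x + s *: v)) l.
Proof.
move=> /is_deriveP H; apply/is_deriveP => e /H[d d0 dP]; exists d => // h hd.
by have := dP h hd; rewrite /= [h *: 1]mulr1 scalerDl addrA.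
Qed.

Lemma is_derive_bound (f df : R -> R) (M a b : R) : a <= b ->
  (forall t, a <= t <= b -> is_derive t (1 : R) f (df t) /\ `|df t| <= M) ->
  `|f b - f a| <= M * (b - a).
Proof.
move=> ab H; have [|t|c] := @MVT_segment R f df a b ab.
- by move=> t; rewrite in_itv /= => /andP[/ltW h1 /ltW h2]; apply: (H t _).1; rewrite h1.
- apply: derivable_within_continuous => x; rewrite in_itv /= => Hx.
  exact: (@ex_derive _ _ _ _ _ _ _ (H x Hx).1).
rewrite in_itv /= => /H[_ Hc] ->; rewrite normrM (ger0_norm (x := b - a)) ?subr_ge0//.
by apply: ler_wpM2r => //; rewrite subr_ge0.
Qed.

Context {n : nat}.
Local Notation V := 'rV[R]_n.
Local Notation e_ i := (delta_mx ord0 i : V).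

Lemma line_bound (f : V -> R) (x v : V) (t M : R) :
  (forall s, 0 <= s <= 1 ->
     derivable f (x + (s * t) *: v) v /\ `|'D_v f (x + (s * t) *: v)| <= M) ->
  `|f (x + t *: v) - f x| <= M * `|t|.
Proof.
move=> H.
have := @is_derive_bound (fun s => f (x + s *: (t *: v)))
  (fun s => t * 'D_v f (x + s *: (t *: v))) (M * `|t|) 0 1 (@ler01 R).
rewrite scale1r scale0r addr0 subr0 mulr1; apply=> s /H[/derivableP h1 h2].
split; last by rewrite scalerA normrM mulrC ler_wpM2r.
apply: is_derive_line; rewrite scalerA; apply/is_deriveP => e e0.
have t1 : 0 < `|t| + 1 by rewrite ltr_wpDl.
have /(is_deriveP f _ v) := h1; move=> /(_ (e / (`|t| + 1))).
rewrite divr_gt0// => /(_ isT)[d d0 dP].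
exists (d / (`|t| + 1)); first by rewrite divr_gt0.
move=> h; rewrite ltr_pdivlMr// => hd.
have htd : `|h * t| < d.
  rewrite normrM; apply: le_lt_trans hd; apply: ler_wpM2l => //.
  by rewrite lerDl.
rewrite [h *: (t *: v)]scalerA mulrA; apply: le_trans (dP _ htd) _.
rewrite normrM mulrAC ler_pdivrMr// -mulrA.
apply: ler_wpM2l; first exact: ltW.
by apply: ler_wpM2l => //; rewrite lerDl.
Qed.

(** A cube is stable under replacing coordinates one at a time: moving from [y]
    to [x] along the axes uses the partial derivatives only, at points of the
    cube. *)
Lemma cube_lipschitz (f : V -> R) (c : V) (r M : R) : 0 <= M ->
  (forall z, cube c r z -> forall i, derivable f z (e_ i) /\ `|partial i f z| <= M) ->
  forall x y, cube c r x -> cube c r y -> `|f x - f y| <= n%:R * M * `|x - y|.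
Proof.
move=> M0 H x y cx cy.
have r0 : 0 <= r by apply: le_trans cx.
pose z (k : nat) : V := \row_i (if (i < k)%N then x ord0 i else y ord0 i).
have z0 : z 0%N = y by apply/rowP => i; rewrite mxE.
have zn : z n = x by apply/rowP => i; rewrite mxE ltn_ord.
have zS (k : 'I_n) : z k.+1 = z k + (x ord0 k - y ord0 k) *: e_ k.
  apply/rowP => i; rewrite !mxE ltnS leq_eqVlt eqxx /=.
  have [ik|ik] := eqVneq (i : nat) k.
    have -> : i = k by exact/val_inj.
    by rewrite ltnn eqxx mulr1 subrKC.
  have /negPf-> : i != k by apply: contra ik => /eqP ->.
  by rewrite mulr0 addr0.
have step (k : nat) : (k <= n)%N -> `|f (z k) - f y| <= k%:R * M * `|x - y|.
  elim: k => [_|k IH kn]; first by rewrite z0 subrr normr0 !mul0r.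
  rewrite -(subrKA (f (z k))); apply: le_trans (ler_normD _ _) _.
  rewrite -natr1 mulrDl mulrDl mul1r addrC lerD//; first exact: IH (ltnW kn).
  rewrite (zS (Ordinal kn)) /=.
  apply: le_trans (_ : M * `|x ord0 (Ordinal kn) - y ord0 (Ordinal kn)| <= _).
    apply: line_bound => s /andP[s0 s1]; apply: H.
    apply/normrV_leP => // i; rewrite !mxE eqxx /=.
    move/normrV_leP : cx => /(_ r0 i); move/normrV_leP : cy => /(_ r0 i).
    rewrite !mxE.
    have [->|] := eqVneq i (Ordinal kn); last by move=> _; rewrite mulr0 addr0; case: ifP.
    rewrite /= ltnn mulr1 => h1 h2.
    rewrite (_ : _ - _ = (1 - s) * (y ord0 (Ordinal kn) - c ord0 (Ordinal kn))
      + s * (x ord0 (Ordinal kn) - c ord0 (Ordinal kn))); last by ring.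
    apply: le_trans (ler_normD _ _) _; rewrite !normrM (ger0_norm s0).
    rewrite (ger0_norm (x := 1 - s)) ?subr_ge0//.
    have s1' : 0 <= 1 - s by rewrite subr_ge0.
    by have := ler_wpM2l s1' h1; have := ler_wpM2l s0 h2; nra.
  apply: ler_wpM2l => //; have := le_coord_norm (x - y) (Ordinal kn).
  by rewrite !mxE.
by have := step n (leqnn n); rewrite zn.
Qed.

Lemma partial_lipschitz (f : V -> R) (M : R) : 0 <= M ->
  (forall z i, derivable f z (e_ i) /\ `|partial i f z| <= M) ->
  forall x y, `|f x - f y| <= n%:R * M * `|x - y|.
Proof.
move=> M0 H x y; apply: (@cube_lipschitz f 0 (`|x| + `|y|)) => //.
  by rewrite /cube /= subr0 lerDl.
by rewrite /cube /= subr0 lerDr.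
Qed.

End derivative_bounds.

Section smooth.
Context {R : realType} {n : nat}.
Local Notation V := 'rV[R]_n.
Local Notation e_ i := (delta_mx ord0 i : V).
Implicit Types (u v : V -> R) (k : nat).

Lemma class_C_cont k u : class_C k setT u -> continuous u.
Proof. by case: k => [|k] [H _] x; apply: H; rewrite in_setT. Qed.

Lemma class_CW k (U : set V) u : class_C k.+1 U u -> class_C k U u.
Proof.
elim: k u => [|k IH] u [cu H]; first by split.
split => // i; have [d1 C] := H i; split => //; exact: IH.
Qed.

Lemma class_CS k u : (forall i, exists du, (forall x, is_derive x (e_ i) u (du x))
     /\ class_C k setT du) -> continuous u -> class_C k.+1 setT u.
Proof.
move=> H cu; split; first by move=> x _; exact: cu.
move=> i; have [du [H1 H2]] := H i; split=> [x _|].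
  exact: (@ex_derive _ _ _ _ _ _ _ (H1 x)).
rewrite (_ : partial i u = du)//; apply/funext => x.
exact: (@derive_val _ _ _ _ _ _ _ (H1 x)).
Qed.

Lemma class_C_derive k u i x : class_C k.+1 setT u ->
  is_derive x (e_ i) u (partial i u x).
Proof. by move=> [_ /(_ i)[H _]]; apply/derivableP; exact: H. Qed.

Lemma class_C_partial k u i : class_C k.+1 setT u -> class_C k setT (partial i u).
Proof. by move=> [_ /(_ i)[]]. Qed.

Lemma class_C_cst k (c : R) : class_C k setT (cst c : V -> R).
Proof.
elim: k c => [|k IH] c; first by split=> // x _; exact: cst_continuous.
apply: class_CS; last exact: cst_continuous.
by move=> i; exists (cst 0); split => // x; exact: is_derive_cst.
Qed.

Lemma class_CD k u v : class_C k setT u -> class_C k setT v ->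
  class_C k setT (fun x => u x + v x).
Proof.
elim: k u v => [|k IH] u v Hu Hv.
  by split=> // x _; exact: (continuousD (@class_C_cont _ _ Hu x) (@class_C_cont _ _ Hv x)).
apply: class_CS; last by move=> x;
  exact: (continuousD (@class_C_cont _ _ Hu x) (@class_C_cont _ _ Hv x)).
move=> i; exists (fun x => partial i u x + partial i v x); split.
  move=> x; have h1 := class_C_derive i x Hu; have h2 := class_C_derive i x Hv.
  exact: is_deriveD.
by apply: IH; [exact: class_C_partial Hu|exact: class_C_partial Hv].
Qed.

Lemma class_CM k u v : class_C k setT u -> class_C k setT v ->
  class_C k setT (fun x => u x * v x).
Proof.
elim: k u v => [|k IH] u v Hu Hv.
  by split=> // x _; exact: (continuousM (@class_C_cont _ _ Hu x) (@class_C_cont _ _ Hv x)).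
apply: class_CS; last by move=> x;
  exact: (continuousM (@class_C_cont _ _ Hu x) (@class_C_cont _ _ Hv x)).
move=> i; exists (fun x => u x * partial i v x + v x * partial i u x); split.
  move=> x; have h1 := class_C_derive i x Hu; have h2 := class_C_derive i x Hv.
  exact: is_deriveM.
apply: class_CD; apply: IH; try exact: class_C_partial.
  exact: class_CW.
exact: class_CW.
Qed.

Lemma class_CZ k (c : R) u : class_C k setT u -> class_C k setT (fun x => c * u x).
Proof. by apply: class_CM; exact: class_C_cst. Qed.

Lemma class_C_prod k (I : Type) (s : seq I) (F : I -> V -> R) :
  (forall i, class_C k setT (F i)) -> class_C k setT (fun x => \prod_(i <- s) F i x).
Proof.
move=> H; elim: s => [|i s IH].
  rewrite (_ : (fun _ => _) = cst 1); first exact: class_C_cst.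
  by apply/funext => x; rewrite big_nil.
rewrite (_ : (fun _ => _) = fun x => F i x * \prod_(i <- s) F i x).
  exact: class_CM.
by apply/funext => x; rewrite big_cons.
Qed.

(** The derivatives of [exp (-1/t)], extended by 0, are combinations of the
    functions [t^-m exp (-1/t)], which therefore form a family closed under
    differentiation. *)
Definition flat (m : nat) (t : R) : R :=
  if 0 < t then t^-1 ^+ m * expR (- t^-1) else 0.

(** The exponential series at [s = 1/t] gives [exp s >= s^(m+2) / (m+2)!]. Since
    the bound is quadratic, the extension by 0 is differentiable at 0, with
    derivative 0. *)
Lemma flat_quadratic m t : `|flat m t| <= m.+2`!%:R * t ^+ 2.
Proof.
have F0 : 0 < m.+2`!%:R :> R by rewrite ltr0n fact_gt0.
rewrite /flat; case: ifPn => [t0|_]; last first.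
  by rewrite normr0 mulr_ge0 ?sqr_ge0// ltW.
have s0 : 0 < t^-1 by rewrite invr_gt0.
have H0 : 0 <= t^-1 ^+ m * expR (- t^-1).
  by rewrite mulr_ge0 ?expR_ge0// exprn_ge0// ltW.
rewrite (ger0_norm H0) expRN ler_pdivrMr ?expR_gt0//.
apply: le_trans (_ : m.+2`!%:R * t ^+ 2 * (t^-1 ^+ m.+2 / m.+2`!%:R) <= _).
  rewrite le_eqVlt; apply/orP; left; apply/eqP.
  rewrite [_ ^+ m.+2]exprS [_ ^+ m.+1]exprS.
  rewrite [RHS](_ : _ = (m.+2`!%:R / m.+2`!%:R) * (t / t) ^+ 2 * t^-1 ^+ m).
    by rewrite (divff (lt0r_neq0 F0)) (divff (lt0r_neq0 t0)) expr1n !mul1r.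
  by ring.
apply: ler_wpM2l; first by rewrite mulr_ge0 ?sqr_ge0// ltW.
by apply: le_trans (expR_ge1Dxn m.+1 (ltW s0)); rewrite lerDr.
Qed.

Lemma is_derive_flat m t :
  is_derive t (1 : R) (flat m) (flat m.+2 t - m%:R * flat m.+1 t).
Proof.
have [t0|t0|->] := ltgtP t 0.
- have f0 k s : s <= 0 -> flat k s = 0.
    by move=> s0; rewrite /flat ifF//; apply/negbTE; rewrite -leNgt.
  rewrite !f0 ?ltW// mulr0 subr0.
  apply: (@near_eq_is_derive _ _ _ (cst (0 : R))).
  by near=> s; rewrite f0//; apply: ltW; near: s; exact: lt_nbhsl.
- pose g (y : R) := y ^+ m * expR (- y).
  apply: (@near_eq_is_derive _ _ _ (g \o (fun s => s^-1))).
    near=> s; rewrite /flat ifT//; near: s; exact: lt_nbhsr.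
  have h1 : is_derive t (1 : R) (fun s : R => s^-1) (- t ^- 2).
    apply: is_derive_eq; first by apply: is_deriveV; rewrite gt_eqF.
    by rewrite [_ *: _]mulr1.
  have h2 : is_derive t^-1 (1 : R) g
     (t^-1 ^+ m * (- expR (- t^-1)) + expR (- t^-1) * (m%:R * t^-1 ^+ m.-1)).
    have d1 : is_derive t^-1 (1 : R) (fun y : R => expR (- y)) (- expR (- t^-1)).
      have dN : is_derive (t^-1 : R) (1 : R) (fun y : R => - y) (-1).
        exact: is_deriveN.
      have := is_derive1_comp (f := expR) (is_derive_expR (- t^-1)) dN.
      by rewrite mulrN1.
    have d2 : is_derive t^-1 (1 : R) (fun y : R => y ^+ m) (m%:R * t^-1 ^+ m.-1).
      apply: DeriveDef; first exact: exprn_derivable.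
      by rewrite exp_derive [_ *: _]mulr1.
    exact: (is_deriveM d2 d1).
  have h3 := is_derive1_comp h2 h1; apply: (is_derive_eq h3).
  rewrite /flat t0 -!exprVn; move: (t^-1) (expR _) => y E.
  by case: (m) => [|k] /=; rewrite ?exprS; ring.
have f0 k : flat k 0 = 0 by rewrite /flat ltxx.
rewrite !f0 mulr0 subr0; apply/is_deriveP => e e0.
have F0 : 0 < m.+2`!%:R :> R by rewrite ltr0n fact_gt0.
exists (e / m.+2`!%:R); first by rewrite divr_gt0.
move=> h; rewrite ltr_pdivlMr// => hd; rewrite f0 !subr0 add0r mulr0 subr0 [h *: 1]mulr1.
apply: le_trans (flat_quadratic m h) _; rewrite -real_normK ?num_real// expr2 mulrA.
by apply: ler_wpM2r => //; rewrite mulrC ltW.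
Unshelve. all: by end_near. Qed.

End smooth.

(** * Test functions *)

Section test_functions.
Context {R : realType} {n : nat}.
Local Notation V := 'rV[R]_n.
Local Notation e_ i := (delta_mx ord0 i : V).
Local Notation mu := (@leb R n).
Implicit Types (u v phi : V -> R) (k m : nat) (Omega : set V) (a b x y : V).

Lemma is_derive_flat_coord m (c d : R) (i j : 'I_n) (x : V) :
  is_derive x (e_ j) (fun y : V => flat m (c * y ord0 i + d))
    ((i == j)%:R * c * (flat m.+2 (c * x ord0 i + d) -
                        m%:R * flat m.+1 (c * x ord0 i + d))).
Proof.
have /is_deriveP H := is_derive_flat m (c * x ord0 i + d).
set l := (_ - _) in H *; apply/is_deriveP => e e0.
have c0 : 0 < `|c| + 1 by rewrite ltr_wpDl.
have [d' d'0 dP] := H _ (divr_gt0 e0 c0).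
exists (d' / (`|c| + 1)); first by rewrite divr_gt0.
move=> h; rewrite ltr_pdivlMr// => hd; rewrite !mxE /=.
have [_|_] := eqVneq i j; last first.
  rewrite mulr0 addr0 subrr !mul0r mulr0 subr0 normr0 mulr_ge0//; exact: ltW.
have cd : `|c * h| < d'.
  rewrite normrM mulrC; apply: le_lt_trans hd; apply: ler_wpM2l => //.
  by rewrite lerDl.
have := dP _ cd; rewrite [_ *: 1]mulr1 => HH.
rewrite mulr1 mulrDr (addrAC (c * _)) mul1r.
rewrite (_ : h * (c * l) = c * h * l); last by ring.
apply: le_trans HH _; rewrite normrM mulrAC ler_pdivrMr// -mulrA (mulrC `|c|).
apply: ler_wpM2l; first exact: ltW.
by apply: ler_wpM2l => //; rewrite lerDl.
Qed.

Lemma class_C_flat k m (c d : R) (i : 'I_n) :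
  class_C k setT (fun x : V => flat m (c * x ord0 i + d)).
Proof.
have ct m' : continuous (fun x : V => flat m' (c * x ord0 i + d)).
  move=> x; apply: (@continuous_comp _ _ _ (fun y : V => c * y ord0 i + d) (flat m')).
    apply: continuousD; last exact: cst_continuous.
    by apply: continuousM; [exact: cst_continuous|exact: coord_continuous].
  apply: differentiable_continuous; apply/derivable1_diffP.
  exact: (@ex_derive _ _ _ _ _ _ _ (is_derive_flat m' _)).
elim: k m => [|k IH] m; first by split => // x _; exact: ct.
apply: class_CS => // j; eexists; split.
  by move=> x; exact: is_derive_flat_coord.
apply: class_CZ; apply: class_CD; first exact: IH.
rewrite (_ : (fun _ => _) = fun x : V => (-1) * (m%:R * flat m.+1 (c * x ord0 i + d))).
  by do 2!apply: class_CZ; exact: IH.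
by apply/funext => x; rewrite mulN1r.
Qed.

(** Positive exactly on the open box from [a] to [b]; when [K] grows it tends
    to the indicator of that box. *)
Definition bump (a b : V) (K : R) (x : V) : R :=
  \prod_(i < n) (flat 0 (K * x ord0 i - K * a ord0 i) *
                 flat 0 (- K * x ord0 i + K * b ord0 i)).

Lemma class_C_bump k a b K : class_C k setT (bump a b K).
Proof.
apply: class_C_prod => i; apply: class_CM; first exact: class_C_flat.
exact: class_C_flat.
Qed.

Lemma flat01 (t : R) : 0 <= flat 0 t <= 1.
Proof.
rewrite /flat; case: ifPn => [t0|_]; last by rewrite lexx ler01.
rewrite expr0 mul1r expR_ge0 -[leRHS](@expR0 R) ler_expR oppr_le0 invr_ge0.
exact: ltW.
Qed.

Lemma flat_gt0 m (t : R) : (0 < flat m t) = (0 < t).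
Proof.
rewrite /flat; case: ifPn => [t0|_]; last by rewrite ltxx.
by rewrite mulr_gt0 ?expR_gt0// exprn_gt0// invr_gt0.
Qed.

Lemma bump01 a b K x : 0 <= bump a b K x <= 1.
Proof.
rewrite /bump; elim/big_ind: _ => [|y z /andP[y0 y1] /andP[z0 z1]|i _].
- by rewrite ler01 lexx.
- by rewrite mulr_ge0//= mulr_ile1.
have /andP[y0 y1] := flat01 (K * x ord0 i - K * a ord0 i).
have /andP[z0 z1] := flat01 (- K * x ord0 i + K * b ord0 i).
by rewrite mulr_ge0//= mulr_ile1.
Qed.

Lemma bump_gt0 a b K x : 0 < K ->
  (forall i, a ord0 i < x ord0 i < b ord0 i) -> 0 < bump a b K x.
Proof.
move=> K0 H; apply: prodr_gt0 => i _; have /andP[ax xb] := H i.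
rewrite mulr_gt0// flat_gt0 ?mulNr ?(addrC (- _)) subr_gt0 ltr_pM2l//.
Qed.

Lemma bump_eq0 a b K x i : 0 < K ->
  ~~ (a ord0 i < x ord0 i < b ord0 i) -> bump a b K x = 0.
Proof.
move=> K0 H; rewrite /bump (bigD1 i)//= (_ : _ * flat 0 _ = 0) ?mul0r//.
apply/eqP; rewrite mulf_eq0; rewrite negb_and -!leNgt in H.
by apply/orP; case/orP: H => H; [left|right]; rewrite /flat ifF//;
  apply/negbTE; rewrite -leNgt ?mulNr ?(addrC (- _)) subr_le0 ler_pM2l.
Qed.

Lemma bump_supp a b K : 0 < K -> closure [set x | bump a b K x != 0] `<=` box a b.
Proof.
move=> K0; have cb : closed (box a b).
  rewrite (_ : box a b = \bigcap_(i in [set: 'I_n])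
     ((fun x : V => x ord0 i) @^-1` `[a ord0 i, b ord0 i]%classic)).
    apply: closed_bigI => i _; apply: preimage_closed; last exact: itv_closed.
    by move=> x _; exact: coord_continuous.
  apply/seteqP; split=> x /= H i; first by move=> _; rewrite /= in_itv; exact: H.
  by have := H i I; rewrite /= in_itv.
rewrite [X in _ `<=` X](closure_id _).1//; apply: closureS => x /= + i.
apply: contraR => H; apply/eqP; apply: (bump_eq0 (i := i)) => //.
by apply: contra H => /andP[/ltW -> /ltW ->].
Qed.

Lemma sub_bounded_set (A B : set V) : A `<=` B -> bounded_set B -> bounded_set A.
Proof. by move=> AB [M [Mr HM]]; exists M; split => // N /HM H x /AB /H. Qed.

Lemma box_bounded a b : bounded_set (box a b).
Proof.
apply: sub_bounded_set (@box_sub_cube _ _ a b) _.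
by apply: compact_bounded; exact: compact_cube.
Qed.

Lemma test_bump Omega a b K : 0 < K -> box a b `<=` Omega ->
  test_fun Omega (bump a b K).
Proof.
move=> K0 abO; split; first by move=> k; exact: class_C_bump.
split; last by apply: subset_trans abO; exact: bump_supp.
apply: bounded_closed_compact; last exact: closed_closure.
exact: sub_bounded_set (bump_supp K0) (box_bounded a b).
Qed.

Lemma continuous_in_bounded (W K : set V) (h : V -> R) : {in W, continuous h} -> compact K -> K `<=` W ->
  exists2 M, 0 <= M & forall x, K x -> `|h x| <= M.
Proof.
move=> ch cK KW; have /compact_bounded[M [_ HM]] : compact (h @` K).
  apply: continuous_compact => //.
  apply: continuous_in_subspaceT => x; rewrite inE => Kx.
  by apply: ch; rewrite inE; exact: KW.
exists (`|M| + 1); first by rewrite addr_ge0.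
move=> x Kx; apply: (HM (`|M| + 1)); last by exists x.
by apply: le_lt_trans (ler_norm M) _; rewrite ltrDl.
Qed.

Lemma compact_supp_bounded (K : set V) u : compact K -> continuous u ->
  (forall x, ~ K x -> u x = 0) -> exists2 M, 0 <= M & forall x, `|u x| <= M.
Proof.
move=> cK cu u0.
have [|M M0 HM] := @continuous_in_bounded setT K u _ cK (@subsetT _ K).
  by move=> x _; exact: cu.
exists M => // x; have [Kx|/u0 ->] := pselect (K x); first exact: HM.
by rewrite normr0.
Qed.

Lemma is_derive_away0 u (K : set V) x (v : V) : closed K -> ~ K x ->
  (forall y, ~ K y -> u y = 0) -> is_derive x v u 0.
Proof.
move=> clK Kx u0; apply: (@near_eq_is_derive _ _ _ (cst (0 : R))).
have : nbhs x (~` K) by apply: open_nbhs_nbhs; split => //; exact: closed_openC.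
by apply: filterS => y Ky; rewrite u0.
Qed.

Section one_test_function.
Context (Omega : set V) (phi : V -> R).
Hypothesis tphi : test_fun Omega phi.

Lemma test_cont : continuous phi.
Proof. by case: tphi => /(_ 0%N)/class_C_cont. Qed.

Lemma test_suppP : exists K : set V, [/\ compact K, K `<=` Omega &
  forall x, ~ K x -> phi x = 0 /\ forall i, partial i phi x = 0].
Proof.
case: tphi => _ [cK KO]; exists (closure [set x | phi x != 0]); split => // x Kx.
have z y : ~ closure [set x | phi x != 0] y -> phi y = 0.
  move=> H; apply/eqP; apply: contrapT => /negP h; apply: H; exact: subset_closure.
split; first exact: z.
move=> i; apply: (@derive_val _ _ _ _ _ _ _ (is_derive_away0 _ _ Kx z)).
exact: closed_closure.
Qed.

Lemma test_derive x i : is_derive x (e_ i) phi (partial i phi x).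
Proof. by case: tphi => /(_ 1%N)/class_C_derive. Qed.

Lemma test_partial i : test_fun Omega (partial i phi).
Proof.
have [K [cK KO K0]] := test_suppP; split.
  by move=> k; case: tphi => /(_ k.+1)/class_C_partial.
have S : closure [set x | partial i phi x != 0] `<=` K.
  rewrite [X in _ `<=` X](closure_id _).1//; last exact: compact_rV_closed.
  apply: closureS => x /= /eqP H; apply: contrapT => /K0[_ /(_ i)]; exact: H.
split; last exact: subset_trans KO.
by apply: subclosed_compact S => //; exact: closed_closure.
Qed.

Lemma test_bounded : exists2 M, 0 <= M & forall x, `|phi x| <= M.
Proof.
have [K [cK KO K0]] := test_suppP; apply: (compact_supp_bounded cK test_cont).
by move=> x /K0[].
Qed.

End one_test_function.

Lemma test_partial_bounded Omega phi : test_fun Omega phi ->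
  exists2 M, 0 <= M & forall i x, `|partial i phi x| <= M.
Proof.
move=> tphi.
have /choice[M MP] : forall i, exists M, 0 <= M /\ forall x, `|partial i phi x| <= M.
  by move=> i; have [M M0 MP] := test_bounded (test_partial tphi i); exists M.
exists (\sum_i M i); first by apply: sumr_ge0 => i _; have [] := MP i.
move=> i x; apply: le_trans ((MP i).2 x) _; rewrite (bigD1 i)//= lerDl.
by apply: sumr_ge0 => j _; have [] := MP j.
Qed.

Lemma test_lipschitz Omega phi : test_fun Omega phi ->
  exists2 L, 0 <= L & forall x y, `|phi x - phi y| <= L * `|x - y|.
Proof.
move=> tphi; have [M M0 MP] := test_partial_bounded tphi.
exists (n%:R * M); first by rewrite mulr_ge0.
apply: partial_lipschitz => // z i; split; last exact: MP.
exact: (@ex_derive _ _ _ _ _ _ _ (test_derive tphi z i)).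
Qed.

Lemma testB Omega phi psi : test_fun Omega phi -> test_fun Omega psi ->
  test_fun Omega (fun x => phi x - psi x).
Proof.
move=> t1 t2; have [K1 [cK1 KO1 Kz1]] := test_suppP t1.
have [K2 [cK2 KO2 Kz2]] := test_suppP t2.
have cK : compact (K1 `|` K2) by exact: compactU.
have S : closure [set x | phi x - psi x != 0] `<=` K1 `|` K2.
  rewrite [X in _ `<=` X](closure_id _).1//; last exact: compact_rV_closed.
  apply: closureS => x /= /eqP H; apply: contrapT => /not_orP[/Kz1[h1 _] /Kz2[h2 _]].
  by apply: H; rewrite h1 h2 subrr.
split; last first.
  split; first by apply: subclosed_compact S => //; exact: closed_closure.
  by apply: subset_trans S _ => x [/KO1|/KO2].
move=> k; rewrite (_ : (fun _ => _) = fun x => phi x + (-1) * psi x).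
  by apply: class_CD; [case: t1|apply: class_CZ; case: t2].
by apply/funext => x; rewrite mulN1r.
Qed.

Lemma bounded_onW (A : set V) u (M : R) : (forall x, A x -> `|u x| <= M) ->
  [bounded u x | x in A].
Proof.
move=> uM; exists M; split; first exact: num_real.
by move=> y My x Ax; apply: le_trans (uM x Ax) _; exact: ltW.
Qed.

Lemma integrable_bounded (K : set V) u (M : R) : measurable_fun setT u ->
  measurable K -> (mu K < +oo)%E -> (forall x, `|u x| <= M) ->
  (forall x, ~ K x -> u x = 0) -> mu.-integrable setT (EFin \o u).
Proof.
move=> mu_ mK Koo uM u0.
have H : mu.-integrable K (EFin \o u).
  apply: measurable_bounded_integrable => //; first exact: measurable_funTS.
  by apply: (@bounded_onW _ _ M) => x _; exact: uM.
move/(integrable_mkcond _ mK) : H; apply: eq_integrable => // x _.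
by rewrite patchE; case: ifPn => // /negP; rewrite inE => /u0 /= ->.
Qed.

Lemma integrable_cst_indic (K : set V) (M : R) : measurable K -> (mu K < +oo)%E ->
  mu.-integrable setT (EFin \o (fun x => M * \1_K x)).
Proof.
move=> mK Koo; apply: (@integrable_bounded K _ `|M|) => //.
- by apply: measurable_funM => //; exact: measurable_indic.
- move=> x; rewrite normrM indicE; case: (_ \in _); rewrite ?normr1 ?mulr1//.
  by rewrite normr0 mulr0.
- by move=> x Kx; rewrite indicE memNset// mulr0.
Qed.

Lemma integrable_test Omega phi : test_fun Omega phi ->
  mu.-integrable setT (EFin \o phi).
Proof.
move=> tphi; have [K [cK _ Kz]] := test_suppP tphi.
have [M _ MP] := test_bounded tphi.
apply: (@integrable_bounded K _ M) => //.
- by apply: continuous_rV_measurable; exact: test_cont tphi.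
- exact: compact_rV_measurable.
- exact: compact_leb_lty.
- by move=> x /Kz[].
Qed.

(** A normalised bump: its integral is positive because it is positive on a cube
    of positive measure. *)
Lemma mollifier_exists (e : R) : 0 < e -> exists rho : V -> R,
  [/\ test_fun setT rho, forall x, 0 <= rho x, forall x, rho x != 0 -> `|x| <= e &
      \int[mu]_x rho x = 1].
Proof.
move=> e0; pose b : V := const_mx e.
have tb : test_fun setT (bump (- b) b 1) by exact: test_bump.
have ib := integrable_test tb.
set c := \int[mu]_x bump (- b) b 1 x.
have cE : c%:E = (\int[mu]_x (bump (- b) b 1 x)%:E)%E.
  by rewrite fineK//; apply: integrable_fin_num ib.
have c0 : 0 < c.
  rewrite lt_neqAle Rintegral_ge0 ?andbT//; last by move=> x _; case/andP: (bump01 (- b) b 1 x).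
  apply/negP => /eqP c0; rewrite -c0 in cE.
  have H : (\int[mu]_x `|(EFin \o bump (- b) b 1) x| = 0)%E.
    apply: (etrans _ (esym cE)); apply: eq_integral => x _; rewrite /= ger0_norm//.
    by case/andP: (bump01 (- b) b 1 x).
  have mb : measurable_fun setT (EFin \o bump (- b) b 1) by case/integrableP: ib.
  have [N [mN N0 NP]] := (ae_eq_integral_abs mu measurableT mb).1 H.
  have sub : cube (0 : V) (e / 2) `<=` N.
    move=> x cx; apply: NP => /= /(_ I) [] Hx.
    have : 0 < bump (- b) b 1 x; last by rewrite Hx ltxx.
    apply: bump_gt0 => [|i]; first exact: ltr01.
    rewrite !mxE -ltr_norml.
    apply: le_lt_trans (le_coord_norm _ _) _; move: cx; rewrite /cube /= subr0.
    by move=> /le_lt_trans; apply; rewrite ltr_pdivrMr// ltr_pMr// ltr1n.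
  have e20 : 0 <= e / 2 by rewrite divr_ge0// ltW.
  have : mu (cube (0 : V) (e / 2)) = 0%E.
    by apply: subset_measure0 sub N0 => //; exact: measurable_cube.
  rewrite leb_cube// => -[] /eqP; rewrite expf_eq0 => /andP[_].
  by rewrite mulrn_eq0/= mulf_eq0 gt_eqF//= invr_eq0 pnatr_eq0.
exists (fun x => c^-1 * bump (- b) b 1 x); split.
- have S : closure [set x | c^-1 * bump (- b) b 1 x != 0] `<=` box (- b) b.
    apply: subset_trans (@bump_supp _ _ 1 ltr01); apply: closureS => x /=.
    by apply: contra => /eqP ->; rewrite mulr0.
  split; first by move=> k; apply: class_CZ; exact: class_C_bump.
  split => //; apply: bounded_closed_compact; last exact: closed_closure.
  exact: sub_bounded_set S (box_bounded _ _).
- move=> x; apply: mulr_ge0; first by rewrite invr_ge0 ltW.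
  by case/andP: (bump01 (- b) b 1 x).
- move=> x /negP H; apply/normrV_leP; first exact: ltW.
  move=> i; apply: contrapT => /negP xi; apply: H.
  rewrite (bump_eq0 (i := i)) ?mulr0// !mxE -ltr_norml.
  by apply: contra xi => /ltW.
- by rewrite RintegralZl// mulVf// gt_eqF.
Qed.

End test_functions.

(** * Integration by parts *)

Lemma Rdominated_convergence d (T : measurableType d) (R : realType)
    (nu : {measure set T -> \bar R}) (f_ : nat -> T -> R) (f h : T -> R) :
  (forall k, measurable_fun setT (f_ k)) -> measurable_fun setT f ->
  nu.-integrable setT (EFin \o h) -> (forall k x, `|f_ k x| <= h x) ->
  (\forall x \ae nu, f_ ^~ x @ \oo --> f x) ->
  [/\ nu.-integrable setT (EFin \o f),
      (\int[nu]_x `|(f_ k x - f x)%:E|)%E @[k --> \oo] --> 0%E &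
      (\int[nu]_x (f_ k x)%:E)%E @[k --> \oo] --> (\int[nu]_x (f x)%:E)%E].
Proof.
move=> mf_ mf ih fh cf.
have [|||||H1 H2 H3] := @dominated_convergence _ _ _ nu _ measurableT
  (fun k => EFin \o f_ k) (EFin \o f) (EFin \o h).
- by move=> k; apply/measurable_EFinP.
- exact/measurable_EFinP.
- apply: filterS cf => x cx _; apply: cvg_EFin; first by near=> k.
  exact: cx.
- exact: ih.
- by apply: aeW => x k _; rewrite /= lee_fin.
by split.
Unshelve. all: by end_near. Qed.

Section weak_gradients.
Context {R : realType} {n : nat}.
Local Notation V := 'rV[R]_n.
Local Notation e_ i := (delta_mx ord0 i : V).
Local Notation mu := (@leb R n).
Implicit Types (u v phi : V -> R) (Omega : set V).

Lemma norm_delta_le1 (i : 'I_n) : `|e_ i| <= 1.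
Proof.
apply/normrV_leP => // j; rewrite mxE; case: (_ && _); first by rewrite normr1.
by rewrite normr0.
Qed.

Lemma compact_sub_cube (K : set V) : compact K -> exists2 r : R, 0 < r & K `<=` cube 0 r.
Proof. by move=> cK; apply: bounded_sub_cube; exact: compact_bounded. Qed.

(** The difference quotients of [s] have zero integral because Lebesgue measure
    is translation invariant, and they converge to [g] boundedly. *)
Lemma integral_derivative0 (s g : V -> R) (i : 'I_n) (K : set V) (L : R) :
  compact K -> (forall x, ~ K x -> s x = 0) -> 0 <= L ->
  (forall x y, `|s x - s y| <= L * `|x - y|) ->
  measurable_fun setT g -> (\forall x \ae mu, is_derive x (e_ i) s (g x)) ->
  (\int[mu]_x (g x)%:E = 0)%E.
Proof.
move=> cK s0 L0 sL mg sg; have [r r0 Kr] := compact_sub_cube cK.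
have cs : continuous s := lip_continuous sL.
have ms : measurable_fun setT s := continuous_rV_measurable cs.
pose q (k : nat) (x : V) := k.+1%:R * (s (x + k.+1%:R^-1 *: e_ i) - s x).
have mshift (k : nat) : measurable_fun setT (fun x : V => s (x + k.+1%:R^-1 *: e_ i)).
  by apply: (measurableT_comp ms); exact: measurable_shift.
have is_ : mu.-integrable setT (EFin \o s).
  have [M M0 MP] := compact_supp_bounded cK cs s0.
  apply: (integrable_bounded (K := K)) ms _ _ MP s0; first exact: compact_rV_measurable.
  exact: compact_leb_lty.
have q0 k : (\int[mu]_x (q k x)%:E = 0)%E.
  have i1 := integrable_shift (k.+1%:R^-1 *: e_ i) is_.
  have : \int[mu]_x (q k x) = 0.
    rewrite /q RintegralZl//; last exact: (integrableB measurableT i1 is_).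
    by rewrite RintegralB// Rintegral_shift// subrr mulr0.
  rewrite /Rintegral => H; rewrite -[LHS]fineK ?H//.
  have : mu.-integrable setT (EFin \o q k).
    exact: (integrableZl measurableT k.+1%:R (integrableB measurableT i1 is_)).
  by move=> /integrable_fin_num; apply.
pose h (x : V) : R := L * \1_(cube (0 : V) (r + 1)) x.
have c1 : 0 <= r + 1 by rewrite addr_ge0// ltW.
have ih : mu.-integrable setT (EFin \o h).
  apply: integrable_cst_indic; first exact: measurable_cube.
  by rewrite leb_cube// ltry.
have qh k x : `|q k x| <= h x.
  have k1 : 0 < k.+1%:R^-1 :> R by rewrite invr_gt0.
  have d1 : `|k.+1%:R^-1 *: e_ i| <= k.+1%:R^-1.
    by rewrite normrZ (gtr0_norm k1) ler_piMr ?norm_delta_le1// ltW.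
  rewrite /q /h indicE; have [H|/negP] := boolP (`|x| <= r + 1).
    rewrite mem_set ?mulr1; last by rewrite /cube /= subr0.
    rewrite normrM normr_nat -ler_pdivlMl//.
    apply: le_trans (sL _ _) _; rewrite addrAC subrr add0r mulrC.
    by apply: ler_wpM2r.
  move=> H; rewrite memNset ?mulr0; last by rewrite /cube /= subr0.
  move/negP: H; rewrite -ltNge => H.
  have k1' : k.+1%:R^-1 <= 1 :> R by rewrite invf_le1 ?ler1n.
  have out y : r < `|y| -> s y = 0.
    by move=> ry; apply: s0 => /Kr; rewrite /cube /= subr0 leNgt ry.
  rewrite !out ?subrr ?mulr0 ?normr0//; first by apply: lt_trans H; rewrite ltrDl.
  have := lerB_normD x (k.+1%:R^-1 *: e_ i); apply: lt_le_trans.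
  by rewrite ltrBrDr; apply: le_lt_trans H; rewrite lerD2l (le_trans d1).
have mq k : measurable_fun setT (q k).
  by apply: measurable_funM => //; apply: measurable_funB.
have qg : \forall x \ae mu, q ^~ x @ \oo --> g x.
  apply: filterS sg => x /is_deriveP Hx; apply/cvgrPdist_le => e e0.
  have [d d0 dP] := Hx e e0.
  near=> k; have k1 : 0 < k.+1%:R^-1 :> R by rewrite invr_gt0.
  have := dP k.+1%:R^-1; rewrite (gtr0_norm k1) => H.
  have kd : k.+1%:R^-1 < d by near: k; exact: (near_infty_natSinv_lt (PosNum d0)).
  rewrite distrC /q -[g x](mulVKf (_ : k.+1%:R != 0 :> R))// -mulrBr.
  by rewrite normrM normr_nat -ler_pdivlMl// [leRHS]mulrC; exact: H.
have [_ _ cvg] := Rdominated_convergence mq mg ih qh qg.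
have /cvg_lim <- := cvg => //.
rewrite (_ : (fun _ => _) = cst 0%E); first by rewrite lim_cst.
by apply/funext => k; exact: q0.
Unshelve. all: by end_near. Qed.

Lemma integral_supp (Omega : set V) (f : V -> \bar R) :
  (forall x, ~ Omega x -> f x = 0%E) ->
  (\int[mu]_(x in Omega) f x = \int[mu]_x f x)%E.
Proof.
move=> f0; rewrite integral_mkcond; apply: eq_integral => x _.
by rewrite patchE; case: ifPn => // /negP; rewrite inE => /f0 ->.
Qed.

(** The product of [s] with the test function is Lipschitz with compact carrier,
    so [integral_derivative0] applies to it. *)
Lemma integral_by_parts (s g : V -> R) (i : 'I_n) Omega phi (M L : R) :
  test_fun Omega phi -> 0 <= L -> 
  (forall x, `|s x| <= M) -> (forall x y, `|s x - s y| <= L * `|x - y|) ->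
  measurable_fun setT g -> (forall x, `|g x| <= M) ->
  (\forall x \ae mu, is_derive x (e_ i) s (g x)) ->
  (\int[mu]_(x in Omega) (s x * partial i phi x)%:E =
   - \int[mu]_(x in Omega) (g x * phi x)%:E)%E.
Proof.
move=> tphi L0 sM sL mg gM sg.
have M0 : 0 <= M by apply: le_trans (sM 0).
have [K [cK KO K0]] := test_suppP tphi.
have [P P0 PP] := test_bounded tphi.
have [P' P'0 PP'] := test_bounded (test_partial tphi i).
have [L' L'0 LP'] := test_lipschitz tphi.
have ms : measurable_fun setT s := continuous_rV_measurable (lip_continuous sL).
have mphi : measurable_fun setT phi := continuous_rV_measurable (test_cont tphi).
have mphi' : measurable_fun setT (partial i phi) :=
  continuous_rV_measurable (test_cont (test_partial tphi i)).
rewrite (@integral_supp Omega (fun x => (s x * partial i phi x)%:E)); last first.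
  by move=> x /(contra_not (KO x))/K0[_ ->]; rewrite mulr0.
rewrite (@integral_supp Omega (fun x => (g x * phi x)%:E)); last first.
  by move=> x /(contra_not (KO x))/K0[-> _]; rewrite mulr0.
have i1 : mu.-integrable setT (EFin \o (fun x => g x * phi x)).
  apply: (integrable_bounded (K := K) (M := M * P)).
  - exact: measurable_funM.
  - exact: compact_rV_measurable.
  - exact: compact_leb_lty.
  - by move=> x; rewrite normrM ler_pM.
  - by move=> x /K0[-> _]; rewrite mulr0.
have i2 : mu.-integrable setT (EFin \o (fun x => s x * partial i phi x)).
  apply: (integrable_bounded (K := K) (M := M * P')).
  - exact: measurable_funM.
  - exact: compact_rV_measurable.
  - exact: compact_leb_lty.
  - by move=> x; rewrite normrM ler_pM.
  - by move=> x /K0[_ ->]; rewrite mulr0.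
have : (\int[mu]_x (s x * partial i phi x + g x * phi x)%:E = 0)%E.
  apply: (@integral_derivative0 (fun x => s x * phi x) _ i K (L * P + M * L')) => //.
  - by move=> x /K0[-> _]; rewrite mulr0.
  - by rewrite addr_ge0// mulr_ge0.
  - move=> x y; rewrite (_ : _ - _ = (s x - s y) * phi x + s y * (phi x - phi y)).
      apply: le_trans (ler_normD _ _) _; rewrite !normrM mulrDl lerD//.
        by rewrite mulrAC ler_pM.
      by rewrite -mulrA ler_pM.
    by ring.
  - by apply: measurable_funD; exact: measurable_funM.
  - apply: filterS sg => x Hx.
    have := is_deriveM Hx (test_derive tphi x i).
    by rewrite [_ *: g x]mulrC.
rewrite integralD_EFin// => H.
have fin f : mu.-integrable setT (EFin \o f) -> (\int[mu]_x (f x)%:E)%E \is a fin_num.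
  by move=> /integrable_fin_num; apply.
move: H; rewrite -(fineK (fin _ i2)) -(fineK (fin _ i1)) -EFinD -EFinN.
by move=> -[] /eqP; rewrite addr_eq0 => /eqP ->.
Qed.

End weak_gradients.

(** * The fundamental lemma of the calculus of variations *)

Section fundamental_lemma.
Context {R : realType} {n : nat}.
Local Notation V := 'rV[R]_n.
Local Notation mu := (@leb R n).
Implicit Types (u v phi h : V -> R) (Omega U : set V) (a b c x : V).

(** At a point of the box the two arguments of [flat 0] are at least [(k+1) r],
    because the margin [r / (k+1)] is multiplied by [(k+1)^2]; they tend to
    infinity and [flat 0] to 1. Off the box, the bump vanishes as soon as the
    margin is small enough. *)
Lemma bump_cvg a b (r : R) x : 0 < r ->
  bump (a - const_mx (r / k.+1%:R)) (b + const_mx (r / k.+1%:R)) (k.+1%:R ^+ 2) x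
    @[k --> \oo] --> (\1_(box a b) x : R).
Proof.
move=> r0; rewrite indicE.
have [xab|/negP] := boolP (x \in box a b).
  rewrite /= mulr1n; rewrite inE in xab.
  pose E k : R := expR (- (2 * n%:R / r * harmonic k)).
  have E1 : E k @[k --> \oo] --> (1 : R).
    rewrite -(@expR0 R) -[X in expR X]oppr0 -(mulr0 (2 * n%:R / r)).
    apply: (@cvg_comp _ _ _ (fun k => - (2 * n%:R / r * harmonic k)) expR); last first.
      exact: continuous_expR.
    by apply: cvgN; apply: cvgM; [exact: cvg_cst|exact: cvg_harmonic].
  apply: (squeeze_cvgr _ E1 (cvg_cst (1 : R))); apply: nearW => k.
  apply/andP; split; last by case/andP: (bump01 (a - const_mx (r / k.+1%:R)) (b + const_mx (r / k.+1%:R)) (k.+1%:R ^+ 2) x).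
  pose F : R := expR (- (r^-1 * harmonic k)).
  have -> : E k = \prod_(i < n) (F * F).
    rewrite prodr_const card_ord -expr2 exprnP -exprnP -exprM /F -expRM_natl.
    by congr expR; rewrite natrM; ring.
  have kk : k.+1%:R != 0 :> R by [].
  have Fle (t : R) : k.+1%:R * r <= t -> F <= flat 0 t.
    move=> rt; have kr : 0 < k.+1%:R * r by rewrite mulr_gt0.
    have t0 : 0 < t by apply: lt_le_trans rt.
    rewrite /flat t0 expr0 mul1r ler_expR lerN2 /harmonic /= -invfM.
    by rewrite lef_pV2 ?posrE// mulrC.
  apply: ler_prod => i _; have /andP[ax xb] := xab i.
  rewrite mulr_ge0 ?expR_ge0//= ler_pM ?expR_ge0// Fle// !mxE.
    rewrite [X in _ <= X](_ : _ =
      k.+1%:R * r + k.+1%:R ^+ 2 * (x ord0 i - a ord0 i)).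
      by rewrite lerDl mulr_ge0// subr_ge0.
    by field.
  rewrite [X in _ <= X](_ : _ =
      k.+1%:R * r + k.+1%:R ^+ 2 * (b ord0 i - x ord0 i)).
    by rewrite lerDl mulr_ge0// subr_ge0.
  by field.
rewrite inE => /existsNP[i /negP xi]; rewrite /= mulr0n.
have [d d0 dP] : exists2 d, 0 < d & forall e, e < d ->
    ~~ (a ord0 i - e < x ord0 i < b ord0 i + e).
  move: xi; rewrite negb_and -!ltNge => /orP[xa|bx].
    exists (a ord0 i - x ord0 i); first by rewrite subr_gt0.
    by move=> e ed; rewrite negb_and -leNgt; apply/orP; left; lra.
  exists (x ord0 i - b ord0 i); first by rewrite subr_gt0.
  by move=> e ed; rewrite negb_and -!leNgt; apply/orP; right; lra.
apply: cvg_near_cst; near=> k.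
apply: (bump_eq0 (i := i)); first by rewrite exprn_gt0.
rewrite !mxE; apply: dP; rewrite mulrC -ltr_pdivlMr//; near: k.
exact: (near_infty_natSinv_lt (PosNum (divr_gt0 d0 r0))).
Unshelve. all: by end_near. Qed.

Lemma locally_integrable_test U h phi : measurable U -> locally_integrable_on U h ->
  test_fun U phi -> mu.-integrable U (EFin \o (fun x => h x * phi x)).
Proof.
move=> mU ih tphi; have [K [cK KU K0]] := test_suppP tphi.
have [M M0 MP] := test_bounded tphi.
have mK := compact_rV_measurable cK.
have mphi : measurable_fun setT phi := continuous_rV_measurable (test_cont tphi).
have : mu.-integrable K (EFin \o (fun x => h x * phi x)).
  apply: (integrableMl mK (ih K cK KU)); first exact: measurable_funTS.
  by apply: (@bounded_onW _ _ _ _ M) => x _; exact: MP.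
move=> /(integrable_mkcond _ mK) H.
apply/(integrable_mkcond _ mU); apply: eq_integrable H => // x _.
rewrite !patchE; case: ifPn => [xK|/negP].
  by rewrite mem_set//; apply: KU; rewrite inE in xK.
by rewrite inE => /K0[h1 _]; case: ifP => //= _; rewrite h1 mulr0.
Qed.

Section on_a_cube.
Context (U : set V) (h : V -> R) (c : V) (r : R).
Hypothesis r0 : 0 < r.
Hypothesis cU : cube c (r *+ 2) `<=` U.
Hypothesis ih : locally_integrable_on U h.
Hypothesis h0 : forall phi, test_fun U phi ->
  (\int[mu]_(x in U) (h x * phi x)%:E = 0)%E.

Let r2 : 0 <= r *+ 2. Proof. by rewrite mulrn_wge0// ltW. Qed.
Let mQ1 : measurable (cube c (r *+ 2)). Proof. exact: measurable_cube. Qed.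
Let mQ0 : measurable (cube c r). Proof. by apply: measurable_cube; exact: ltW. Qed.
Let i1 : mu.-integrable (cube c (r *+ 2)) (EFin \o h).
Proof. by apply: ih => //; exact: compact_cube. Qed.
Let Q01 : cube c r `<=` cube c (r *+ 2).
Proof. by move=> x cx; apply: le_trans cx _; rewrite mulr2n lerDl ltW. Qed.
Let i0 : mu.-integrable (cube c r) (EFin \o h).
Proof. by apply: integrableS i1. Qed.

(** The indicator of the box is a bounded limit of bumps, which are test
    functions because the doubled cube is contained in [U]. *)
Lemma integral_subbox0 a b : box a b `<=` cube c r ->
  (forall i, a ord0 i <= b ord0 i) ->
  (\int[mu]_(x in box a b) (h x)%:E = 0)%E.
Proof.
move=> abQ ab.
have aB : box a b a by move=> i; rewrite lexx ab.
have bB : box a b b by move=> i; rewrite lexx ab.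
pose phi k := bump (a - const_mx (r / k.+1%:R)) (b + const_mx (r / k.+1%:R)) (k.+1%:R ^+ 2).
have K0 k : 0 < k.+1%:R ^+ 2 :> R by rewrite exprn_gt0.
have bQ k : box (a - const_mx (r / k.+1%:R)) (b + const_mx (r / k.+1%:R)) `<=` cube c (r *+ 2).
  move=> x H; apply/normrV_leP => // i; have := H i; rewrite !mxE.
  have /normrV_leP-/(_ (ltW r0) i) := abQ _ aB.
  have /normrV_leP-/(_ (ltW r0) i) := abQ _ bB.
  have : r / k.+1%:R <= r by rewrite ler_pdivrMr// ler_peMr ?ler1n// ltW.
  move: (r / k.+1%:R) => t.
  rewrite !mxE !ler_norml mulr2n => ? /andP[? ?] /andP[? ?] /andP[? ?].
  by apply/andP; split; lra.
have tphi k : test_fun U (phi k) by apply: test_bump => //; exact: subset_trans (bQ k) _.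
have phi_out k x : ~ cube c (r *+ 2) x -> phi k x = 0.
  move=> nx; apply/eqP; apply: contrapT => /negP H; apply: nx; apply: (bQ k).
  by apply: (bump_supp (K0 k)); exact: subset_closure.
have mh : measurable_fun (cube c (r *+ 2)) h.
  by case/integrableP: i1 => /measurable_EFinP.
have mB : measurable (box a b) := measurable_box a b.
have Bs : box a b `<=` cube c (r *+ 2) by apply: subset_trans Q01.
have [|||||_ _ cvg] := @dominated_convergence _ _ _ mu _ mQ1
  (fun k x => (h x * phi k x)%:E) (fun x => (h x * \1_(box a b) x)%:E) (fun x => `|(h x)%:E|%E).
- move=> k; apply/measurable_EFinP; apply: measurable_funM => //.
  by apply: measurable_funTS; exact: (continuous_rV_measurable (test_cont (tphi k))).
- by apply/measurable_EFinP; apply: measurable_funM.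
- apply: aeW => x _; apply: cvg_EFin; first by near=> k.
  by apply: cvgM; [exact: cvg_cst|exact: bump_cvg].
- exact: integrable_abse.
- apply: aeW => x k _; rewrite /= lee_fin normrM ler_piMr//.
  by have /andP[y0 y1] := bump01 (a - const_mx (r / k.+1%:R)) (b + const_mx (r / k.+1%:R)) (k.+1%:R ^+ 2) x; rewrite ger0_norm.
have -> : (\int[mu]_(x in box a b) (h x)%:E =
  \int[mu]_(x in cube c (r *+ 2)) (h x * \1_(box a b) x)%:E)%E.
  rewrite (integral_mkcond (box a b)) (integral_mkcond (cube _ _)).
  apply: eq_integral => x _; rewrite !patchE indicE.
  have [xB|xB] := boolP (x \in box a b); last first.
    by case: ifPn => // _; rewrite mulr0.
  by rewrite mem_set ?mulr1//; apply: Bs; rewrite inE in xB.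
have /cvg_lim <- := cvg => //.
rewrite (_ : (fun _ => _) = cst 0%E); first by rewrite lim_cst.
apply/funext => k /=; rewrite -(h0 (tphi k)).
rewrite (integral_mkcond U) (integral_mkcond (cube _ _)).
apply: eq_integral => x _; rewrite !patchE.
have [xB|/negP xB] := boolP (x \in cube c (r *+ 2)).
  by rewrite mem_set//; apply: cU; rewrite inE in xB.
by rewrite inE in xB; rewrite phi_out// mulr0 if_same.
Unshelve. all: by end_near. Qed.

Lemma integral_box_cube0 a b : (\int[mu]_(x in box a b `&` cube c r) (h x)%:E = 0)%E.
Proof.
rewrite cubeE; last exact: ltW.
have [a' [b' E]] : boxes (box a b `&` box (c - const_mx r) (c + const_mx r)).
  by apply: boxes_setI; [exists a, b|exists (c - const_mx r), (c + const_mx r)].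
rewrite E; have [ab|/existsNP[i /negP]] := pselect (forall i, a' ord0 i <= b' ord0 i).
  by apply: integral_subbox0 => //; rewrite cubeE ?ltW// -E; exact: subIsetr.
rewrite -ltNge => ba; rewrite (_ : box a' b' = set0) ?integral_set0//.
apply/seteqP; split => // x /(_ i)/andP[h1 h2].
by have := le_lt_trans (le_trans h1 h2) ba; rewrite ltxx.
Qed.

(** Boxes are stable under intersection and generate the Borel sets: the
    property extends from boxes by the pi-lambda theorem. *)
Lemma integral_measurable_cube0 A : measurable A ->
  (\int[mu]_(x in A `&` cube c r) (h x)%:E = 0)%E.
Proof.
rewrite rV_measurableE; apply: (@dynkin_induction _ _ boxes (fun A =>
  (\int[mu]_(x in A `&` cube c r) (h x)%:E = 0)%E) rV_measurableE boxes_setI).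
- rewrite setTI -(setIid (cube c r)) {1}cubeE; last exact: ltW.
  exact: integral_box_cube0.
- by move=> _ [a [b ->]]; exact: integral_box_cube0.
- move=> S mS S0.
  have : (\int[mu]_(x in (S `&` cube c r) `|` (~` S `&` cube c r)) (h x)%:E = 0)%E.
    rewrite -setIUl setUCr setTI -(setIid (cube c r)) {1}cubeE; last exact: ltW.
    exact: integral_box_cube0.
  rewrite integral_setU_EFin.
  + by rewrite S0 add0e.
  + exact: measurableI.
  + by apply: measurableI => //; exact: measurableC.
  + have : measurable_fun (cube c r) h by case/integrableP: i0 => /measurable_EFinP.
    by apply: measurable_funS => //; rewrite -setIUl setUCr setTI.
  + by rewrite disj_set2E setIACA setICr set0I.
- move=> F mF tF F0; rewrite setI_bigcupl integral_bigcup.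
  + by rewrite eseries0// => i _ _; exact: F0.
  + by apply: trivIset_setIr.
  + by move=> k; exact: measurableI.
  + apply: integrableS i0 => //; first by apply: bigcupT_measurable => k; exact: measurableI.
    by move=> x [k _ []].
Qed.

Lemma ae_cube0 : \forall x \ae mu, cube c r x -> h x = 0.
Proof.
have : ae_eq mu (cube c r) (EFin \o h) (cst 0%E).
  apply: integral_ae_eq => // E EQ mE; rewrite integral0.
  by rewrite -(setIidl EQ); exact: integral_measurable_cube0.
by apply: filterS => x H /H [].
Qed.

End on_a_cube.

(** On each of countably many cubes that cover [U], all the integrals of [h]
    over Borel subsets vanish. *)
Lemma test_functions_separate U h : open U -> locally_integrable_on U h ->
  (forall phi, test_fun U phi -> (\int[mu]_(x in U) (h x * phi x)%:E = 0)%E) ->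
  \forall x \ae mu, U x -> h x = 0.
Proof.
move=> oU ih h0; have [c [r [r0 H]]] := @cube_basis R n.
have : \forall x \ae mu, forall k, cube (c k) (r k *+ 2) `<=` U ->
    cube (c k) (r k) x -> h x = 0.
  apply: ae_foralln => k.
  have [cU|cU] := pselect (cube (c k) (r k *+ 2) `<=` U); last exact: aeW.
  have := @ae_cube0 U h (c k) (r k) (r0 k) cU ih h0.
  by apply: filterS => x Hx _.
apply: filterS => x Hx Ux; have [k [h1 h2]] := H _ _ oU Ux; exact: Hx h2 h1.
Qed.

Lemma locally_integrable_measurable U h : open U -> locally_integrable_on U h ->
  measurable_fun U h.
Proof.
move=> /open_sigma_compact[D [DP DU_]] ih; rewrite -DU_.
apply/measurable_fun_bigcup => k; have [cD mD DU] := DP k => //.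
by have /integrableP[/measurable_EFinP] := ih _ cD DU.
Qed.

End fundamental_lemma.

(** * Weak gradients and the space W^{1,1} *)

Section sobolev.
Context {R : realType} {n : nat}.
Local Notation V := 'rV[R]_n.
Local Notation mu := (@leb R n).
Context (Omega : set V) (oO : open Omega).
Implicit Types (u v w phi : V -> R) (g k : V -> V).

Let mO : measurable Omega. Proof. exact: open_rV_measurable. Qed.

(** The classical gradient. *)
Definition gradient u (x : V) : V := \row_i partial i u x.

Lemma Lp1E u : Lp 1%E Omega u <-> mu.-integrable Omega (EFin \o u).
Proof.
rewrite /Lp /= Lfun1_integrable (integrable_mkcond _ mO).
rewrite (_ : (EFin \o u) \_ Omega = EFin \o u \_ Omega)//.
by apply/funext => x; rewrite /= !patchE; case: ifP.
Qed.

Lemma measurable_patchE u : measurable_fun setT (u \_ Omega) <-> measurable_fun Omega u.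
Proof. by rewrite -measurable_restrictT. Qed.

Lemma Lpoo_bounded u : Lp +oo%E Omega u ->
  measurable_fun Omega u /\ exists M : R, \forall x \ae mu, Omega x -> `|u x| <= M.
Proof.
rewrite /Lp /= => /andP[mu_ fu].
have {mu_}mu_ : measurable_fun setT (u \_ Omega) by rewrite inE in mu_.
have {}fu : ('N[mu]_+oo[EFin \o u \_ Omega] < +oo)%E by rewrite inE in fu.
split; first exact/measurable_patchE.
move: fu; rewrite unlock; case: ifPn => [_|m0 _]; last first.
  exists 0; have : mu setT = 0%E by apply/eqP; rewrite eq_le measure_ge0 leNgt m0.
  by move=> m0'; exists setT; split.
set E := ess_sup _ _ => Eoo; exists (fine E).
have := ess_sup_ge mu (abse \o (EFin \o u \_ Omega)); rewrite -/E.
apply: filterS => x /= xE Ox; move: xE; rewrite patchE mem_set//.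
by case: E Eoo => // r _; rewrite lee_fin.
Qed.

Lemma bounded_Lpoo u (M : R) : measurable_fun Omega u ->
  (\forall x \ae mu, Omega x -> `|u x| <= M) -> Lp +oo%E Omega u.
Proof.
move=> mu_ uM; rewrite /Lp /=; apply/andP; split.
  by rewrite inE /=; exact/measurable_patchE.
rewrite inE /= /finite_norm unlock; case: ifPn => // _.
apply: (@le_lt_trans _ _ (`|M|%:E)); last exact: ltry.
apply/ess_supP; apply: filterS uM => x H /=; rewrite lee_fin patchE.
case: ifPn => [|_]; last by rewrite normr0.
by rewrite inE => /H /le_trans; apply; exact: ler_norm.
Qed.

Lemma LpooB u v : Lp +oo%E Omega u -> Lp +oo%E Omega v ->
  Lp +oo%E Omega (fun x => u x - v x).
Proof.
move=> /Lpoo_bounded[mu_ [M HM]] /Lpoo_bounded[mv [N HN]].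
apply: (@bounded_Lpoo _ (M + N)); first exact: measurable_funB.
apply: filterS2 HM HN => x h1 h2 Ox; apply: le_trans (ler_normB _ _) _.
by rewrite lerD// ?h1 ?h2.
Qed.

Lemma Lpoo_Lp1 u : (mu Omega < +oo)%E -> Lp +oo%E Omega u ->
  mu.-integrable Omega (EFin \o u).
Proof.
move=> Ooo /Lpoo_bounded[mu_ [M HM]].
apply/integrableP; split; first exact/measurable_EFinP.
apply: (@le_lt_trans _ _ (\int[mu]_(x in Omega) `|M|%:E)%E); last first.
  by rewrite integral_cst// lte_mul_pinfty.
have mn : measurable_fun Omega (fun x => `|(EFin \o u) x|%E).
  by apply: measurableT_comp => //; exact/measurable_EFinP.
apply: ae_ge0_le_integral => //.
apply: filterS HM => x H /H; rewrite /= lee_fin => /le_trans; apply.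
exact: ler_norm.
Qed.

Lemma integrable_locally u : mu.-integrable Omega (EFin \o u) ->
  locally_integrable_on Omega u.
Proof.
move=> iu K cK KO; apply: integrableS iu => //; exact: compact_rV_measurable.
Qed.

Lemma locally_integrableB u v : locally_integrable_on Omega u ->
  locally_integrable_on Omega v -> locally_integrable_on Omega (fun x => u x - v x).
Proof.
move=> iu iv K cK KO.
exact: (integrableB (compact_rV_measurable cK) (iu K cK KO) (iv K cK KO)).
Qed.

Lemma weak_gradient_unique u g k : weak_gradient Omega u g ->
  weak_gradient Omega u k -> \forall x \ae mu, Omega x -> g x = k x.
Proof.
move=> gu ku.
have H i : \forall x \ae mu, Omega x -> coor i (g x) - coor i (k x) = 0.
  have [ig gE] := gu i; have [ik kE] := ku i.
  apply: (@test_functions_separate _ _ _ (fun x => coor i (g x) - coor i (k x))) => //.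
    exact: locally_integrableB.
  move=> phi tphi; have i1 := locally_integrable_test mO ig tphi.
  have i2 := locally_integrable_test mO ik tphi.
  have E : (\int[mu]_(x in Omega) (coor i (g x) * phi x)%:E =
            \int[mu]_(x in Omega) (coor i (k x) * phi x)%:E)%E.
    by apply: oppe_inj; rewrite -gE// -kE.
  under eq_integral do rewrite mulrBl.
  rewrite integralB_EFin// E subee//.
  exact: (integrable_fin_num mO i2).
have : \forall x \ae mu, forall i, Omega x -> coor i (g x) - coor i (k x) = 0.
  exact: filter_forall.
apply: filterS => x Hx Ox; apply/rowP => i.
by apply/eqP; rewrite -subr_eq0; apply/eqP; exact: Hx.
Qed.

Lemma grad_weak u : (exists g, weak_gradient Omega u g) ->
  weak_gradient Omega u (grad Omega u).
Proof. by move=> H; exact: (xgetPex _ H). Qed.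

Lemma grad_ae u g : weak_gradient Omega u g ->
  \forall x \ae mu, Omega x -> grad Omega u x = g x.
Proof.
by move=> gu; apply: (weak_gradient_unique (u := u)) => //; apply: grad_weak; exists g.
Qed.

Lemma weak_gradient_coor_measurable u g i : weak_gradient Omega u g ->
  measurable_fun Omega (coor i \o g).
Proof. by move=> /(_ i)[H _]; exact: locally_integrable_measurable. Qed.

Lemma weak_gradientB u v g k : locally_integrable_on Omega u ->
  locally_integrable_on Omega v -> weak_gradient Omega u g ->
  weak_gradient Omega v k ->
  weak_gradient Omega (fun x => u x - v x) (fun x => g x - k x).
Proof.
move=> iu iv gu kv i; have [ig gE] := gu i; have [ik kE] := kv i.
have cE : coor i \o (fun x => g x - k x) = fun x => coor i (g x) - coor i (k x).
  by apply/funext => x; rewrite /coor /= !mxE.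
split; first by rewrite cE; exact: locally_integrableB.
move=> phi tphi; have tphi' := test_partial tphi i.
under eq_integral do rewrite mulrBl.
rewrite integralB_EFin//; try exact: locally_integrable_test.
rewrite [X in (_ = - X)%E](_ : _ =
  \int[mu]_(x in Omega) (coor i (g x) * phi x - coor i (k x) * phi x)%:E)%E; last first.
  by apply: eq_integral => x _; rewrite /coor !mxE mulrBl.
have i1 := locally_integrable_test mO ig tphi.
have i2 := locally_integrable_test mO ik tphi.
rewrite integralB_EFin//.
rewrite gE// kE//.
rewrite oppeK oppeB; last first.
  by apply: fin_num_adde_defl; rewrite fin_numN; exact: (integrable_fin_num mO i2).
by [].
Qed.

(** The gradient is carried along as an explicit function: unlike [grad], it can
    be computed from those of other functions exactly, and not only up to a null
    set. *)
Definition W11_grad u g : Prop :=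
  [/\ mu.-integrable Omega (EFin \o u),
      forall i, mu.-integrable Omega (EFin \o (coor i \o g)) &
      weak_gradient Omega u g].

Definition W11_dist u g v k : \bar R :=
  (\int[mu]_(x in Omega) `|(u x - v x)%:E| +
   \sum_(i < n) \int[mu]_(x in Omega) `|(coor i (g x) - coor i (k x))%:E|)%E.

(** Membership in the closure W_0^{1,1} of the test functions, for a function
    given with its weak gradient. *)
Definition in_W11_0 u g : Prop :=
  forall e : R, 0 < e -> exists2 phi, test_fun Omega phi &
    (W11_dist u g phi (gradient phi) < e%:E)%E.

Lemma L1_subadd (a b c : V -> R) : measurable_fun Omega a ->
  measurable_fun Omega b -> measurable_fun Omega c ->
  (forall x, Omega x -> `|a x| <= `|b x| + `|c x|) ->
  (\int[mu]_(x in Omega) `|(a x)%:E| <=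
   \int[mu]_(x in Omega) `|(b x)%:E| + \int[mu]_(x in Omega) `|(c x)%:E|)%E.
Proof.
move=> ma mb mc H; rewrite -ge0_integralD//.
- apply: ge0_le_integral => //.
  + by apply: measurableT_comp => //; exact/measurable_EFinP.
  + by apply: emeasurable_funD; apply: measurableT_comp => //; exact/measurable_EFinP.
- by apply: measurableT_comp => //; exact/measurable_EFinP.
- by apply: measurableT_comp => //; exact/measurable_EFinP.
Qed.

Let W11_grad_meas u g : W11_grad u g ->
  measurable_fun Omega u /\ forall i, measurable_fun Omega (coor i \o g).
Proof.
move=> [/integrableP[/measurable_EFinP mu_ _] ig _]; split => // i.
by have /integrableP[/measurable_EFinP] := ig i.
Qed.

Lemma W11_dist_triangle u g v k w l :
  W11_grad u g -> W11_grad v k -> W11_grad w l ->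
  (W11_dist u g w l <= W11_dist u g v k + W11_dist v k w l)%E.
Proof.
move=> /W11_grad_meas[m1 n1] /W11_grad_meas[m2 n2] /W11_grad_meas[m3 n3].
rewrite /W11_dist addeACA -big_split /=; apply: leeD.
  apply: L1_subadd; try exact: measurable_funB.
  by move=> x _; apply: le_trans (ler_normD _ _); rewrite subrKA.
apply: lee_sum => i _; apply: L1_subadd => [|||x _].
- by apply: measurable_funB; [exact: n1|exact: n3].
- by apply: measurable_funB; [exact: n1|exact: n2].
- by apply: measurable_funB; [exact: n2|exact: n3].
- by apply: le_trans (ler_normD _ _); rewrite subrKA.
Qed.

Lemma W11_distB u g u' g' v k v' k' :
  W11_grad u g -> W11_grad u' g' -> W11_grad v k -> W11_grad v' k' ->
  (W11_dist (fun x => (u x - u' x)%R) (fun x => (g x - g' x)%R)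
            (fun x => (v x - v' x)%R) (fun x => (k x - k' x)%R)
   <= W11_dist u g v k + W11_dist u' g' v' k')%E.
Proof.
move=> /W11_grad_meas[m1 n1] /W11_grad_meas[m2 n2] /W11_grad_meas[m3 n3].
move=> /W11_grad_meas[m4 n4].
have cE (a b : V) i : coor i (a - b) = coor i a - coor i b by rewrite /coor !mxE.
have ab (a b c d : R) : `|a - b - (c - d)| <= `|a - c| + `|b - d|.
  by apply: le_trans (ler_normB _ _); rewrite le_eqVlt; apply/orP; left; apply/eqP; congr (`| _ |); ring.
rewrite /W11_dist addeACA -big_split /=; apply: leeD.
  by apply: L1_subadd => //; do ?apply: measurable_funB.
apply: lee_sum => i _; under eq_integral do rewrite !cE.
apply: L1_subadd => [|||x _]; last exact: ab.
- by apply: measurable_funB; apply: measurable_funB;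
    [exact: n1|exact: n2|exact: n3|exact: n4].
- by apply: measurable_funB; [exact: n1|exact: n3].
- by apply: measurable_funB; [exact: n2|exact: n4].
Qed.

Lemma W11_gradB u g v k : W11_grad u g -> W11_grad v k ->
  W11_grad (fun x => u x - v x) (fun x => g x - k x).
Proof.
move=> [h1 h2 h3] [h4 h5 h6]; split.
- exact: (integrableB mO h1 h4).
- move=> i; apply: eq_integrable (integrableB mO (h2 i) (h5 i)) => // x _.
  by rewrite /coor /= !mxE.
- by apply: weak_gradientB => //; exact: integrable_locally.
Qed.

Lemma test_weak_gradient phi : test_fun Omega phi -> W11_grad phi (gradient phi).
Proof.
move=> tphi.
have iO psi : test_fun Omega psi -> mu.-integrable Omega (EFin \o psi).
  by move=> tp; apply: integrableS (integrable_test tp).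
have cE i : coor i \o gradient phi = partial i phi.
  by apply/funext => x; rewrite /coor /= mxE.
split; first exact: iO.
  by move=> i; rewrite cE; apply: iO; exact: test_partial.
move=> i; rewrite cE; split.
  by apply: integrable_locally; apply: iO; exact: test_partial.
move=> psi tpsi; have [L L0 LP] := test_lipschitz tphi.
have [M M0 MP] := test_bounded tphi.
have [N N0 NP] := test_bounded (test_partial tphi i).
rewrite (@integral_by_parts _ _ phi (partial i phi) i Omega psi (M + N) L)//.
- by congr (- _)%E; apply: eq_integral => x _; rewrite /coor mxE.
- by move=> x; apply: le_trans (MP x) _; rewrite lerDl.
- exact: (continuous_rV_measurable (test_cont (test_partial tphi i))).
- by move=> x; apply: le_trans (NP x) _; rewrite lerDr.
- by apply: aeW => x; exact: test_derive tphi x i.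
Qed.

(** [W1_norm] is defined from the chosen gradient of the difference, which is
    almost everywhere the difference of the gradients. *)
Lemma W1_norm_dist u g phi : W11_grad u g -> test_fun Omega phi ->
  W1_norm 1%E Omega (u \- phi) = W11_dist u g phi (gradient phi).
Proof.
move=> gu tphi; have [h1 h2 h3] := W11_gradB gu (test_weak_gradient tphi).
rewrite /W1_norm /W11_dist Lnorm1; congr (_ + _)%E.
  rewrite [RHS]integral_mkcond; apply: eq_integral => x _ /=.
  by rewrite !patchE; case: ifP => //; rewrite normr0.
apply: eq_bigr => i _; rewrite Lnorm1.
transitivity (\int[mu]_(x in Omega) `|(coor i (grad Omega (u \- phi) x))%:E|)%E.
  rewrite [RHS]integral_mkcond; apply: eq_integral => x _ /=.
  by rewrite !patchE; case: ifP => //; rewrite normr0.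
have gw : weak_gradient Omega (u \- phi) (grad Omega (u \- phi)).
  by apply: grad_weak; exists (fun x => g x - gradient phi x).
apply: ge0_ae_eq_integral => //.
- apply: measurableT_comp => //; apply/measurable_EFinP.
  exact: (weak_gradient_coor_measurable i gw).
- have [_ mg] := W11_grad_meas gu.
  have [_ mp] := W11_grad_meas (test_weak_gradient tphi).
  apply: measurableT_comp => //; apply/measurable_EFinP; apply: measurable_funB;
    [exact: mg|exact: mp].
- apply: filterS (grad_ae h3) => x Hx Ox; rewrite Hx//.
  by rewrite /coor !mxE.
Qed.

Lemma W10_inftyP u g : W11_grad u g ->
  (W10_infty Omega u <-> in_W11_0 u g /\ W1 +oo%E Omega u).
Proof.
move=> gu; split=> [[[_ H] Hoo]|[H Hoo]]; split => //.
  move=> e /H[phi tphi Hphi]; exists phi => //.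
  by rewrite -(W1_norm_dist gu tphi).
split; last first.
  move=> e /H[phi tphi Hphi]; exists phi => //.
  by rewrite (W1_norm_dist gu tphi).
have [h1 h2 h3] := gu; split; first exact/Lp1E.
by exists g; split => // i; exact/Lp1E.
Qed.

Lemma in_W11_0B u g v k : W11_grad u g -> W11_grad v k ->
  in_W11_0 u g -> in_W11_0 v k ->
  in_W11_0 (fun x => u x - v x) (fun x => g x - k x).
Proof.
move=> gu gv Hu Hv e e0; have e2 : 0 < e / 2 by rewrite divr_gt0.
have [phi t1 H1] := Hu _ e2; have [psi t2 H2] := Hv _ e2.
exists (fun x => phi x - psi x); first exact: testB.
have -> : gradient (fun x => phi x - psi x) = fun x => gradient phi x - gradient psi x.
  apply/funext => x; apply/rowP => i; rewrite !mxE.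
  exact: (@derive_val _ _ _ _ _ _ _
    (is_deriveB (test_derive t1 x i) (test_derive t2 x i))).
apply: (le_lt_trans (W11_distB gu gv (test_weak_gradient t1) (test_weak_gradient t2))).
have -> : e%:E = ((e / 2)%:E + (e / 2)%:E)%E by rewrite -EFinD -splitr.
exact: lteD H1 H2.
Qed.

Lemma in_W11_0_limit u g : W11_grad u g ->
  (forall e : R, 0 < e -> exists v k, [/\ W11_grad v k, in_W11_0 v k &
     (W11_dist u g v k < e%:E)%E]) -> in_W11_0 u g.
Proof.
move=> gu H e e0; have e2 : 0 < e / 2 by rewrite divr_gt0.
have [v [k [gv Hv H1]]] := H _ e2; have [phi t2 H2] := Hv _ e2.
exists phi => //.
apply: (le_lt_trans (W11_dist_triangle gu gv (test_weak_gradient t2))).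
have -> : e%:E = ((e / 2)%:E + (e / 2)%:E)%E by rewrite -EFinD -splitr.
exact: lteD H1 H2.
Qed.

End sobolev.

(** * Mollification *)

Lemma cvge0_lt (R : realType) (f : nat -> \bar R) (e : R) : f @ \oo --> 0%E -> 0 < e ->
  exists N, forall k, (N <= k)%N -> (f k < e%:E)%E.
Proof.
move=> /fine_cvgP[fin /cvgrPdist_lt/(_ e)] H e0.
have [N _ HN] := filterI fin (H e0).
exists N => k Nk; have [/= h1] := HN k Nk.
rewrite sub0r normrN => /(le_lt_trans (ler_norm _)) h2.
by rewrite -(fineK h1) lte_fin.
Qed.

Section mollification.
Context {R : realType} {n : nat}.
Local Notation V := 'rV[R]_n.
Local Notation e_ i := (delta_mx ord0 i : V).
Local Notation mu := (@leb R n).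
Implicit Types (s h rho phi : V -> R) (Omega K : set V) (x y z : V).

Lemma shift_is_derive h x v z (l : R) : is_derive (z - x) v h l ->
  is_derive z v (fun y => h (y - x)) l.
Proof.
move=> /is_deriveP H; apply/is_deriveP => e /H[d d0 dP]; exists d => // t td.
by have := dP t td; rewrite (addrAC z (- x)).
Qed.

Lemma class_C_shift k h x : class_C k setT h -> class_C k setT (fun y => h (y - x)).
Proof.
elim: k h => [|k IH] h Hh.
  split => // y _; apply: (@continuous_comp _ _ _ (fun y => y - x) h).
    by apply: continuousB; [exact: cvg_id|exact: cst_continuous].
  exact: (class_C_cont Hh).
apply: class_CS => [i|y]; last first.
  apply: (@continuous_comp _ _ _ (fun y => y - x) h).
    by apply: continuousB; [exact: cvg_id|exact: cst_continuous].
  exact: (class_C_cont Hh).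
exists (fun y => partial i h (y - x)); split; last exact: IH (class_C_partial i Hh).
by move=> y; apply: shift_is_derive; exact: class_C_derive Hh.
Qed.

Lemma test_shift rho x : test_fun setT rho -> test_fun setT (fun y => rho (y - x)).
Proof.
move=> trho; have [K [cK _ K0]] := test_suppP trho.
have [r r0 Kr] := compact_sub_cube cK.
have S : closure [set y | rho (y - x) != 0] `<=` cube x r.
  rewrite [X in _ `<=` X](closure_id _).1//; last first.
    by apply: compact_rV_closed; exact: compact_cube.
  apply: closureS => y /= /eqP H; have : K (y - x).
    by apply: contrapT => /K0[].
  by move=> /Kr; rewrite /cube /= subr0.
split; first by move=> k; apply: class_C_shift; case: trho.
split => //; apply: subclosed_compact S; first exact: closed_closure.
exact: compact_cube.
Qed.

Lemma test_opp Omega rho : test_fun Omega rho -> test_fun Omega (fun y => - rho y).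
Proof.
move=> trho; have [H1 [H2 H3]] := trho.
have E : [set x | - rho x != 0] = [set x | rho x != 0].
  by apply/seteqP; split => x /=; rewrite oppr_eq0.
split; last by rewrite E.
move=> k; rewrite (_ : (fun _ => _) = fun x => (-1) * rho x); first exact: class_CZ.
by apply/funext => x; rewrite mulN1r.
Qed.

(** Convolution of [s] with the reflection of [rho]. *)
Definition mollify s rho x : R := \int[mu]_y (s y * rho (y - x)).

Section smoothness.
Context (s : V -> R).
Hypothesis is_ : mu.-integrable setT (EFin \o s).

Let bint h : measurable_fun setT h -> (exists M : R, forall y, `|h y| <= M) ->
  mu.-integrable setT (EFin \o (fun y => s y * h y)).
Proof.
move=> mh [M HM]; apply: (integrableMl measurableT is_ mh).
by apply: (@bounded_onW _ _ _ _ M) => x _; exact: HM.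
Qed.

Lemma integrable_mollify rho x : test_fun setT rho ->
  mu.-integrable setT (EFin \o (fun y => s y * rho (y - x))).
Proof.
move=> trho; have ts := test_shift x trho.
apply: bint; first exact: (continuous_rV_measurable (test_cont ts)).
by have [M _ HM] := test_bounded ts; exists M.
Qed.

Let A : R := \int[mu]_y `|s y|.
Let A0 : 0 <= A. Proof. exact: Rintegral_ge0. Qed.

Let int_bound h (c : R) : 0 <= c -> measurable_fun setT h -> (forall y, `|h y| <= c) ->
  `|\int[mu]_y (s y * h y)| <= c * A.
Proof.
move=> c0 mh hc.
have i1 : mu.-integrable setT (EFin \o (fun y => s y * h y)) by apply: bint => //; exists c.
apply: le_trans (le_normr_Rintegral measurableT i1) _.
rewrite -RintegralZl//; last exact: (integrable_norm is_).
apply: le_Rintegral => //.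
- exact: (integrable_norm i1).
- have := integrableZl measurableT c (integrable_norm is_).
  by apply: eq_integrable.
- by move=> y _; rewrite normrM mulrC ler_wpM2r.
Qed.

Lemma mollify_continuous rho : test_fun setT rho -> continuous (mollify s rho).
Proof.
move=> trho; have [L L0 LP] := test_lipschitz trho.
apply: (@lip_continuous _ _ _ (L * A)) => x x'.
rewrite -RintegralB//; try exact: integrable_mollify.
under eq_Rintegral do rewrite -mulrBr.
rewrite mulrAC; apply: int_bound; first by rewrite mulr_ge0.
  apply: measurable_funB.
    exact: (continuous_rV_measurable (test_cont (test_shift x trho))).
  exact: (continuous_rV_measurable (test_cont (test_shift x' trho))).
move=> y; apply: le_trans (LP _ _) _; rewrite opprB addrCA addrAC subrr add0r.
by rewrite distrC.
Qed.

(** Differentiation under the integral sign: the partial derivative of [rho]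
    being Lipschitz, the first order expansion of [rho] has a remainder in
    [h^2], uniformly in [y]. *)
Lemma mollify_is_derive rho i x : test_fun setT rho ->
  is_derive x (e_ i) (mollify s rho) (mollify s (fun y => - partial i rho y) x).
Proof.
move=> trho; have tp := test_partial trho i.
have [L L0 LP] := test_lipschitz tp.
apply/is_deriveP => e e0.
have A1 : 0 < L * A + 1 by rewrite ltr_wpDl// mulr_ge0.
exists (e / (L * A + 1)); first by rewrite divr_gt0.
move=> h; rewrite ltr_pdivlMr// => hd.
have ma z : measurable_fun setT (fun y => rho (y - z)).
  exact: (continuous_rV_measurable (test_cont (test_shift z trho))).
have mp z : measurable_fun setT (fun y => partial i rho (y - z)).
  exact: (continuous_rV_measurable (test_cont (test_shift z tp))).
have -> : mollify s rho (x + h *: e_ i) - mollify s rho x -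
     h * mollify s (fun y => - partial i rho y) x =
   \int[mu]_y (s y * (rho (y - (x + h *: e_ i)) - rho (y - x)
                      + h * partial i rho (y - x))).
  have tn := test_opp tp.
  have j1 := integrable_mollify (x + h *: e_ i) trho.
  have j2 := integrable_mollify x trho.
  have j3 := integrable_mollify x tn.
  rewrite -RintegralB// -RintegralZl// -RintegralB//.
  - by apply: eq_Rintegral => y _; ring.
  - exact: (integrableB measurableT j1 j2).
  - by have := integrableZl measurableT h j3; apply: eq_integrable.
apply: le_trans (_ : L * `|h| * `|h| * A <= _); last first.
  rewrite mulrAC; apply: ler_wpM2r => //.
  rewrite mulrAC; apply: ltW; apply: le_lt_trans hd.
  by rewrite mulrC; apply: ler_wpM2l => //; rewrite lerDl.
apply: int_bound; first by rewrite !mulr_ge0.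
  by apply: measurable_funD; [exact: measurable_funB|exact: measurable_funM].
move=> y; set z := y - x.
pose f w := rho w - partial i rho z * w ord0 i.
have dc p w : is_derive w (e_ i) (fun w : V => p * w ord0 i) p.
  apply/is_deriveP => e' e'0; exists 1 => // t _.
  rewrite !mxE !eqxx /= mulr1 mulrDr (addrAC (p * _)) subrr add0r (mulrC p) subrr normr0.
  by rewrite mulr_ge0// ltW.
have df w : is_derive w (e_ i) f (partial i rho w - partial i rho z).
  exact: is_deriveB (test_derive trho w i) (dc _ w).
have := @line_bound _ _ f z (e_ i) (- h) (L * `|h|).
have -> : f (z + - h *: e_ i) - f z = rho (y - (x + h *: e_ i)) - rho (y - x) +
    h * partial i rho (y - x).
  rewrite /f !mxE !eqxx /= mulr1 -/z (_ : y - (x + h *: e_ i) = z + - h *: e_ i).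
    by ring.
  by rewrite scaleNr opprD addrA.
rewrite normrN; apply => t /andP[t0 t1]; split.
  exact: (@ex_derive _ _ _ _ _ _ _ (df _)).
rewrite (@derive_val _ _ _ _ _ _ _ (df _)); apply: le_trans (LP _ _) _.
apply: ler_wpM2l => //; rewrite addrAC subrr add0r normrZ normrM normrN.
rewrite (ger0_norm t0) -[leRHS]mulr1 -[X in _ <= X * 1]mul1r.
by apply: ler_pM; rewrite ?mulr_ge0 ?ler_wpM2r ?norm_delta_le1.
Qed.

Lemma mollify_class_C k rho : test_fun setT rho -> class_C k setT (mollify s rho).
Proof.
elim: k rho => [|k IH] rho trho.
  by split => // x _; exact: mollify_continuous.
apply: class_CS; last exact: mollify_continuous.
move=> i; exists (mollify s (fun y => - partial i rho y)); split.
  by move=> x; exact: mollify_is_derive.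
by apply: IH; apply: test_opp; exact: test_partial.
Qed.

End smoothness.

Lemma compact_margin K Omega : compact K -> open Omega -> K `<=` Omega ->
  exists2 d : R, 0 < d & forall x y, K y -> `|x - y| <= d -> Omega x.
Proof.
move=> /compact_near_coveringP cK oO KO.
have [//|d /= d0 dP] := cK R (0^'+) (fun d y => cube y d `<=` Omega) _ _.
  move=> y Ky; have [r r0 rP] := open_cube oO (KO y Ky).
  exists (ball y (r / 2), [set d : R | d < r / 2]).
    split => /=; first by apply: nbhsx_ballx; rewrite divr_gt0.
    by apply: nbhs_right_lt; rewrite divr_gt0.
  move=> [z d] [/=]; rewrite -ball_normE /= => yz dr w; rewrite /cube /= => wz.
  apply: rP; rewrite /cube /= -(subrKA z) (splitr r).
  apply: le_trans (ler_normD _ _) _; rewrite lerD//.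
    exact: le_trans wz (ltW dr).
  by rewrite distrC ltW.
exists (d / 2); first by rewrite divr_gt0.
move=> x y Ky xy; apply: (dP (d / 2)) Ky _ xy => //=.
  by rewrite sub0r normrN gtr0_norm ?divr_gt0// ltr_pdivrMr// ltr_pMr// ltr1n.
by rewrite divr_gt0.
Qed.

Lemma mollify_out s rho K (d : R) x : (forall y, ~ K y -> s y = 0) ->
  (forall z, rho z != 0 -> `|z| <= d) -> (forall y, K y -> d < `|y - x|) ->
  mollify s rho x = 0.
Proof.
move=> s0 rd H; rewrite /mollify (@eq_Rintegral _ _ _ _ _ (fun=> 0)).
  by rewrite Rintegral_cst// mul0r.
move=> y _; have [Ky|nKy] := pselect (K y); last by rewrite s0// mul0r.
have [->|/rd] := eqVneq (rho (y - x)) 0; first by rewrite mulr0.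
by rewrite leNgt H.
Qed.

Lemma mollify_test s rho K Omega (d : R) : mu.-integrable setT (EFin \o s) ->
  compact K -> (forall y, ~ K y -> s y = 0) -> test_fun setT rho -> 0 < d ->
  (forall z, rho z != 0 -> `|z| <= d) ->
  (forall x y, K y -> `|x - y| <= d *+ 2 -> Omega x) ->
  test_fun Omega (mollify s rho).
Proof.
move=> is_ cK s0 trho d0 rd KO; split; first by move=> k; exact: mollify_class_C.
have S x : closure [set x | mollify s rho x != 0] x ->
    exists2 y, K y & `|x - y| <= d *+ 2.
  move=> /(_ _ (nbhsx_ballx x d d0))[x' [/= fx' xx']].
  rewrite -ball_normE /= in xx'.
  have [y [Ky yx]] : exists y, K y /\ `|y - x'| <= d.
    apply: contrapT => H; move/eqP: fx'; apply; apply: (mollify_out s0 rd) => y Ky.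
    by rewrite ltNge; apply/negP => h; apply: H; exists y.
  exists y => //; rewrite -(subrKA x'); apply: le_trans (ler_normD _ _) _.
  by rewrite mulr2n lerD ?(ltW xx')// distrC.
split; last by move=> x /S[y Ky]; exact: KO.
apply: bounded_closed_compact; last exact: closed_closure.
have [r r0 Kr] := compact_sub_cube cK.
apply: (@sub_bounded_set _ _ _ (cube 0 (r + d *+ 2))); last first.
  by apply: compact_bounded; exact: compact_cube.
move=> x /S[y /Kr]; rewrite /cube /= !subr0 => yr xy.
by rewrite -(subrK y x) addrC; apply: le_trans (ler_normD _ _) _; exact: lerD.
Qed.

Lemma mollify_near h rho x (d e : R) : mu.-integrable setT (EFin \o h) ->
  test_fun setT rho -> (forall z, 0 <= rho z) -> \int[mu]_z rho z = 1 ->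
  (forall z, rho z != 0 -> `|z| <= d) ->
  (forall z, `|z| <= d -> `|h (z + x) - h x| <= e) ->
  `|mollify h rho x - h x| <= e.
Proof.
move=> ih trho rho0 rho1 rd He.
have irho := integrable_test trho.
have i1 := integrable_mollify ih x trho.
have i2 : mu.-integrable setT (EFin \o (fun z => h (z + x) * rho z)).
  have := integrable_shift x i1; apply: eq_integrable => // z _ /=.
  by rewrite addrK.
have i3 : mu.-integrable setT (EFin \o (fun z => h x * rho z)).
  by have := integrableZl measurableT (h x) irho; apply: eq_integrable.
have -> : mollify h rho x - h x = \int[mu]_z (h (z + x) * rho z - h x * rho z).
  rewrite RintegralB// RintegralZl// rho1 mulr1; congr (_ - _).
  rewrite /mollify -(Rintegral_shift x i1); apply: eq_Rintegral => z _.
  by rewrite addrK.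
have i4 := integrableB measurableT i2 i3.
apply: le_trans (le_normr_Rintegral measurableT i4) _.
rewrite -[e]mulr1 -rho1 -RintegralZl//; apply: le_Rintegral => //.
- exact: (integrable_norm i4).
- by have := integrableZl measurableT e irho; apply: eq_integrable.
move=> z _; rewrite -mulrBl normrM (ger0_norm (rho0 z)).
have [->|/rd/He] := eqVneq (rho z) 0; first by rewrite !mulr0.
by move=> H; apply: ler_wpM2r.
Qed.

(** Mollified functions converge at every point of continuity, and they are
    bounded and carried by a fixed cube: dominated convergence applies. *)
Lemma mollify_L1 h K (M : R) (rho : nat -> V -> R) :
  measurable_fun setT h -> (forall x, `|h x| <= M) -> compact K ->
  (forall x, ~ K x -> h x = 0) -> (\forall x \ae mu, {for x, continuous h}) ->
  (forall k, [/\ test_fun setT (rho k), forall x, 0 <= rho k x,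
     forall x, rho k x != 0 -> `|x| <= k.+1%:R^-1 & \int[mu]_x rho k x = 1]) ->
  (\int[mu]_x `|(mollify h (rho k) x - h x)%:E|)%E @[k --> \oo] --> 0%E.
Proof.
move=> mh hM cK h0 hc rhoP.
have M0 : 0 <= M by apply: le_trans (hM 0).
have mK := compact_rV_measurable cK.
have ih : mu.-integrable setT (EFin \o h).
  exact: (integrable_bounded mh mK (compact_leb_lty cK) hM h0).
have [r r0 Kr] := compact_sub_cube cK.
pose D x : R := (M + M + M) * \1_(cube (0 : V) (r + 1)) x.
have r1 : 0 <= r + 1 by rewrite addr_ge0// ltW.
have iD : mu.-integrable setT (EFin \o D).
  apply: integrable_cst_indic; first exact: measurable_cube.
  by rewrite leb_cube// ltry.
have hx x z : `|h (z + x) - h x| <= M + M.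
  by apply: le_trans (ler_normB _ _) _; exact: lerD.
have mhD k x : `|mollify h (rho k) x| <= D x.
  have [t1 t2 t3 t4] := rhoP k.
  have [cx|cx] := pselect (cube 0 (r + 1) x); last first.
    rewrite (mollify_out h0 t3) ?normr0.
      by rewrite /D indicE memNset// mulr0.
    move=> y /Kr; rewrite /cube /= subr0 => yr; rewrite /cube /= subr0 in cx.
    move/negP: cx; rewrite -ltNge => cx.
    have k1 : k.+1%:R^-1 <= 1 :> R by rewrite invf_le1 ?ler1n.
    have h1 : `|x| - `|y| <= `|y - x|.
      by rewrite distrC; apply: le_trans (lerB_normD x (- y)); rewrite normrN.
    by apply: lt_le_trans h1; move: (k.+1%:R^-1) k1 => t tle; lra.
  rewrite /D indicE mem_set// mulr1.
  have := mollify_near ih t1 t2 t4 t3 (fun z _ => hx x z) => h1.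
  rewrite -(subrK (h x) (mollify h (rho k) x)); apply: le_trans (ler_normD _ _) _.
  exact: lerD.
have md k : measurable_fun setT (mollify h (rho k)).
  by have [t1 _ _ _] := rhoP k; apply: continuous_rV_measurable; exact: mollify_continuous.
have [|_ H _] := Rdominated_convergence md mh iD mhD _; last exact: H.
apply: filterS hc => x hcx; apply/cvgrPdist_le => e e0.
have [d d0 dP] : exists2 d, 0 < d & forall z, `|z| <= d -> `|h (z + x) - h x| <= e.
  have /cvgrPdist_le/(_ e e0)/nbhs_ballP[d /= d0 dP] := hcx.
  exists (d / 2); first by rewrite divr_gt0.
  move=> z zd; rewrite distrC; apply: dP; rewrite -ball_normE /= opprD addrCA subrr addr0 normrN.
  by apply: le_lt_trans zd _; rewrite ltr_pdivrMr// ltr_pMr// ltr1n.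
near=> k; have [t1 t2 t3 t4] := rhoP k.
rewrite distrC; apply: (mollify_near ih t1 t2 t4 t3) => z zk; apply: dP.
apply: le_trans zk _; apply: ltW; near: k.
exact: (near_infty_natSinv_lt (PosNum d0)).
Unshelve. all: by end_near. Qed.

End mollification.

(** * Lipschitz functions with compact carrier *)

Section lipschitz_sobolev.
Context {R : realType} {n : nat}.
Local Notation V := 'rV[R]_n.
Local Notation e_ i := (delta_mx ord0 i : V).
Local Notation mu := (@leb R n).
Implicit Types (s : V -> R) (g : V -> V) (Omega K : set V).

(** The corrections used below: the gradient is known explicitly, and its
    continuity at almost every point makes its mollifications converge almost
    everywhere. *)
Definition lipschitz_grad K s g : Prop :=
  [/\ compact K, forall x, ~ K x -> s x = 0 /\ g x = 0,
      exists2 L, 0 <= L & forall x y, `|s x - s y| <= L * `|x - y|,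
      (forall i, measurable_fun setT (coor i \o g)) /\
        (exists M, forall x, `|g x| <= M) &
      \forall x \ae mu, forall i, is_derive x (e_ i) s (g x ord0 i) /\
         {for x, continuous (coor i \o g)}].

Context (Omega : set V) (oO : open Omega).
Let mO : measurable Omega. Proof. exact: open_rV_measurable. Qed.

Section fixed.
Context (K : set V) (s : V -> R) (g : V -> V).
Hypothesis KO : K `<=` Omega.
Hypothesis sg : lipschitz_grad K s g.

Lemma lipschitz_grad_bounded : exists M, forall x, `|s x| <= M /\ forall i, `|g x ord0 i| <= M.
Proof.
have [cK out [L L0 LP] [mg [M HM]] _] := sg.
have [N N0 HN] := compact_supp_bounded cK (lip_continuous LP) (fun x h => (out x h).1).
have M0 : 0 <= M by apply: le_trans (HM 0).
exists (M + N) => x; split; first by apply: le_trans (HN x) _; rewrite lerDr.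
move=> i; apply: le_trans (le_coord_norm _ _) _; apply: le_trans (HM x) _.
by rewrite lerDl.
Qed.

Lemma lipschitz_grad_W11 : W11_grad Omega s g.
Proof.
have [cK out [L L0 LP] [mg _] H] := sg; have [M HM] := lipschitz_grad_bounded.
have M0 : 0 <= M by apply: le_trans (HM 0).1.
have mK := compact_rV_measurable cK; have Koo := compact_leb_lty cK.
have ms : measurable_fun setT s := continuous_rV_measurable (lip_continuous LP).
have is_ : mu.-integrable setT (EFin \o s).
  exact: (integrable_bounded ms mK Koo (fun x => (HM x).1) (fun x h => (out x h).1)).
have ig i : mu.-integrable setT (EFin \o (coor i \o g)).
  apply: (integrable_bounded (mg i) mK Koo (fun x => (HM x).2 i)).
  by move=> x /out[_ h]; rewrite /= /coor h mxE.
split.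
- exact: integrableS is_.
- by move=> i; exact: integrableS (ig i).
move=> i; split.
  by apply: integrable_locally => //; exact: integrableS (ig i).
move=> phi tphi; apply: (integral_by_parts tphi L0 (fun x => (HM x).1) LP (mg i)).
  by move=> x; exact: (HM x).2.
by apply: filterS H => x /(_ i)[].
Qed.

(** The mollifications of [s] are test functions carried by a small
    neighbourhood of [K], and their gradients are the mollifications of [g]. *)
Lemma lipschitz_grad_W11_0 : in_W11_0 Omega s g.
Proof.
have [cK out [L L0 LP] [mg _] H] := sg; have [M HM] := lipschitz_grad_bounded.
have M0 : 0 <= M by apply: le_trans (HM 0).1.
have mK := compact_rV_measurable cK; have Koo := compact_leb_lty cK.
have cs : continuous s := lip_continuous LP.
have ms : measurable_fun setT s := continuous_rV_measurable cs.
have is_ : mu.-integrable setT (EFin \o s).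
  exact: (integrable_bounded ms mK Koo (fun x => (HM x).1) (fun x h => (out x h).1)).
have /choice[rho rhoP] : forall k : nat, exists rho : V -> R,
   [/\ test_fun setT rho, forall x, 0 <= rho x,
     forall x, rho x != 0 -> `|x| <= k.+1%:R^-1 & \int[mu]_x rho x = 1].
  by move=> k; apply: mollifier_exists; rewrite invr_gt0.
have c0 := mollify_L1 ms (fun x => (HM x).1) cK (fun x h => (out x h).1)
  (aeW _ (fun x => cs x)) rhoP.
have cg i : (\int[mu]_x `|(mollify (coor i \o g) (rho k) x - (coor i \o g) x)%:E|)%E
   @[k --> \oo] --> 0%E.
  apply: (mollify_L1 (mg i) (fun x => (HM x).2 i) cK) rhoP.
    by move=> x /out[_ h]; rewrite /= /coor h mxE.
  by apply: filterS H => x /(_ i)[].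
(* integration by parts moves the derivative from the mollifier to [s] *)
have dE k i x : partial i (mollify s (rho k)) x = mollify (coor i \o g) (rho k) x.
  have [t1 _ _ _] := rhoP k.
  rewrite [LHS](@derive_val _ _ _ _ _ _ _ (mollify_is_derive is_ i x t1)).
  have tx := test_shift x t1.
  have Hi : \forall x \ae mu, is_derive x (e_ i) s ((coor i \o g) x).
    by apply: filterS H => z /(_ i)[].
  have E := integral_by_parts tx L0 (fun x => (HM x).1) LP (mg i)
    (fun x => (HM x).2 i) Hi.
  have ppE y : partial i (fun y => rho k (y - x)) y = partial i (rho k) (y - x).
    apply: (@derive_val _ _ _ _ _ _ _ (shift_is_derive _)).
    exact: test_derive t1 _ i.
  transitivity (- \int[mu]_y (s y * partial i (fun y => rho k (y - x)) y)).
    rewrite -mulN1r -RintegralZl//.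
      by apply: eq_Rintegral => y _; rewrite ppE mulN1r mulrN.
    have := integrable_mollify is_ x (test_partial t1 i).
    by apply: eq_integrable => // y _; rewrite /= ppE.
  by rewrite /Rintegral E fineN opprK.
move=> e e0.
have n1 : 0 < n.+1%:R :> R by [].
have en0 : 0 < e / n.+1%:R by rewrite divr_gt0.
have [N0 HN0] := cvge0_lt c0 en0.
have /choice[N_ HN] := fun i => cvge0_lt (cg i) en0.
have [d d0 dP] := compact_margin cK oO KO.
have [k3 _ Hk3] := near_infty_natSinv_lt (PosNum (divr_gt0 d0 (ltr0Sn R 1))).
pose k := maxn (maxn N0 (\max_i N_ i)) k3.
have [t1 t2 t3 t4] := rhoP k.
have kd : k.+1%:R^-1 < d / 2 by apply: Hk3; exact: leq_maxr.
exists (mollify s (rho k)).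
  apply: (mollify_test is_ cK (fun x h => (out x h).1) t1 _ t3).
    by rewrite invr_gt0.
  move=> x y Ky xy; apply: dP Ky _; apply: le_trans xy _.
  by rewrite mulr2n; move: (k.+1%:R^-1) kd => t td; lra.
have le_O (a b : V -> R) : measurable_fun setT a -> measurable_fun setT b ->
  (\int[mu]_(x in Omega) `|(a x - b x)%:E| <= \int[mu]_x `|(b x - a x)%:E|)%E.
  move=> ma mb.
  have -> : (\int[mu]_x `|(b x - a x)%:E| = \int[mu]_x `|(a x - b x)%:E|)%E.
    by apply: eq_integral => x _; rewrite /= distrC.
  apply: ge0_subset_integral => //.
  by apply: measurableT_comp => //; apply/measurable_EFinP; exact: measurable_funB.
have mm : measurable_fun setT (mollify s (rho k)).
  by apply: continuous_rV_measurable; exact: mollify_continuous.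
rewrite /W11_dist (_ : e%:E = \sum_(i < n.+1) (e / n.+1%:R)%:E)%E; last first.
  rewrite sumEFin; congr EFin; rewrite sumr_const card_ord -[RHS]mulr_natr divfK//.
have Hs : (\sum_(i < n) \int[mu]_(x in Omega)
    `|(coor i (g x) - coor i (gradient (mollify s (rho k)) x))%:E| <=
   \sum_(i < n) (e / n.+1%:R)%:E)%E.
  apply: lee_sum => i _.
  have mk : measurable_fun setT (mollify (coor i \o g) (rho k)).
    have ig : mu.-integrable setT (EFin \o (coor i \o g)).
      apply: (integrable_bounded (mg i) mK Koo (fun x => (HM x).2 i)).
      by move=> x /out[_ h]; rewrite /= /coor h mxE.
    by apply: continuous_rV_measurable; exact: mollify_continuous.
  rewrite (_ : (fun x => _) = fun x => `|((coor i \o g) x - mollify (coor i \o g) (rho k) x)%:E|%E).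
    apply: le_trans (le_O _ _ (mg i) mk) _; apply/ltW/HN.
    apply: leq_trans (_ : (\max_i N_ i <= _)%N); first exact: leq_bigmax.
    by rewrite /k !leq_max leqnn orbT.
  by apply/funext => x; rewrite [coor i (gradient _ _)]mxE dE.
rewrite big_ord_recl /=; apply: lte_leD => //.
  rewrite ge0_fin_numE; first by apply: le_lt_trans Hs _; rewrite sumEFin ltry.
  by apply: sume_ge0 => i _; exact: integral_ge0.
apply: le_lt_trans (le_O _ _ ms mm) _; apply: HN0.
by rewrite /k !leq_max leqnn.
Qed.

End fixed.

(** A test function and its derivatives are bounded, so both sides of the
    identity that defines weak gradients are continuous for the W^{1,1}
    distance. *)
Lemma W11_grad_limit (u : V -> R) (g : V -> V) :
  mu.-integrable Omega (EFin \o u) ->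
  (forall i, mu.-integrable Omega (EFin \o (coor i \o g))) ->
  (forall e : R, 0 < e -> exists v k, W11_grad Omega v k /\
     (W11_dist Omega u g v k < e%:E)%E) -> W11_grad Omega u g.
Proof.
move=> iu ig H; split => // i; split; first exact: integrable_locally.
move=> phi tphi; have tphi' := test_partial tphi i.
have [M M0 MP] := test_bounded tphi; have [M' M'0 MP'] := test_bounded tphi'.
have lu := integrable_locally oO iu; have lg := integrable_locally oO (ig i).
have j1 := locally_integrable_test mO lu tphi'.
have j2 := locally_integrable_test mO lg tphi.
have f1 := integrable_fin_num mO j1; have f2 := integrable_fin_num mO j2.
rewrite -[LHS](fineK f1) -[X in (- X)%E](fineK f2) -EFinN; congr EFin.
set A := fine _; set B := fine _.
have bound (a b c : V -> R) (C : R) : 0 <= C -> measurable_fun setT c -> (forall x, `|c x| <= C) ->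
  mu.-integrable Omega (EFin \o a) -> mu.-integrable Omega (EFin \o b) ->
  mu.-integrable Omega (EFin \o (fun x => a x * c x)) ->
  mu.-integrable Omega (EFin \o (fun x => b x * c x)) ->
  (`|\int[mu]_(x in Omega) (a x * c x) - \int[mu]_(x in Omega) (b x * c x)|%:E <=
   C%:E * \int[mu]_(x in Omega) `|(a x - b x)%:E|)%E.
  move=> C0 mc cC ia ib iac ibc; rewrite -RintegralB//.
  have iab := integrableB mO ia ib; have iabc := integrableB mO iac ibc.
  apply: le_trans (_ : ((\int[mu]_(x in Omega) `|a x * c x - b x * c x|)%:E <= _)%E).
    by rewrite lee_fin; exact: le_normr_Rintegral.
  have iabn := integrable_norm iab; have iabcn := integrable_norm iabc.
  rewrite -(fineK (integrable_fin_num mO iabn)) -EFinM lee_fin.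
  rewrite -[fine _]/(\int[mu]_(x in Omega) `|a x - b x|) -RintegralZl//.
  apply: le_Rintegral => //.
    by have := integrableZl mO C iabn; apply: eq_integrable.
  by move=> x _; rewrite -mulrBl normrM mulrC ler_wpM2r.
apply/eqP; rewrite -subr_eq0 opprK; apply/eqP/eqP; rewrite -normr_le0.
apply/ler_addgt0Pr => e e0; rewrite add0r.
have C1 : 0 < M + M' + 1 by rewrite ltr_wpDl// addr_ge0.
have [v [k [[iv ik vk] dist]]] := H _ (divr_gt0 e0 C1).
have [_ /(_ phi tphi) Ev] := vk i.
have lv := integrable_locally oO iv; have lk := integrable_locally oO (ik i).
have j3 := locally_integrable_test mO lv tphi'.
have j4 := locally_integrable_test mO lk tphi.
have f3 := integrable_fin_num mO j3; have f4 := integrable_fin_num mO j4.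
have Ev' : \int[mu]_(x in Omega) (v x * partial i phi x) = - \int[mu]_(x in Omega) (coor i (k x) * phi x).
  by rewrite /Rintegral Ev fineN.
have b1 := bound _ _ _ _ M'0 (continuous_rV_measurable (test_cont tphi')) MP' iu iv j1 j3.
have b2 := bound _ _ _ _ M0 (continuous_rV_measurable (test_cont tphi)) MP (ig i) (ik i) j2 j4.
rewrite -lee_fin.
set d1 := (\int[mu]_(x in Omega) `|(u x - v x)%:E|)%E in b1.
set d2 := (\int[mu]_(x in Omega) _)%E in b2.
have d1D : (d1 <= W11_dist Omega u g v k)%E.
  by rewrite /W11_dist -/d1 leeDl// sume_ge0// => j _; exact: integral_ge0.
have d2D : (d2 <= W11_dist Omega u g v k)%E.
  rewrite /W11_dist (bigD1 i)//= -/d2 addeCA leeDl// adde_ge0//.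
    exact: integral_ge0.
  by apply: sume_ge0 => j _; exact: integral_ge0.
set D := W11_dist _ _ _ _ _ in dist d1D d2D.
apply: (@le_trans _ _ (M'%:E * D + M%:E * D)%E).
  apply: (@le_trans _ _ (M'%:E * d1 + M%:E * d2)%E); last first.
    by apply: leeD; apply: lee_wpmul2l; rewrite ?lee_fin.
  apply: le_trans (leeD b1 b2); rewrite -EFinD lee_fin.
  apply: le_trans (ler_normD _ _); rewrite Ev' -/(Rintegral mu Omega (fun x => u x * partial i phi x)).
  rewrite le_eqVlt; apply/orP; left; apply/eqP; congr (`| _ |).
  by rewrite /A /B /Rintegral /=; ring.
rewrite -ge0_muleDl ?lee_fin// -EFinD.
apply: (@le_trans _ _ ((M' + M)%:E * (e / (M + M' + 1))%:E)%E).
  by apply: lee_wpmul2l; rewrite ?lee_fin ?addr_ge0//; exact: ltW.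
rewrite -EFinM lee_fin mulrA ler_pdivrMr// mulrC; apply: ler_wpM2l; first exact: ltW.
by lra.
Qed.

End lipschitz_sobolev.

(** * The lower semicontinuous level convex envelope *)

Section convexity.
Context {R : realType} {n : nat}.
Local Notation V := 'rV[R]_n.
Implicit Types (x y z p q xi eta : V) (C : set V).

Lemma convex_setE C : convex_set C -> forall x y (t : R), 0 <= t <= 1 ->
  C x -> C y -> C (t *: x + (1 - t) *: y).
Proof.
move=> cC x y t /andP[t0 t1] Cx Cy.
have := cC x y (Itv01 t0 t1) (mem_set Cx) (mem_set Cy).
by rewrite inE.
Qed.

Lemma convex_halfspace y (t : R) : convex_set [set x | dot x y <= t].
Proof.
move=> a b l; rewrite !inE /= => ha hb.
have -> : conv l a b = l%:num *: a + (1 - l%:num) *: b :> V by [].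
rewrite dotDl !dotZl.
have l0 : 0 <= l%:num by [].
have l1 : 0 <= 1 - l%:num by rewrite subr_ge0.
by have := ler_wpM2l l0 ha; have := ler_wpM2l l1 hb; nra.
Qed.

Lemma continuous_dotl y : continuous (fun x => dot x y).
Proof.
rewrite (_ : (fun x => dot x y) = dot y); first exact: continuous_dot.
by apply/funext => x; rewrite dotC.
Qed.

Lemma continuous_sqdist p : continuous (fun x => dot (x - p) (x - p)).
Proof.
have cs (s : seq 'I_n) : continuous (fun x : V =>
    \sum_(i <- s) (x ord0 i - p ord0 i) * (x ord0 i - p ord0 i)).
  elim: s => [|i s IH].
    rewrite (_ : (fun _ => _) = cst 0); first exact: cst_continuous.
    by apply/funext => x; rewrite big_nil.
  rewrite (_ : (fun _ => _) = fun x => (x ord0 i - p ord0 i) * (x ord0 i - p ord0 i) +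
    \sum_(i <- s) (x ord0 i - p ord0 i) * (x ord0 i - p ord0 i)).
    have c1 : continuous (fun x : V => x ord0 i - p ord0 i).
      by move=> x; exact: (continuousB (@coord_continuous R 1 n ord0 i x)
        (@cst_continuous V R (p ord0 i) x)).
    by move=> x; exact: (continuousD (continuousM (c1 x) (c1 x)) (IH x)).
  by apply/funext => x; rewrite big_cons.
rewrite (_ : (fun _ => _) = fun x : V => \sum_(i <- index_enum 'I_n)
  (x ord0 i - p ord0 i) * (x ord0 i - p ord0 i)); first exact: cs.
by apply/funext => x; apply: eq_bigr => i _; rewrite !mxE.
Qed.

Lemma norm_le_sqdot x (r : R) : 0 <= r -> dot x x <= r ^+ 2 -> `|x| <= r.
Proof.
move=> r0 xr; apply/normrV_leP => // i.
rewrite -(ler_pXn2r (ltn0Sn 1)) ?nnegrE// real_normK ?num_real//.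
apply: le_trans xr; rewrite /dot (bigD1 i)//= expr2 lerDl.
by apply: sumr_ge0 => j _; rewrite -expr2 sqr_ge0.
Qed.

Lemma closed_halfspace y (t : R) : closed [set x | dot x y <= t].
Proof.
apply: (@preimage_closed _ _ (fun x => dot x y) [set s | s <= t]).
  by move=> x _; exact: continuous_dotl.
exact: closed_le.
Qed.

(** The point of [C] nearest to [p] for the Euclidean distance: moving it
    towards another point of [C] does not bring it closer to [p]. *)
Lemma convex_projection C p : closed C -> convex_set C -> C !=set0 -> ~ C p ->
  exists q, q != p /\ forall x, C x -> dot (x - q) (p - q) <= 0.
Proof.
move=> clC cC [c0 Cc0] Cp.
pose D := C `&` [set x | dot (x - p) (x - p) <= dot (c0 - p) (c0 - p)].
have clD : closed D.
  apply: closedI => //.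
  apply: (@preimage_closed _ _ (fun x => dot (x - p) (x - p))
    [set s | s <= dot (c0 - p) (c0 - p)]); last exact: closed_le.
  by move=> x _; exact: continuous_sqdist.
set r2 := dot (c0 - p) (c0 - p) in D clD.
have r20 : 0 <= r2 by exact: dot_ge0.
have cD : compact D.
  apply: bounded_closed_compact => //.
  apply: (@sub_bounded_set _ _ _ (cube p (r2 + 1))); last first.
    by apply: compact_bounded; exact: compact_cube.
  move=> x [_ /= xr]; rewrite /cube /=; apply: norm_le_sqdot; first exact: addr_ge0.
  by apply: le_trans xr _; rewrite expr2 mulrDl mul1r mulrDr mulr1; have := mulr_ge0 r20 r20; lra.
have [||q qD qmin] := @EVT_min_rV R n (fun x => dot (x - p) (x - p)) D _ cD.
- by exists c0; split => //=.
- by apply: continuous_subspaceT => x; exact: continuous_sqdist.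
have [Cq qr] : D q by rewrite inE in qD.
have {}qmin x : C x -> dot (q - p) (q - p) <= dot (x - p) (x - p).
  move=> Cx; have [xr|xr] := leP (dot (x - p) (x - p)) r2.
    by apply: qmin; rewrite inE; split.
  by apply: le_trans (ltW xr).
exists q; split; first by apply: contra_notN Cp => /eqP <-.
move=> x Cx; rewrite leNgt; apply/negP => a0.
set a := dot _ _ in a0; set b := dot (x - q) (x - q).
have b0 : 0 <= b by exact: dot_ge0.
pose t := Num.min 1 (a / (b + 1)).
have b1 : 0 < b + 1 by rewrite ltr_wpDl.
have t0 : 0 < t by rewrite lt_min ltr01 divr_gt0.
have t1 : t <= 1 by rewrite ge_min lexx.
have := qmin _ (convex_setE cC (t := t) _ Cx Cq); rewrite (ltW t0) t1 => /(_ isT).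
have -> : t *: x + (1 - t) *: q - p = (q - p) + t *: (x - q).
  by apply/rowP => i; rewrite !mxE; ring.
have uw : dot (q - p) (x - q) = - a by rewrite /a dotC -dotNr opprB.
have wu : dot (x - q) (q - p) = - a by rewrite /a -dotNr opprB.
move: (q - p) (x - q) @b b0 b1 @t t0 t1 uw wu => u w b b0 b1 t t0 t1 uw wu.
rewrite dotDl !dotDr !dotZl !dotZr uw wu -/b.
have tb : t * (b + 1) <= a.
  by rewrite -ler_pdivlMr// ge_min lexx orbT.
have := ler_wpM2l (ltW t0) tb; have := mulr_gt0 t0 a0; have := mulr_gt0 t0 t0.
by nra.
Qed.

(** Up to a dimensional factor, the ball of centre [xi0] and radius [d] is
    contained in the convex hull of [Xi]: no hyperplane through [xi0] leaves all
    of [Xi] on one side. *)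
Definition spans (Xi : seq V) xi0 (d : R) : Prop :=
  forall y, y != 0 -> exists2 xi, xi \in Xi & d * `|y| <= dot (xi - xi0) y.

Section envelope.
Context (f : V -> R).
Hypothesis f_cont : continuous f.
Hypothesis f_coercive : forall c : R, bounded_set [set x | f x <= c].
Local Notation F := (lslc (EFin \o f)).

Lemma lslc_le xi : (F xi <= (f xi)%:E)%E.
Proof. by apply: ge_ereal_sup => _ [G [_ _ H] <-]; exact: H. Qed.

Lemma lslc_ge (G : V -> \bar R) xi : lower_semicont G -> level_convex G ->
  (forall eta, (G eta <= (f eta)%:E)%E) -> (G xi <= F xi)%E.
Proof. by move=> h1 h2 h3; apply: ereal_sup_ubound; exists G. Qed.

Lemma lslc_ge_cst (c : R) xi : (forall eta, c <= f eta) -> (c%:E <= F xi)%E.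
Proof.
move=> cf; apply: (@lslc_ge (cst c%:E)) => [b|b|eta]; last by rewrite /= lee_fin.
  rewrite /sublevel /=; have [cb|cb] := leP c%:E b%:E.
    by rewrite (_ : mkset _ = setT); [exact: closedT|apply/seteqP; split].
  by rewrite (_ : mkset _ = set0); [exact: closed0|apply/seteqP; split].
move=> x y l; rewrite !inE.
by [].
Qed.

Lemma lslc_sublevelE c : sublevel F c = \bigcap_(G in [set G | [/\ lower_semicont G,
   level_convex G & forall eta, (G eta <= (f eta)%:E)%E]]) sublevel G c.
Proof.
apply/seteqP; split => [xi /= H G [h1 h2 h3]|xi H].
  by apply: le_trans (lslc_ge xi h1 h2 h3) H.
by apply: ge_ereal_sup => _ [G hG <-]; exact: H.
Qed.

Lemma lslc_closed c : closed (sublevel F c).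
Proof. by rewrite lslc_sublevelE; apply: closed_bigI => G [h1 _ _]; exact: h1. Qed.

Lemma lslc_convex c : convex_set (sublevel F c).
Proof.
rewrite lslc_sublevelE => x y l; rewrite !inE => hx hy G hG.
have [_ h2 _] := hG; have := h2 c x y l; rewrite !inE; apply; [exact: hx|exact: hy].
Qed.

(** A function equal to [-oo] on a half-space and to a constant outside is lower
    semicontinuous and level convex, and the envelope dominates those which are
    below [f]. *)
Lemma lslc_ge_halfspace y (t m : R) zeta :
  (forall xi, f xi <= m -> dot xi y <= t) -> t < dot zeta y -> (m%:E <= F zeta)%E.
Proof.
move=> H tz; pose G xi : \bar R := if dot xi y <= t then -oo%E else m%:E.
have sG c : sublevel G c = if c < m then [set x | dot x y <= t] else setT.
  rewrite /sublevel /G; have [cm|cm] := ltP c m; apply/seteqP; split => xi /=.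
  - by have [//|_] := boolP (dot xi y <= t); rewrite lee_fin leNgt cm.
  - by move=> ->; rewrite leNye.
  - by [].
  - by have [_|_ _] := boolP (dot xi y <= t); rewrite ?leNye// lee_fin.
have -> : m%:E = G zeta by rewrite /G leNgt tz.
apply: lslc_ge => [c|c|eta].
- by rewrite sG; case: ifP => _; [exact: closed_halfspace|exact: closedT].
- rewrite sG; case: ifP => _; first exact: convex_halfspace.
  by move=> a b l; rewrite !inE.
- rewrite /G; case: ifPn => [_|nt]; first by rewrite leNye.
  by rewrite lee_fin leNgt; apply: contra nt => /ltW /H.
Qed.

Lemma sublevel_compact (c : R) : compact [set x | f x <= c].
Proof.
apply: bounded_closed_compact; first exact: f_coercive.
apply: (@preimage_closed _ _ f [set s | s <= c]); last exact: closed_le.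
by move=> x _; exact: f_cont.
Qed.

(** The sublevel sets of the envelope are no wider, in any direction, than those
    of [f]: otherwise a half-space containing a slightly larger sublevel set of
    [f] would, by [lslc_ge_halfspace], give a larger envelope. Compactness of
    the sublevel sets provides this slightly larger level. *)
Lemma lslc_support y (m : R) zeta : (F zeta <= m%:E)%E ->
  exists xi, f xi <= m /\ dot zeta y <= dot xi y.
Proof.
move=> Fm.
have Z (t : R) : t < dot zeta y -> exists xi, f xi <= m /\ t < dot xi y.
  move=> tz; apply: contrapT => Hn.
  pose t' := (t + dot zeta y) / 2.
  have [tt' t'z] : t < t' /\ t' < dot zeta y by rewrite /t'; split; lra.
  pose E := [set x | f x <= m + 1] `&` [set x | dot x (- y) <= - t'].
  have cE : compact E.
    have sE : E `<=` [set x | f x <= m + 1] by move=> x [].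
    apply: subclosed_compact sE; last exact: sublevel_compact.
    apply: closedI; last exact: closed_halfspace.
    by apply: compact_rV_closed; exact: sublevel_compact.
  have [m' mm' Hm'] : exists2 m', m < m' & forall xi, f xi <= m' -> dot xi y <= t'.
    have [E0|E0] := pselect (E !=set0); last first.
      exists (m + 1); first by rewrite ltrDl.
      move=> xi fxi; rewrite leNgt; apply/negP => h; apply: E0; exists xi; split => //=.
      by rewrite dotNr lerN2 ltW.
    have [c cE' cmin] := EVT_min_rV E0 cE (continuous_subspaceT f_cont).
    have [fc tc] : E c by rewrite inE in cE'.
    have mc : m < f c.
      rewrite ltNge; apply/negP => fcm; apply: Hn; exists c; split => //.
      by move: tc; rewrite /= dotNr lerN2; apply: lt_le_trans.
    exists ((m + Num.min (f c) (m + 1)) / 2).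
      have : m < Num.min (f c) (m + 1) by rewrite lt_min mc ltrDl ltr01.
      by lra.
    have [h1 h2] : Num.min (f c) (m + 1) <= f c /\ Num.min (f c) (m + 1) <= m + 1.
      by rewrite !ge_min !lexx orbT.
    move=> xi fxi; rewrite leNgt; apply/negP => h.
    have Exi : E xi.
      split => /=; last by rewrite dotNr lerN2 ltW.
      have : m < Num.min (f c) (m + 1) by rewrite lt_min mc ltrDl ltr01.
      by lra.
    have := cmin xi (mem_set Exi).
    have : m < Num.min (f c) (m + 1) by rewrite lt_min mc ltrDl ltr01.
    by lra.
  have := le_trans (lslc_ge_halfspace Hm' t'z) Fm.
  by rewrite lee_fin leNgt mm'.
have [||xi xiK ximax] := @EVT_max_rV R n (fun x => dot x y) _ _ (@sublevel_compact m).
- have [xi [h _]] : exists xi, f xi <= m /\ dot zeta y - 1 < dot xi y.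
    by apply: Z; rewrite ltrBlDr ltrDl.
  by exists xi.
- by apply: continuous_subspaceT => x; exact: continuous_dotl.
exists xi; split; first by rewrite inE in xiK.
rewrite leNgt; apply/negP => /Z[eta [h1]].
by rewrite ltNge ximax// inE.
Qed.

(** Compactness of the unit sphere: each point of [S] handles an open set of
    directions with a margin [1/(k+1)], and finitely many of these open sets
    suffice. *)
Lemma finite_positive_span (S : set V) xi0 :
  (forall y, y != 0 -> exists xi, S xi /\ 0 < dot (xi - xi0) y) ->
  exists (Xi : seq V) (d : R), [/\ 0 < d, forall xi, xi \in Xi -> S xi & spans Xi xi0 d].
Proof.
move=> H; pose sph := [set y : V | `|y| = 1].
have csph : compact sph.
  apply: bounded_closed_compact.
    apply: (@sub_bounded_set _ _ _ (cube 0 1)).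
      by move=> y; rewrite /sph /cube /= subr0 => ->.
    by apply: compact_bounded; exact: compact_cube.
  rewrite (_ : sph = (fun y : V => `|y|) @^-1` [set 1])//.
  apply: preimage_closed; last exact: closed_eq.
  by move=> y _; exact: norm_continuous.
pose U (p : V * nat) := [set y | p.2.+1%:R^-1 < dot (p.1 - xi0) y].
have := csph; rewrite compact_cover => /(_ _ [set p : V * nat | S p.1] U) [].
- move=> p _; rewrite /U (_ : mkset _ = dot (p.1 - xi0) @^-1` [set s | p.2.+1%:R^-1 < s])//.
  by apply: open_comp; [move=> y _; exact: continuous_dot|exact: open_gt].
- move=> y y1; have y0 : y != 0 by rewrite -normr_gt0 y1.
  have [xi [Sxi xiy]] := H y y0.
  have [k _ /(_ k (leqnn k)) ke] := near_infty_natSinv_lt (PosNum xiy).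
  by exists (xi, k).
move=> D DS Dcov; pose N := (\max_(p <- finmap.enum_fset D) p.2)%N.
exists (map (fun p : V * nat => p.1) (finmap.enum_fset D)), (N.+1%:R^-1); split.
- by rewrite invr_gt0.
- by move=> _ /mapP[p pD ->]; have := DS p pD; rewrite inE.
move=> y y0; have ny : 0 < `|y| by rewrite normr_gt0.
have [|p pD Up] := Dcov (`|y|^-1 *: y).
  by rewrite /sph /= normrZ normfV normr_id mulVf// gt_eqF.
exists p.1; first by apply: map_f.
rewrite -ler_pdivlMr// mulrC -dotZr; apply: le_trans (ltW Up).
rewrite lef_pV2 ?posrE// ler_nat ltnS; exact: leq_bigmax_seq.
Qed.

(** Points where [f] is less than [c] exist on all sides of [xi0], by
    [lslc_support] and the continuity of [f]; so [xi0] is interior to the convex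
    set where the envelope is at most [c]. *)
Lemma lslc_near xi0 (m c : R) : (F xi0 <= m%:E)%E -> m < c ->
  exists2 r, 0 < r & forall p, `|p - xi0| <= r -> (F p <= c%:E)%E.
Proof.
move=> Fm mc.
have [|Xi [d [d0 XiS span]]] := @finite_positive_span [set x | f x <= c] xi0.
  move=> y y0; have [xi [fxi xiy]] := lslc_support y Fm.
  have /cvgrPdist_lt/(_ (c - m)) := @f_cont xi; rewrite subr_gt0 => /(_ mc).
  move=> /nbhs_ballP[e /= e0 eP].
  have ny : 0 < `|y| by rewrite normr_gt0.
  pose t := e / 2 / `|y|; have t0 : 0 < t by rewrite !divr_gt0.
  exists (xi + t *: y); split => /=.
    have : `|f xi - f (xi + t *: y)| < c - m.
      apply: eP; rewrite -ball_normE /= opprD addrA subrr add0r normrN normrZ.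
      by rewrite gtr0_norm// divfK ?gt_eqF// ltr_pdivrMr// ltr_pMr// ltr1n.
    by rewrite ltr_norml => /andP[h1 _]; lra.
  rewrite dotBl dotDl dotZl; have := mulr_gt0 t0 (dot_gt0 y0); lra.
exists (d / n.+1%:R); first by rewrite divr_gt0.
move=> p pr; apply: contrapT => Fp.
have ne : sublevel F c !=set0.
  by exists xi0; rewrite /sublevel /=; apply: le_trans Fm _; rewrite lee_fin ltW.
have [q [qp Hq]] := convex_projection (@lslc_closed c) (@lslc_convex c) ne Fp.
have y0 : p - q != 0 by rewrite subr_eq0 eq_sym.
have [xi xiX] := span _ y0.
have fxi := XiS _ xiX.
have : sublevel F c xi by rewrite /sublevel /=; apply: le_trans (lslc_le xi) _; rewrite lee_fin.
move=> /Hq h1.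
have -> : xi - xi0 = (xi - q) - (p - q) + (p - xi0) by apply/rowP => i; rewrite !mxE; ring.
rewrite dotDl dotBl => h2.
have h3 := dot_gt0 y0; have h4 := le_norm_dot (p - xi0) (p - q).
have h5 : n%:R * `|p - xi0| * `|p - q| <= d * `|p - q|.
  apply: ler_wpM2r => //; rewrite ler_pdivlMr// in pr.
  apply: le_trans pr; rewrite mulrC; apply: ler_wpM2l => //.
  by rewrite ler_nat.
by have := ler_norm (dot (p - xi0) (p - q)); lra.
Qed.

Hypothesis lslc_const : let A := [set xi | (F xi < (f xi)%:E)%E] in
  forall xi eta, A xi -> connected_component A xi eta -> F eta = F xi.

(** The envelope is less than [f] near [xi0], hence constant there, and a whole
    ball is contained in the sublevel set of level [m] of the envelope, instead
    of a slightly larger level. By [lslc_support] the sublevel set of [f] of the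
    same level [m] surrounds that ball. *)
Lemma lslc_const_span xi0 (m : R) : (F xi0 <= m%:E)%E -> m < f xi0 ->
  exists (Xi : seq V) (d : R), [/\ 0 < d, forall xi, xi \in Xi -> f xi <= m & spans Xi xi0 d].
Proof.
move=> Fm mf; pose c := (m + f xi0) / 2.
have [mc cf] : m < c /\ c < f xi0 by rewrite /c; split; lra.
have [r r0 rP] := lslc_near Fm mc.
have : nbhs xi0 [set x | c < f x].
  exact: (@f_cont xi0 [set s | c < s] (lt_nbhsr cf)).
move=> /nbhs_ballP[r' /= r'0 r'P].
pose r2 := Num.min r (r' / 2); have r20 : 0 < r2 by rewrite lt_min r0 divr_gt0.
pose A := [set xi | (F xi < (f xi)%:E)%E].
have rA p : `|p - xi0| <= r2 -> A p.
  rewrite le_min => /andP[p1 p2]; apply: le_lt_trans (rP _ p1) _.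
  rewrite lte_fin; apply: r'P; rewrite -ball_normE /= distrC.
  by apply: le_lt_trans p2 _; rewrite ltr_pdivrMr// ltr_pMr// ltr1n.
have FE p : `|p - xi0| <= r2 -> F p = F xi0.
  move=> pr; apply: lslc_const; first by apply: rA; rewrite subrr normr0 ltW.
  pose g (t : R) : V := xi0 + t *: (p - xi0).
  apply: (@connected_component_max _ A (g @` [set` `[0, 1]])).
  - by exists 0; rewrite /= ?in_itv /= ?lexx ?ler01// /g scale0r addr0.
  - move=> _ [t /= + <-]; rewrite in_itv /= => /andP[t0 t1]; apply: rA.
    rewrite /g addrAC subrr add0r normrZ ger0_norm//; apply: le_trans pr.
    by rewrite ler_piMl.
  - apply: connected_continuous_connected; first exact: segment_connected.
    apply: continuous_subspaceT => t; rewrite /continuous_at /g.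
    apply: (@cvgD R V); first exact: cvg_cst.
    by apply: (@cvgZr_tmp R V); exact: cvg_id.
  - by exists 1; rewrite /= ?in_itv /= ?lexx ?ler01// /g scale1r addrC subrK.
apply: finite_positive_span => y y0.
have ny : 0 < `|y| by rewrite normr_gt0.
pose t := r2 / `|y|; have t0 : 0 < t by rewrite divr_gt0.
have pz : `|xi0 + t *: y - xi0| <= r2.
  by rewrite addrAC subrr add0r normrZ gtr0_norm// divfK// gt_eqF.
have Fz : (F (xi0 + t *: y) <= m%:E)%E by rewrite FE.
have [xi [fxi]] := lslc_support y Fz.
rewrite dotDl dotZl => h; exists xi; split => //.
rewrite dotBl; have := mulr_gt0 t0 (dot_gt0 y0); lra.
Qed.

End envelope.

End convexity.

(** * Exhaustion of an open set by disjoint compact pieces *)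

Section covering.
Context {R : realType} {n : nat}.
Local Notation V := 'rV[R]_n.
Local Notation mu := (@leb R n).
Implicit Types (A B K O U Q : set V) (x y : V).

Lemma leb_seq_le (s : seq V) (F : V -> set V) (c : V -> R) K :
  (forall x, measurable (F x)) -> (forall x, x \in s -> (mu (F x) <= (c x)%:E)%E) ->
  measurable K ->
  (forall x, K x -> exists2 y, y \in s & F y x) -> (mu K <= (\sum_(x <- s) c x)%:E)%E.
Proof.
move=> mF; elim: s K => [|y s IH] K Fc mK KF.
  rewrite big_nil (_ : K = set0) ?measure0//.
  by apply/seteqP; split => // x /KF[].
have -> : K = (K `&` F y) `|` (K `\` F y) by rewrite setUIDK.
apply: le_trans (measureU2 _ _ _) _; [exact: measurableI|exact: measurableD|].
rewrite big_cons EFinD; apply: leeD.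
  apply: le_trans (Fc y (mem_head _ _)).
  by apply: le_measure; rewrite ?inE//; exact: measurableI.
apply: IH => [x xs||x [Kx nFx]]; first by apply: Fc; rewrite inE xs orbT.
  exact: measurableD.
have [z] := KF x Kx; rewrite inE => /orP[/eqP ->//|zs Fz]; by exists z.
Qed.

(** The finite Vitali covering lemma, for cubes: select greedily by decreasing
    radius. *)
Lemma vitali_cubes (r : V -> R) (s : seq V) : (forall x, x \in s -> 0 < r x) ->
  exists D : seq V, [/\ {subset D <= s},
    pairwise (fun x y => `[< cube x (r x) `&` cube y (r y) = set0 >]) D &
    forall x, x \in s -> exists2 y, y \in D & cube x (r x) `<=` cube y (r y *+ 3)].
Proof.
have [m] := ubnP (size s); elim: m s => // m IH [|x0 s0] sm r0.
  by exists [::].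
set s := x0 :: s0 in sm r0 *.
have [x xs xmax] : exists2 x, x \in s & forall y, y \in s -> r y <= r x.
  rewrite /s; elim: (s0) (x0) => [z|a t IHt z].
    by exists z; rewrite ?inE// => y; rewrite inE => /eqP ->.
  have [w wt wmax] := IHt a; have [h|h] := leP (r w) (r z).
    exists z; first by rewrite inE eqxx.
    move=> y; rewrite inE => /orP[/eqP ->//|/wmax H]; exact: le_trans H h.
  exists w; first by rewrite inE wt orbT.
  by move=> y; rewrite inE => /orP[/eqP ->|/wmax//]; exact: ltW.
(* keep the largest cube, and recurse on those disjoint from it *)
pose far y := `[< cube x (r x) `&` cube y (r y) = set0 >].
have xfar : ~~ far x.
  apply/negP => /asboolP; rewrite setIid => /seteqP[H _]; apply: (H x).
  by rewrite /cube /= subrr normr0 ltW// r0.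
have [||D [Ds Dp Dc]] := IH [seq y <- s | far y].
- rewrite ltnS in sm; apply: leq_trans sm; rewrite size_filter -(count_predC far s).
  by rewrite -addn1 leq_add2l -has_count; apply/hasP; exists x.
- by move=> y; rewrite mem_filter => /andP[_ /r0].
exists (x :: D); split.
- move=> y; rewrite inE => /orP[/eqP ->//|/Ds].
  by rewrite mem_filter => /andP[].
- by rewrite /= Dp andbT; apply/allP => y /Ds; rewrite mem_filter => /andP[].
move=> y ys; have [fy|/asboolPn/eqP/set0P[z [zx zy]]] := boolP (far y).
  have [|w wD H] := Dc y; first by rewrite mem_filter fy.
  by exists w => //; rewrite inE wD orbT.
exists x; first by rewrite inE eqxx.
move=> w wy; rewrite /cube /= in zx zy wy *.
rewrite -(subrKA z); apply: le_trans (ler_normD _ _) _.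
have h : `|w - z| <= `|w - y| + `|z - y|.
  by rewrite -(subrKA y w) (distrC z); exact: ler_normD.
have := xmax y ys; rewrite !mulrS mulr0n; lra.
Qed.

Lemma open_compact_approx O : open O -> (mu O < +oo)%E -> (0 < mu O)%E ->
  exists K, [/\ compact K, K `<=` O & (mu O <= 2%:E * mu K)%E].
Proof.
move=> oO Ooo Opos; have [D [DP DO]] := open_sigma_compact oO.
have cD k : compact (D k) by have [] := DP k.
pose E k := \big[setU/set0]_(j < k.+1) D j.
have cE k : compact (E k).
  by rewrite /E; elim/big_ind: _ => [|A B|j _]; [exact: compact0|exact: compactU|exact: cD].
have EO : \bigcup_k E k = O.
  by rewrite -DO -[RHS]bigcup_bigsetU_bigcup.
have mE k : measurable (E k) by exact: compact_rV_measurable.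
have mO : measurable O by exact: open_rV_measurable.
have cv : (mu \o E) k @[k --> \oo] --> mu O.
  rewrite -EO; apply: nondecreasing_cvg_mu => //; first by rewrite EO.
  by move=> i j ij; apply/subsetPset; exact: (subset_bigsetU (F := D)).
have fO : mu O \is a fin_num by rewrite ge0_fin_numE.
have half : ((fine (mu O) / 2)%:E < mu O)%E.
  have f0 : 0 < fine (mu O) by rewrite fine_gt0// Opos.
  rewrite -[ltRHS](fineK fO) lte_fin ltr_pdivrMr// ltr_pMr// ltr1n//.
have [N HN] : exists N, ((fine (mu O) / 2)%:E < mu (E N))%E.
  apply: contrapT => /forallNP Hn; move: half; apply/negP; rewrite -leNgt.
  apply: (@le_trans _ _ (limn (mu \o E))); first by rewrite (cvg_lim _ cv).
  apply: lime_le; first by apply/cvg_ex; exists (mu O).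
  by apply: nearW => k; rewrite leNgt; apply/negP; exact: (Hn k).
exists (E N); split => //.
  by rewrite -[in X in _ `<=` X]EO; exact: bigcup_sup.
rewrite -[leLHS](fineK fO).
apply: (@le_trans _ _ (2%:E * (fine (mu O) / 2)%:E)%E).
  by rewrite -EFinM mulrC divfK.
by apply: lee_wpmul2l => //; exact: ltW.
Qed.

Section exhaustion.
Context (QQ : set (set V)).
Hypothesis QQ_compact : forall Q, QQ Q -> compact Q.
Hypothesis QQ0 : QQ set0.
Hypothesis QQU : forall Q Q', QQ Q -> QQ Q' -> Q `&` Q' = set0 -> QQ (Q `|` Q').

Let QQm Q : QQ Q -> measurable Q.
Proof. by move=> /QQ_compact/compact_rV_measurable. Qed.

(** The hypothesis of a covering theorem of Vitali type: the threshold [d] may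
    depend on the point, but not the proportion [c]. *)
Definition fine_cover (A : set V) (c : R) : Prop := forall x, A x ->
  exists2 d, 0 < d & forall r, 0 < r < d ->
    exists Q, [/\ QQ Q, Q `<=` cube x r & cube x (c * r) `<=` Q].

(** Cover half of the measure of [O] by finitely many cubes, extract disjoint
    ones whose triples still cover it, and place in each an element of the
    family: each dimension loses a factor [c / 3]. *)
Lemma fine_cover_fraction A O (c : R) : 0 < c -> fine_cover A c -> open O ->
  O `<=` A -> (mu O < +oo)%E ->
  exists Q, [/\ QQ Q, Q `<=` O & (((c / 3) ^+ n / 2)%:E * mu O <= mu Q)%E].
Proof.
move=> c0 fA oO OA Ooo.
have [mO0|] := leP (mu O) 0%E.
  exists set0; split => //; have -> : mu O = 0%E by apply/eqP; rewrite eq_le mO0 measure_ge0.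
  by rewrite mule0.
move=> /(open_compact_approx oO Ooo)[K [cK KO OK]].
have /choice[rP HrP] : forall x, exists p : R * set V, O x ->
    [/\ 0 < p.1, cube x p.1 `<=` O & [/\ QQ p.2, p.2 `<=` cube x p.1 & cube x (c * p.1) `<=` p.2]].
  move=> x; have [Ox|nOx] := pselect (O x); last by exists (0, set0).
  have [d d0 dP] := fA x (OA x Ox); have [e e0 eP] := open_cube oO Ox.
  pose r := Num.min (d / 2) e.
  have r0 : 0 < r by rewrite lt_min divr_gt0.
  have rd : r < d.
    by apply: (@le_lt_trans _ _ (d / 2)); [rewrite ge_min lexx|rewrite ltr_pdivrMr// ltr_pMr// ltr1n].
  have [|Q [h1 h2 h3]] := dP r; first by rewrite r0.
  exists (r, Q) => _; split => //=.
  by apply: subset_trans eP => y /= yr; apply: le_trans yr _; rewrite ge_min lexx orbT.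
pose r x := (rP x).1; pose Q x := (rP x).2.
have := cK; rewrite compact_cover => /(_ _ O (fun x => ball x (r x))) [].
- by move=> x _; exact: ball_open.
- by move=> x Kx; exists x; [exact: KO|apply: ballxx; have [] := HrP x (KO x Kx)].
move=> D DO Dcov; pose s : seq V := finmap.enum_fset D.
have sO x : x \in s -> O x by move=> /DO; rewrite inE.
have [E [Es Ep Ec]] := @vitali_cubes r s (fun x xs => let: And3 h _ _ := HrP x (sO x xs) in h).
have HE x : x \in E -> [/\ 0 < r x, cube x (r x) `<=` O &
    [/\ QQ (Q x), Q x `<=` cube x (r x) & cube x (c * r x) `<=` Q x]].
  by move=> /Es/sO /HrP.
have KE : (mu K <= (\sum_(x <- E) (Num.max 0 (r x) *+ 6) ^+ n)%:E)%E.
  apply: (@leb_seq_le E (fun x => cube x (Num.max 0 (r x) *+ 3))) => [x|x xE||x Kx].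
  - by apply: measurable_cube; rewrite mulrn_wge0// le_max lexx.
  - by rewrite leb_cube ?mulrn_wge0 ?le_max ?lexx// -mulrnA.
  - exact: compact_rV_measurable.
  have [y yD bx] := Dcov x Kx.
  have ys : y \in s by [].
  have [z zE H] := Ec y ys; exists z => //; have [z0 _ _] := HE z zE.
  rewrite (max_idPr (ltW z0)); apply: H; rewrite /cube /= distrC; apply: ltW.
  by rewrite -ball_normE in bx.
have [Q' [h1 h2 h3]] : exists Q', [/\ QQ Q', forall x, Q' x -> exists2 y, y \in E & Q y x &
   (mu Q' >= (\sum_(x <- E) (c * Num.max 0 (r x) *+ 2) ^+ n)%:E)%E].
  elim: (E) HE Ep => [|x E' IH] HE Ep.
    by exists set0; split => //; rewrite big_nil measure0.
  move: Ep => /= /andP[/allP px /IH [|Q1 [g1 g2 g3]]].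
    by move=> y yE; apply: HE; rewrite inE yE orbT.
  have [x0 _ [q1 q2 q3]] := HE x (mem_head _ _).
  have dis : Q x `&` Q1 = set0.
    apply/seteqP; split => // y [Qxy /g2[z zE Qzy]].
    have /asboolP/seteqP[H _] := px z zE.
    have zE' : z \in x :: E' by rewrite inE zE orbT.
    have [_ _ [_ h _]] := HE z zE'.
    by apply: (H y); split; [exact: q2|exact: h].
  exists (Q x `|` Q1); split; first exact: QQU.
    move=> y [Qy|/g2[z zE Qz]]; first by exists x; rewrite ?mem_head.
    by exists z => //; rewrite inE zE orbT.
  rewrite measureU//; [|exact: QQm|exact: QQm].
  rewrite big_cons EFinD leeD// (max_idPr (ltW x0)) -(leb_cube x); last first.
    by rewrite mulr_ge0// ltW.
  apply: le_measure; rewrite ?inE//; [|exact: QQm].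
  by apply: measurable_cube; rewrite mulr_ge0// ltW.
exists Q'; split => //.
  by move=> x /h2[y yE Qy]; have [_ yO [_ q _]] := HE y yE; apply: yO; exact: q.
apply: le_trans h3; have c3 : 0 <= c / 3 by rewrite divr_ge0// ltW.
apply: (@le_trans _ _ (((c / 3) ^+ n / 2)%:E * (2%:E * mu K))%E).
  by apply: lee_wpmul2l => //; rewrite lee_fin divr_ge0// exprn_ge0.
rewrite muleA -EFinM divfK//.
apply: (@le_trans _ _ (((c / 3) ^+ n)%:E * (\sum_(x <- E) (Num.max 0 (r x) *+ 6) ^+ n)%:E)%E).
  by apply: lee_wpmul2l => //; rewrite lee_fin exprn_ge0.
rewrite -EFinM lee_fin mulr_sumr; apply: ler_sum => x _.
rewrite -exprMn le_eqVlt; apply/orP; left; apply/eqP; congr (_ ^+ n).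
by move: (Num.max 0 (r x)) => t; rewrite !mulrS mulr0n; field.
Qed.

Context (U : set V) (A_ : nat -> set V) (c_ : nat -> R).
Hypothesis oU : open U.
Hypothesis Uoo : (mu U < +oo)%E.
Hypothesis oA : forall k, open (A_ k).
Hypothesis UA : U = \bigcup_k A_ k.
Hypothesis c0 : forall k, 0 < c_ k.
Hypothesis fA : forall k, fine_cover (A_ k) (c_ k).

Let greedy O : open O -> O `<=` U -> exists Q, [/\ QQ Q, Q `<=` O &
  forall Q', QQ Q' -> Q' `<=` O -> (mu Q' <= 2%:E * mu Q)%E].
Proof.
move=> oO OU; have mO := open_rV_measurable oO; have mU := open_rV_measurable oU.
have Qoo Q : QQ Q -> (mu Q < +oo)%E by move=> /QQ_compact/compact_leb_lty.
have Qf Q : QQ Q -> mu Q \is a fin_num by move=> /Qoo; rewrite ge0_fin_numE.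
pose S : set R := [set fine (mu Q) | Q in [set Q | QQ Q /\ Q `<=` O]].
have hS : has_sup S.
  split; first by exists (fine (mu set0)), set0 => //; split => // x [].
  exists (fine (mu U)) => _ [Q [h1 h2] <-]; apply: fine_le; [exact: Qf|by rewrite ge0_fin_numE|].
  by apply: le_measure; rewrite ?inE//; [exact: QQm|exact: subset_trans OU].
have [s0|s0] := leP (sup S) 0.
  exists set0; split => // Q' h1 h2; rewrite measure0 mule0.
  rewrite -(fineK (Qf _ h1)) lee_fin; apply: le_trans s0.
  by apply: sup_upper_bound => //; exists Q'.
have s2 : 0 < sup S / 2 by rewrite divr_gt0.
have [_ [Q [h1 h2] <-] hQ] := sup_adherent s2 hS.
exists Q; split => // Q' h3 h4.
rewrite -(fineK (Qf _ h1)) -(fineK (Qf _ h3)) -EFinM lee_fin.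
have : fine (mu Q') <= sup S by apply: sup_upper_bound => //; exists Q'.
lra.
Qed.

(** Remove successively elements of the family whose measure is at least half
    the largest available one. The removed pieces are disjoint in a set of
    finite measure, so their measures tend to 0; but if the remainder met [A_k]
    in a set of positive measure, [fine_cover_fraction] would keep providing
    pieces whose measure is bounded below. *)
Lemma exhaustion_cover : exists Q_ : nat -> set V, [/\ forall j, QQ (Q_ j),
  forall j, Q_ j `<=` U, trivIset setT Q_ & mu (U `\` \bigcup_j Q_ j) = 0%E].
Proof.
have /choice[ch chP] : forall O, exists Q, open O -> O `<=` U -> [/\ QQ Q, Q `<=` O &
    forall Q', QQ Q' -> Q' `<=` O -> (mu Q' <= 2%:E * mu Q)%E].
  move=> O; have [oO|noO] := pselect (open O /\ O `<=` U); last first.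
    by exists set0 => h1 h2; exfalso; apply: noO.
  by have [Q H] := greedy oO.1 oO.2; exists Q.
pose C := fix C j := if j is j'.+1 then C j' `|` ch (U `\` C j') else set0.
have oC_ (K : set V) : closed K -> open (U `\` K).
  by move=> clK; rewrite setDE; apply: openI => //; exact: closed_openC.
have clC j : closed (C j).
  elim: j => [|j IH]; first exact: closed0.
  have subU : U `\` C j `<=` U by move=> x [].
  apply: closedU => //; have [h1 _ _] := chP _ (oC_ _ IH) subU.
  exact: compact_rV_closed (QQ_compact h1).
pose Q_ j := ch (U `\` C j).
have QP j : [/\ QQ (Q_ j), Q_ j `<=` U `\` C j &
    forall Q', QQ Q' -> Q' `<=` U `\` C j -> (mu Q' <= 2%:E * mu (Q_ j))%E].
  by apply: chP; [exact: oC_|move=> x []].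
have QC i j : (i < j)%N -> Q_ i `<=` C j.
  elim: j => // j IH; rewrite ltnS leq_eqVlt => /orP[/eqP ->|/IH H] x Qx; [by right|left].
  exact: H.
have mC j : measurable (C j) by exact: closed_rV_measurable.
have mU := open_rV_measurable oU.
have CU j : C j `<=` U.
  elim: j => // j IH x [/IH//|Qx]; have [_ h _] := QP j.
  by have [] := h x Qx.
have small (a : R) : 0 < a -> exists j, (mu (Q_ j) < a%:E)%E.
  move=> a0; apply: contrapT => /forallNP Hn.
  have Ca j : ((j%:R * a)%:E <= mu (C j))%E.
    elim: j => [|j IH]; first by rewrite mul0r measure0.
    have [h1 h2 _] := QP j.
    rewrite /= measureU//; [|exact: QQm|]; last first.
      by apply/seteqP; split => // x [Cx /h2[_]].
    rewrite -natr1 mulrDl mul1r EFinD leeD// leNgt; apply/negP; exact: (Hn j).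
  have fU : mu U \is a fin_num by rewrite ge0_fin_numE.
  pose j := (Num.trunc (fine (mu U) / a)).+1.
  have : ((j%:R * a)%:E <= mu U)%E.
    by apply: le_trans (Ca j) _; apply: le_measure; rewrite ?inE//; exact: CU.
  rewrite -(fineK fU) lee_fin -ler_pdivlMr// leNgt => /negP; apply.
  exact: truncnS_gt.
exists Q_; split => //.
- by move=> j; have [] := QP j.
- by move=> j x Qx; have [_ /(_ x Qx)[]] := QP j.
- apply/trivIsetP => i j _ _ ij; wlog ltij : i j ij / (i < j)%N.
    move=> H; have := ij; rewrite neq_ltn => /orP[lij|lij]; first exact: H.
    by rewrite setIC; apply: H => //; rewrite eq_sym.
  have [_ h2 _] := QP j; apply/seteqP; split => // x [/(QC _ _ ltij) Cx /h2[_]]; exact.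
have mbQ : measurable (\bigcup_j Q_ j).
  by apply: bigcupT_measurable => j; apply: QQm; have [] := QP j.
set L := U `\` _; have mL : measurable L by exact: measurableD.
have LE : L = \bigcup_k (A_ k `&` L).
  by rewrite -setI_bigcupl -UA; apply/esym/setIidr => x [].
have mAL k : measurable (A_ k `&` L).
  by apply: measurableI => //; exact: open_rV_measurable.
suff H k : mu (A_ k `&` L) = 0%E.
  rewrite LE; apply/eqP; rewrite eq_le measure_ge0 andbT.
  have := @generalized_Boole_inequality _ _ _ mu (fun k => A_ k `&` L) mAL.
  by rewrite -LE => /(_ mL) /le_trans; apply; rewrite eseries0// => i _ _; exact: H.
apply/eqP; rewrite eq_le measure_ge0 andbT leNgt; apply/negP => Lpos.
have ALoo : (mu (A_ k `&` L) < +oo)%E.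
  by apply: le_lt_trans Uoo; apply: le_measure; rewrite ?inE// => x [_ []].
have fAL : mu (A_ k `&` L) \is a fin_num by rewrite ge0_fin_numE.
set l := fine (mu (A_ k `&` L)).
have l0 : 0 < l by rewrite fine_gt0// Lpos.
set t := (c_ k / 3) ^+ n / 2; have t0 : 0 < t by rewrite divr_gt0// exprn_gt0// divr_gt0.
have [|j Hj] := small (t * l / 2); first by rewrite divr_gt0// mulr_gt0.
pose O := A_ k `&` (U `\` C j).
have oO : open O by apply: openI => //; exact: oC_.
have OU : O `<=` U by move=> x [_ []].
have Ooo : (mu O < +oo)%E.
  by apply: le_lt_trans Uoo; apply: le_measure; rewrite ?inE//; exact: open_rV_measurable.
have [Q [q1 q2 q3]] := fine_cover_fraction (c0 k) (fA (k := k)) oO (fun x h => h.1) Ooo.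
have [_ _ /(_ Q q1 (fun x h => (q2 x h).2)) h] := QP j.
have LO : (mu (A_ k `&` L) <= mu O)%E.
  apply: le_measure; rewrite ?inE//; first exact: open_rV_measurable.
  move=> x [Ax [Ux nQ]]; split => //; split => // Cx; apply: nQ.
  move: Cx; elim: j {Hj O oO OU Ooo q2 q3 h} => // j IH [/IH//|Qx]; by exists j.
have : (t%:E * mu (A_ k `&` L) < t%:E * l%:E)%E.
  apply: (@le_lt_trans _ _ (2%:E * mu (Q_ j))%E).
    apply: le_trans h; apply: le_trans q3; apply: lee_wpmul2l => //.
    by rewrite lee_fin ltW.
  have fQ : mu (Q_ j) \is a fin_num by rewrite ge0_fin_numE//; apply: lt_trans Hj _; exact: ltry.
  move: Hj; rewrite -(fineK fQ) lte_fin -!EFinM lte_fin; lra.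
by rewrite -(fineK fAL) ltxx.
Qed.

End exhaustion.

End covering.

(** * The weak gradient of a continuously differentiable function *)

Section classical_gradient.
Context {R : realType} {n : nat}.
Local Notation V := 'rV[R]_n.
Local Notation e_ i := (delta_mx ord0 i : V).
Local Notation mu := (@leb R n).
Implicit Types (u h phi : V -> R) (W K Omega : set V).

Lemma continuous_locally_integrable W h : open W -> {in W, continuous h} ->
  locally_integrable_on W h.
Proof.
move=> oW ch K cK KW; have mK := compact_rV_measurable cK.
have [M M0 HM] := continuous_in_bounded ch cK KW.
apply: measurable_bounded_integrable => //; first exact: compact_leb_lty.
  apply: measurable_funS KW _; first exact: open_rV_measurable.
  exact: open_continuous_measurable_rV.
exact: bounded_onW HM.
Qed.

Lemma class_C1P W u : class_C 1 W u -> [/\ {in W, continuous u},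
  forall x i, W x -> is_derive x (e_ i) u (partial i u x) &
  forall i, {in W, continuous (partial i u)}].
Proof.
move=> [cu H]; split => // [x i Wx|i]; last by have [_ []] := H i.
by have [H1 _] := H i; apply/derivableP; exact: H1.
Qed.

(** The weak gradient is the classical one on an open set where the function is
    continuously differentiable: the product with a test function is then
    globally Lipschitz, so that integrating its derivative gives 0. *)
Lemma class_C1_weak_gradient Omega W u g : open Omega -> open W -> W `<=` Omega ->
  class_C 1 W u -> weak_gradient Omega u g ->
  \forall x \ae mu, W x -> g x = gradient u x.
Proof.
move=> oO oW WO /class_C1P[cu du cdu] gu.
have mW := open_rV_measurable oW.
have lu := continuous_locally_integrable oW cu.
have H i : \forall x \ae mu, W x -> coor i (g x) - partial i u x = 0.
  have [ig gE] := gu i.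
  have lg : locally_integrable_on W (coor i \o g).
    by move=> K cK KW; apply: ig => //; exact: subset_trans WO.
  have lp := continuous_locally_integrable oW (cdu i).
  apply: (@test_functions_separate _ _ W (fun x => coor i (g x) - partial i u x)) => //.
    move=> K cK KW.
    exact: (integrableB (compact_rV_measurable cK) (lg K cK KW) (lp K cK KW)).
  move=> phi tphi; have tphi' := test_partial tphi i.
  have j1 := locally_integrable_test mW lg tphi.
  have j2 := locally_integrable_test mW lp tphi.
  have j3 := locally_integrable_test mW lu tphi'.
  under eq_integral do rewrite mulrBl.
  rewrite integralB_EFin//.
  have [K [cK KW K0]] := test_suppP tphi.
  have tO : test_fun Omega phi.
    by case: tphi => h1 [h2 h3]; split => //; split => //; exact: subset_trans WO.
  have out x : ~ W x -> phi x = 0 /\ partial i phi x = 0.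
    by move=> /(contra_not (KW x))/K0[h1 h2].
  have E1 : (\int[mu]_(x in W) (coor i (g x) * phi x)%:E =
     - \int[mu]_(x in W) (u x * partial i phi x)%:E)%E.
    rewrite (@integral_supp _ _ W (fun x => (coor i (g x) * phi x)%:E)); last first.
      by move=> x /out[-> _]; rewrite mulr0.
    rewrite (@integral_supp _ _ W (fun x => (u x * partial i phi x)%:E)); last first.
      by move=> x /out[_ ->]; rewrite mulr0.
    rewrite -(@integral_supp _ _ Omega (fun x => (u x * partial i phi x)%:E)); last first.
      by move=> x /(contra_not (WO x))/out[_ ->]; rewrite mulr0.
    rewrite -(@integral_supp _ _ Omega (fun x => (coor i (g x) * phi x)%:E)); last first.
      by move=> x /(contra_not (WO x))/out[-> _]; rewrite mulr0.
    by rewrite gE// oppeK.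
  pose D j x := if x \in W then u x * partial j phi x + phi x * partial j u x else 0.
  have dD x j : is_derive x (e_ j) (fun x => u x * phi x) (D j x).
    rewrite /D; case: ifPn => [|/negP]; rewrite inE => Wx.
      exact: (is_deriveM (du x j Wx) (test_derive tphi x j)).
    apply: (@is_derive_away0 _ _ _ K) => //; first exact: compact_rV_closed.
      by move=> /KW.
    by move=> y /K0[-> _]; rewrite mulr0.
  have D0 j x : ~ K x -> D j x = 0.
    by move=> /K0[h1 h2]; rewrite /D h1 h2 mulr0 mul0r addr0 if_same.
  have [M1 M10 HM1] := continuous_in_bounded cu cK KW.
  have [P P0 HP] := test_bounded tphi.
  have [P' P'0 HP'] := test_partial_bounded tphi.
  have /choice[M2 HM2] : forall j, exists M, 0 <= M /\ forall x, K x -> `|partial j u x| <= M.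
    by move=> j; have [M M0 HM] := continuous_in_bounded (cdu j) cK KW; exists M.
  pose M := M1 * P' + P * \sum_j M2 j.
  have S0 : 0 <= \sum_j M2 j by apply: sumr_ge0 => j _; have [] := HM2 j.
  have M0 : 0 <= M by rewrite addr_ge0 ?mulr_ge0.
  have DM x j : `|D j x| <= M.
    have [Kx|/(D0 j) ->] := pselect (K x); last by rewrite normr0.
    rewrite /D mem_set; last exact: KW.
    apply: le_trans (ler_normD _ _) _; rewrite !normrM lerD// ler_pM//; first exact: HM1.
    apply: le_trans ((HM2 j).2 x Kx) _; rewrite (bigD1 j)//= lerDl.
    by apply: sumr_ge0 => l _; have [] := HM2 l.
  have lip : forall x y, `|u x * phi x - u y * phi y| <= n%:R * M * `|x - y|.
    apply: (@partial_lipschitz _ _ (fun x => u x * phi x) M) => // z j; split.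
      exact: (@ex_derive _ _ _ _ _ _ _ (dD z j)).
    by rewrite [partial _ _ _](@derive_val _ _ _ _ _ _ _ (dD z j)).
  have mD : measurable_fun setT (D i).
    have -> : D i = (fun x => u x * partial i phi x + phi x * partial i u x) \_ W.
      by apply/funext => x; rewrite /D patchE.
    rewrite -measurable_restrictT//.
    apply: measurable_funD; apply: measurable_funM.
    - exact: open_continuous_measurable_rV.
    - by apply: measurable_funTS; exact: (continuous_rV_measurable (test_cont tphi')).
    - by apply: measurable_funTS; exact: (continuous_rV_measurable (test_cont tphi)).
    - exact: open_continuous_measurable_rV.
  have E2 : (\int[mu]_x (D i x)%:E = 0)%E.
    apply: (@integral_derivative0 _ _ (fun x => u x * phi x) _ i K (n%:R * M)) => //.
    - by move=> x /K0[-> _]; rewrite mulr0.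
    - by rewrite mulr_ge0.
    - by apply: aeW => x; exact: dD.
  have E3 : (\int[mu]_(x in W) (partial i u x * phi x)%:E =
     - \int[mu]_(x in W) (u x * partial i phi x)%:E)%E.
    have : (\int[mu]_(x in W) (u x * partial i phi x + partial i u x * phi x)%:E = 0)%E.
      rewrite -E2 (integral_mkcond W); apply: eq_integral => x _.
      by rewrite /D patchE; case: ifP => // _; rewrite (mulrC (phi x)).
    rewrite integralD_EFin// -(fineK (integrable_fin_num mW j3)).
    rewrite -(fineK (integrable_fin_num mW j2)) -EFinD -EFinN => -[] /eqP.
    by rewrite addrC addr_eq0 => /eqP ->.
  by rewrite E1 E3 subee// fin_numN; exact: (integrable_fin_num mW j3).
have : \forall x \ae mu, forall i, W x -> coor i (g x) - partial i u x = 0.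
  exact: filter_forall.
apply: filterS => x Hx Wx; apply/rowP => i; rewrite [RHS]mxE.
by apply/eqP; rewrite -subr_eq0; apply/eqP; exact: (Hx i).
Qed.

End classical_gradient.

(** * Pyramids *)

Section pyramid.
Context {R : realType} {n : nat}.
Local Notation V := 'rV[R]_n.
Local Notation e_ i := (delta_mx ord0 i : V).
Local Notation mu := (@leb R n).
Implicit Types (x y z xi : V) (K W : set V).

Lemma filter_forall_seq (S : Type) (G : set_system S) (T : eqType) (s : seq T)
    (P : T -> S -> Prop) : Filter G ->
  (forall t, t \in s -> \forall x \near G, P t x) ->
  \forall x \near G, forall t, t \in s -> P t x.
Proof.
move=> FG; elim: s => [|a s IH] H; first exact: nearW.
have h1 := H a (mem_head _ _).
have h2 : \forall x \near G, forall t, t \in s -> P t x.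
  by apply: IH => t ts; apply: H; rewrite inE ts orbT.
by apply: filterS2 h1 h2 => x p1 p2 t; rewrite inE => /orP[/eqP ->//|/p2].
Qed.

Lemma open_forall_seq (T : eqType) (s : seq T) (P : T -> V -> Prop) :
  (forall t, t \in s -> open [set x | P t x]) ->
  open [set x | forall t, t \in s -> P t x].
Proof.
move=> H; rewrite openE => x Hx; apply: (@filter_forall_seq _ (nbhs x) _ s P) => t ts.
by apply: open_nbhs_nbhs; split; [exact: H|exact: Hx].
Qed.

Lemma open_imply (b : Prop) (A : set V) : open A -> open [set x | b -> A x].
Proof.
move=> oA; have [hb|hb] := pselect b.
  by rewrite (_ : mkset _ = A)//; apply/seteqP; split => x /=; [exact|].
by rewrite (_ : mkset _ = setT); [exact: openT|apply/seteqP; split => // x _ /hb].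
Qed.

Lemma near_continuous (f h : V -> R) x : (\forall y \near x, f y = h y) ->
  {for x, continuous f} -> {for x, continuous h}.
Proof.
move=> fh cf; have : f @ x --> f x := cf.
change (f @ x --> f x -> h @ x --> h x).
rewrite -(nbhs_singleton fh); apply: cvg_trans.
exact: (near_eq_cvg (FF := nbhs_filter x) fh).
Qed.

Lemma ae_null (A : set V) : measurable A -> mu A = 0%E -> \forall x \ae mu, ~ A x.
Proof. by move=> mA A0; exists A; split => // x /= /contrapT. Qed.

Lemma lipschitz_gradD K s g K' s' g' : lipschitz_grad K s g -> lipschitz_grad K' s' g' ->
  lipschitz_grad (K `|` K') (fun x => s x + s' x) (fun x => g x + g' x).
Proof.
move=> [cK out [L L0 HL] [mg [M HM]] H] [cK' out' [L' L0' HL'] [mg' [M' HM']] H'].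
split.
- exact: compactU.
- move=> x nK; have /out[-> ->] : ~ K x by move=> Kx; apply: nK; left.
  by have /out'[-> ->] : ~ K' x; [move=> Kx; apply: nK; right|rewrite !addr0].
- exists (L + L'); first exact: addr_ge0.
  move=> x y; rewrite opprD addrACA mulrDl; apply: le_trans (ler_normD _ _) _.
  exact: lerD.
- split; last first.
    exists (M + M') => x; apply: le_trans (ler_normD _ _) _; exact: lerD.
  move=> i; rewrite (_ : _ \o _ = (coor i \o g) \+ (coor i \o g')).
    exact: measurable_funD.
  by apply/funext => x; rewrite /= /coor mxE.
apply: filterS2 H H' => x h h' i; have [d1 c1] := h i; have [d2 c2] := h' i; split.
  by rewrite mxE; exact: is_deriveD.
rewrite (_ : _ \o _ = (fun x => (coor i \o g) x + (coor i \o g') x)).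
  exact: (continuousD c1 c2).
by apply/funext => z; rewrite /= /coor mxE.
Qed.

Lemma gradient_near W u x (e : R) : open W -> class_C 1 W u -> W x -> 0 < e ->
  \forall y \near x, W y /\ `|gradient u y - gradient u x| <= e.
Proof.
move=> oW /class_C1P[_ _ cdu] Wx e0.
have H : \forall y \near x, forall i, `|partial i u y - partial i u x| <= e.
  apply: (@filter_forall _ _ (fun i y => `|partial i u y - partial i u x| <= e) _
    (nbhs_filter x)) => i.
  have /cvgrPdist_le/(_ e e0) := cdu i x (mem_set Wx).
  by apply: filterS => y; rewrite distrC.
have : nbhs x W by exact: open_nbhs_nbhs.
apply: filterS2 H => y H Wy; split => //.
by apply/normrV_leP => [|i]; [exact: ltW|rewrite !mxE].
Qed.

Lemma lipschitz_grad0 : lipschitz_grad set0 (fun _ : V => 0) (fun=> 0).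
Proof.
split => //.
- exact: compact0.
- by exists 0 => // x y; rewrite subrr normr0 mul0r.
- split; last by exists 0 => x; rewrite normr0.
  by move=> i; exact: measurable_cst.
apply: aeW => x i; rewrite mxE; split; first exact: is_derive_cst.
exact: cst_continuous.
Qed.

(** The maximum of the linear forms in [Xi], as a relation that involves no
    default value for the empty list. *)
Lemma cone_exists (Xi : seq V) : Xi != [::] -> exists cone : V -> R,
  (forall xi y, xi \in Xi -> dot xi y <= cone y) /\
  (forall y, exists2 xi, xi \in Xi & cone y = dot xi y).
Proof.
move=> Xi0.
have /choice[c cP] : forall y, exists m, (forall xi, xi \in Xi -> dot xi y <= m) /\
    exists2 xi, xi \in Xi & m = dot xi y.
  move=> y; elim: Xi Xi0 => // a [|b s] IH _.
    exists (dot a y); split; last by exists a; rewrite ?mem_head.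
    by move=> xi; rewrite inE => /eqP ->.
  have [//|m [h1 [xi xis h2]]] := IH.
  have [h|h] := leP (dot a y) m.
    exists m; split; last by exists xi; rewrite // inE xis orbT.
    by move=> z; rewrite inE => /orP[/eqP ->//|/h1].
  exists (dot a y); split; last by exists a; rewrite ?mem_head.
  by move=> z; rewrite inE => /orP[/eqP ->//|/h1 /le_trans]; apply; exact: ltW.
by exists c; split => [xi y|y]; have [h1 h2] := cP y; [exact: h1|exact: h2].
Qed.

Lemma cone_lipschitz (Xi : seq V) (cone : V -> R) (B : R) :
  (forall xi, xi \in Xi -> `|xi| <= B) ->
  (forall xi y, xi \in Xi -> dot xi y <= cone y) ->
  (forall y, exists2 xi, xi \in Xi & cone y = dot xi y) ->
  forall y z, `|cone y - cone z| <= n%:R * B * `|y - z|.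
Proof.
move=> XiB cone_ge coneE y z.
have half a b : cone a - cone b <= n%:R * B * `|a - b|.
  have [xi xiX ->] := coneE a; have := cone_ge _ b xiX.
  have := ler_norm (dot xi (a - b)); have := le_norm_dot xi (a - b); rewrite dotBr.
  have : n%:R * `|xi| * `|a - b| <= n%:R * B * `|a - b|.
    by apply: ler_wpM2r => //; apply: ler_wpM2l => //; exact: XiB.
  lra.
rewrite ler_norml half andbT lerNl opprB.
by rewrite (distrC y z); exact: half.
Qed.

Section cap.
Context (h : V -> R) (x0 : V) (r d L eps : R).
Hypothesis r0 : 0 < r.
Hypothesis d0 : 0 < d.
Hypothesis L0 : 0 < L.
Hypothesis h_top : h x0 = 0.
Hypothesis h_le : forall x, cube x0 r x -> h x <= - (d / 2) * `|x - x0|.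
Hypothesis hL : forall x y, cube x0 r x -> cube x0 r y -> `|h x - h y| <= L * `|x - y|.
Hypothesis eps_ge : d * r / 8 < eps.
Hypothesis eps_le : eps < d * r / 4.

Let eps0 : 0 < eps. Proof. by apply: lt_trans eps_ge; rewrite !mulr_gt0// invr_gt0. Qed.

(** The bounds on [eps] make this neighbourhood of [x0] contain a cube, and keep
    it away from the boundary of the cube where [h] is controlled. *)
Definition cap : set V := [set x | cube x0 r x /\ - eps <= h x].

Definition cap_height x : R := if x \in cap then h x + eps else 0.

Lemma cap_half x : cap x -> `|x - x0| <= r / 2.
Proof.
move=> [cx hx]; have := h_le cx.
move=> h1; rewrite -(ler_pM2l d0); move: h1.
rewrite (_ : d * (r / 2) = d * r / 2); last by ring.
set D := `|x - x0|; rewrite (_ : - (d / 2) * D = - (d * D / 2)); last by ring.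
have := eps_le; move: hx; lra.
Qed.

Lemma cap_ball x : cap x -> ball x0 r x.
Proof.
move=> /cap_half h1; rewrite -ball_normE /= distrC.
by apply: le_lt_trans h1 _; rewrite ltr_pdivrMr// ltr_pMr// ltr1n.
Qed.

Lemma compact_cap : compact cap.
Proof.
apply: subclosed_compact (@compact_cube _ _ x0 r) _; last by move=> x [].
move=> x clx; have cx : cube x0 r x.
  apply: (compact_rV_closed (@compact_cube _ _ x0 r)) => N Nx.
  by have [y [[cy _] Ny]] := clx _ Nx; exists y.
split => //; apply/ler_addgt0Pr => e e0; rewrite -lerBlDr.
have eL : 0 < e / L by rewrite divr_gt0.
have [y [[cy hy] /=]] := clx _ (nbhsx_ballx x _ eL).
rewrite -ball_normE /= => xy; have := hL cx cy.
have : L * `|x - y| <= e by rewrite mulrC -ler_pdivlMr// ltW.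
rewrite ler_norml => h1 /andP[h2 _]; lra.
Qed.

Lemma cap_height_ge0 x : 0 <= cap_height x.
Proof. rewrite /cap_height; case: ifPn => //; rewrite inE => -[_ hx]; lra. Qed.

Lemma cap_height_le x : cap_height x <= eps.
Proof.
rewrite /cap_height; case: ifPn => [|_]; last exact: ltW.
rewrite inE => -[cx _]; have := h_le cx.
have : 0 <= d / 2 * `|x - x0| by rewrite mulr_ge0// divr_ge0// ltW.
rewrite mulNr; lra.
Qed.

(** A point of the cap and a point off the cube are at distance at least [r / 2],
    while the height is at most [d r / 4]. *)
Lemma cap_height_lipschitz x y :
  `|cap_height x - cap_height y| <= (L + d) * `|x - y|.
Proof.
have s_ge z : cube x0 r z -> h z + eps <= cap_height z.
  move=> cz; rewrite /cap_height; case: ifPn => // /negP; rewrite inE => nQ.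
  by rewrite leNgt; apply/negP => h1; apply: nQ; split => //; lra.
have dxy (a b : V) : 0 <= d * `|a - b| by rewrite mulr_ge0// ltW.
have half a b : cap_height a - cap_height b <= (L + d) * `|a - b|.
  rewrite mulrDl; have Lab : 0 <= L * `|a - b| by rewrite mulr_ge0// ltW.
  have [Qa|nQa] := pselect (cap a); last first.
    have -> : cap_height a = 0 by rewrite /cap_height memNset.
    have := cap_height_ge0 b; have := dxy a b; lra.
  have [cb|ncb] := pselect (cube x0 r b).
    have := s_ge _ cb; have -> : cap_height a = h a + eps by rewrite /cap_height mem_set.
    have := hL Qa.1 cb; rewrite ler_norml => /andP[_].
    have := dxy a b; lra.
  have : r / 2 <= `|a - b|.
    move/negP: ncb; rewrite -ltNge => rb; have := cap_half Qa.
    have : `|b - x0| <= `|a - b| + `|a - x0|.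
      by rewrite (distrC a b) -(subrKA a); exact: ler_normD.
    lra.
  rewrite -(ler_pM2l d0); have := cap_height_ge0 b; have := cap_height_le a.
  have : d * (r / 2) = d * r / 2 by ring.
  by have := eps_le; have := eps0; move=> + + ->; lra.
rewrite ler_norml half andbT lerNl opprB (distrC x y); exact: half.
Qed.

Lemma cube_sub_cap : cube x0 (d / 8 / (L + d) * r) `<=` cap.
Proof.
have Ld : 0 < L + d by rewrite addr_gt0.
set rho := d / 8 / (L + d).
have rat : rho * L + rho * d = d / 8 by rewrite -mulrDr /rho mulfVK// gt_eqF.
have rho0 : 0 <= rho by rewrite !divr_ge0// ltW.
have rhoL : 0 <= rho * L by rewrite mulr_ge0// ltW.
have rho_le : rho * L <= d / 8 by rewrite -rat lerDl mulr_ge0// ltW.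
have rho1 : rho <= 1.
  rewrite -(ler_pM2r d0) mul1r; apply: le_trans (_ : d / 8 <= _); last by lra.
  by rewrite -rat lerDr.
move=> x cx; have cx' : cube x0 r x.
  by apply: le_trans cx _; rewrite ler_piMl// ltW.
split => //; have cx0 : cube x0 r x0 by rewrite /cube /= subrr normr0 ltW.
have := hL cx' cx0; rewrite h_top.
have : L * `|x - x0| <= d * r / 8.
  apply: le_trans (_ : L * (rho * r) <= _); first by rewrite ler_wpM2l// ltW.
  rewrite mulrA (mulrC L) (_ : d * r / 8 = d / 8 * r); last by ring.
  by rewrite ler_wpM2r// ltW.
by rewrite subr0 ler_norml => h1 /andP[h2 _]; have := eps_ge; lra.
Qed.

End cap.

Section construction.
Context (W : set V) (u : V -> R) (x0 : V) (Xi : seq V) (d B M0 : R).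
Hypothesis oW : open W.
Hypothesis C1u : class_C 1 W u.
Hypothesis Wx0 : W x0.
Hypothesis d0 : 0 < d.
Hypothesis XiB : forall xi, xi \in Xi -> `|xi| <= B.
Hypothesis spanX : spans Xi (gradient u x0) d.
Hypothesis gM0 : `|gradient u x0| <= M0.
Hypothesis n0 : (0 < n)%N.

Let M00 : 0 <= M0. Proof. exact: le_trans gM0. Qed.

(** The ratio [(d/8) / (L + d)], where [L], the sum of the other two terms,
    bounds the Lipschitz constant of [u] minus a cone: it does not depend on the
    apex, which is what the exhaustion requires. *)
Definition pyramid_ratio (d B M0 : R) : R := d / 8 / (d / 2 + n%:R * (B + M0) + d).

(** Let [h] be the difference between [u - u x0] and the cone [max_(xi in Xi)
    <xi, . - x0>]. As [Xi] surrounds the gradient of [u] at [x0], the cone grows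
    faster than [u] in all directions, and [h x <= - (d/2) |x - x0|] near [x0].
    Hence [h >= - eps] defines a small compact set [Q] around [x0]; subtracting
    [s = h + eps] from [u] on [Q] replaces [u] by a translated cone, whose
    gradient takes its values in [Xi], and this matches [u] on the boundary of
    [Q], where [s] vanishes. The height [eps] is chosen so that this boundary is
    negligible. *)
Lemma pyramid_exists : exists2 r0, 0 < r0 & forall r, 0 < r < r0 ->
  exists (Q : set V) (s : V -> R) (g : V -> V),
  [/\ lipschitz_grad Q s g, Q `<=` cube x0 r, cube x0 (pyramid_ratio d B M0 * r) `<=` Q,
      forall x, `|s x| <= 1 /\ `|g x| <= M0 + B + 1 &
      \forall x \ae mu, Q x -> (gradient u x - g x) \in Xi].
Proof.
have [cu du cdu] := class_C1P C1u.
(* the gradient at [x0] is named without unfolding its coordinates *)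
have [xi0 [xi0E spanX' gM0']] : exists xi0, [/\ xi0 = gradient u x0, spans Xi xi0 d &
  `|xi0| <= M0] by exists (gradient u x0).
have [xi1 xi1X] : exists xi, xi \in Xi.
  have /spanX'[xi xiX _] : (const_mx 1 : V) != 0; last by exists xi.
  by apply/eqP => /rowP/(_ (Ordinal n0)); rewrite !mxE => /eqP; rewrite oner_eq0.
have Xi0 : Xi != [::] by apply/eqP => Xie; rewrite Xie in xi1X.
have B0 : 0 <= B by exact: le_trans (XiB xi1X).
have [cone [cone_ge coneE]] := cone_exists Xi0.
have coneL := cone_lipschitz XiB cone_ge coneE.
pose eta := Num.min 1 (d / 2 / n.+1%:R).
have eta0 : 0 < eta by rewrite lt_min ltr01 !divr_gt0.
have [r1 r10 r1P] : exists2 r1, 0 < r1 & forall x, cube x0 r1 x -> W x /\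
    forall i, `|partial i u x - xi0 ord0 i| <= eta.
  have : nbhs x0 [set x | W x /\ forall i : 'I_n, `|partial i u x - xi0 ord0 i| <= eta].
    have := gradient_near oW C1u Wx0 eta0; apply: filterS => x [Wx gx]; split => // i.
    by apply: le_trans gx; have := le_coord_norm (gradient u x - xi0) i; rewrite -xi0E !mxE.
  move=> /nbhs_ballP[e /= e0 eP]; exists (e / 2); first by rewrite divr_gt0.
  move=> x xe; apply: eP; rewrite -ball_normE /= distrC.
  by apply: le_lt_trans xe _; rewrite ltr_pdivrMr// ltr_pMr// ltr1n.
exists (Num.min r1 d^-1); first by rewrite lt_min r10 invr_gt0.
move=> r /andP[r0]; rewrite lt_min => /andP[rr1 rd].
have subr1 x : cube x0 r x -> cube x0 r1 x by move=> h; apply: le_trans h _; exact: ltW.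
have rW x : cube x0 r x -> W x by move=> /subr1 /r1P[].
have dv v x i c : W x ->
    is_derive x (e_ i) (fun y => u y - dot v y + c) (partial i u x - v ord0 i).
  move=> Wx; have /is_deriveP H : is_derive x (e_ i) (fun y => u y - dot v y)
      (partial i u x - v ord0 i).
    apply: is_deriveB; first exact: du.
    apply/is_deriveP => e e0; exists 1 => // h _.
    rewrite dotDr dotZr dot_deltar (addrC (dot v x)) addrK subrr normr0.
    by rewrite mulr_ge0// ltW.
  apply/is_deriveP => e /H[dd dd0 HH]; exists dd => // h /HH h1.
  by apply: le_trans h1; rewrite le_eqVlt; apply/orP; left; apply/eqP; congr `|_|; rewrite /=; ring.
(* Lipschitz with a small constant on the cube, its gradient vanishing at [x0] *)
pose T x := u x - dot xi0 x + 0.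
have dT x i : W x -> is_derive x (e_ i) T (partial i u x - xi0 ord0 i) by exact: dv.
have TL x y : cube x0 r x -> cube x0 r y -> `|T x - T y| <= d / 2 * `|x - y|.
  move=> cx cy; apply: le_trans (_ : n%:R * eta * `|x - y| <= _).
    apply: (@cube_lipschitz _ _ T x0 r eta) => //; first exact: ltW.
    move=> z cz i; have Wz := rW _ cz; have dz := dT z i Wz; split.
      exact: (@ex_derive _ _ _ _ _ _ _ dz).
    rewrite [partial _ _ _](@derive_val _ _ _ _ _ _ _ dz).
    by have [_] := r1P _ (subr1 _ cz).
  apply: ler_wpM2r => //; apply: le_trans (_ : n.+1%:R * eta <= _).
    by apply: ler_wpM2r; [exact: ltW|rewrite ler_nat].
  by rewrite mulrC -ler_pdivlMr// ge_min lexx orbT.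
pose h x := u x - u x0 - cone (x - x0).
have cone0 : cone 0 = 0.
  by have [xi _ ->] := coneE 0; rewrite -(scale0r 0) dotZr mul0r.
have h_le x : cube x0 r x -> h x <= - (d / 2) * `|x - x0|.
  move=> cx; have [->|xx0] := eqVneq x x0.
    by rewrite /h !subrr cone0 subrr normr0 mulr0.
  have [|xi xiX] := spanX' (x - x0); first by rewrite subr_eq0.
  have := cone_ge _ (x - x0) xiX.
  have cx0 : cube x0 r x0 by rewrite /cube /= subrr normr0 ltW.
  have := ler_norm (T x - T x0); have := TL _ _ cx cx0.
  rewrite /h /T dotBl !dotBr; lra.
have hE x : h x = T x - T x0 + dot xi0 (x - x0) - cone (x - x0).
  by rewrite /h /T dotBr; ring.
pose L := d / 2 + n%:R * (B + M0).
have nBM : 0 <= n%:R * (B + M0) by rewrite mulr_ge0// addr_ge0.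
have L0 : 0 < L by rewrite /L ltr_pwDl// divr_gt0.
have hL x y : cube x0 r x -> cube x0 r y -> `|h x - h y| <= L * `|x - y|.
  move=> cx cy.
  have -> : h x - h y = (T x - T y) + dot xi0 (x - y) - (cone (x - x0) - cone (y - x0)).
    by rewrite !hE !dotBr; ring.
  apply: le_trans (ler_normB _ _) _; rewrite /L mulrDl mulrDr mulrDl addrA.
  rewrite addrAC; apply: lerD.
    apply: le_trans (ler_normD _ _) _; apply: lerD; first exact: TL.
    apply: le_trans (le_norm_dot _ _) _; apply: ler_wpM2r => //.
    exact: ler_wpM2l.
  apply: le_trans (coneL _ _) _; rewrite (_ : x - x0 - (y - x0) = x - y)//.
  by rewrite opprB addrA subrK.
pose Bl : set V := ball x0 r.
have ch : {in Bl, continuous h}.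
  move=> x; rewrite inE => bx; rewrite /continuous_at.
  have cx : cube x0 r x by rewrite /cube /= distrC; move: bx; rewrite /Bl -ball_normE /= => /ltW.
  have cc : {for x, continuous (fun z => cone (z - x0))}.
    apply: (@continuous_comp _ _ _ (fun z => z - x0) cone).
      by apply: continuousB; [exact: cvg_id|exact: cst_continuous].
    exact: (lip_continuous coneL).
  have cux : {for x, continuous u} := cu x (mem_set (rW x cx)).
  have cuc : {for x, continuous (fun=> u x0)} by exact: cst_continuous.
  exact: (continuousB (continuousB cux cuc) cc).
(* almost every level of [h] is negligible: choose the height accordingly *)
pose h' := h \_ Bl.
have oB : open Bl by exact: ball_open.
have mB : measurable Bl by exact: open_rV_measurable.
have mh' : measurable_fun setT h'.
  by have := open_continuous_measurable_rV oB ch; rewrite measurable_restrictT.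
have [|t /andP[t1 t2] ht] := @leb_level_set0 _ _ h' (- (d * r / 4)) (- (d * r / 8)) mh'.
  by rewrite ltrN2; have := mulr_gt0 d0 r0; lra.
pose eps := - t; have [e1 e2] : d * r / 8 < eps /\ eps < d * r / 4.
  by rewrite /eps; split; lra.
have eps0 : 0 < eps by apply: lt_trans e1; rewrite !mulr_gt0// invr_gt0.
have dr1 : d * r <= 1.
  by rewrite mulrC -ler_pdivlMr// div1r ltW.
have eps1 : eps <= 1 by lra.
have h_top : h x0 = 0 by rewrite /h !subrr cone0 subrr.
pose Q := cap h x0 r eps; pose s := cap_height h x0 r eps.
have Qball x : Q x -> Bl x by exact: (cap_ball r0 d0 h_le e2).
have cQ : compact Q by exact: (compact_cap L0 hL).
have s_le x : s x <= eps by exact: (cap_height_le r0 d0 h_le e1).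
(* where the maximum is attained at [xi] only: off these sets two of the linear
   forms coincide, that is, on finitely many hyperplanes *)
pose O xi : set V := [set x | forall z, z \in Xi -> z != xi -> dot z (x - x0) < dot xi (x - x0)].
pose G xi : set V := Bl `&` [set x | - eps < h x] `&` O xi.
have GQ xi x : G xi x -> Q x.
  move=> [[bx hx] _]; split; last exact: ltW.
  by move: bx; rewrite /Bl -ball_normE /cube /= distrC => /ltW.
have oG xi : open (G xi).
  apply: openI.
    rewrite openE => x [bx hx]; apply: filterI; first exact: open_nbhs_nbhs.
    by apply: (ch x (mem_set bx) [set z | - eps < z]); exact: lt_nbhsr.
  apply: open_forall_seq => z _.
  apply: (@open_imply _ [set x | dot z (x - x0) < dot xi (x - x0)]).
  rewrite (_ : mkset _ = (fun x => dot (xi - z) x) @^-1`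
      [set w | dot (xi - z) x0 < w]); last first.
    by apply/seteqP; split => x /=; rewrite !dotBl !dotBr; lra.
  by apply: open_comp; [move=> y _; exact: continuous_dot|exact: open_gt].
have oneG xi xi' x : xi \in Xi -> xi' \in Xi -> xi' != xi -> G xi x -> ~ G xi' x.
  move=> h1 h2 h3 [_ O1] [_ O2]; have := O1 _ h2 h3.
  by rewrite ltNge (ltW (O2 _ h1 _))// eq_sym.
pose g x : V := \sum_(xi <- undup Xi) (if x \in G xi then gradient u x - xi else 0).
have gG xi x : xi \in Xi -> G xi x -> g x = gradient u x - xi.
  move=> xiX Gx; rewrite /g (bigD1_seq xi) ?mem_undup ?undup_uniq//= mem_set//.
  rewrite big1_seq ?addr0// => z /andP[zxi]; rewrite mem_undup => zX.
  by rewrite memNset//; exact: oneG Gx.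
have g0 x : (forall xi, xi \in Xi -> ~ G xi x) -> g x = 0.
  move=> H; rewrite /g big1_seq// => xi /andP[_]; rewrite mem_undup => xiX.
  by rewrite memNset//; exact: H.
have gP x : (exists2 xi, xi \in Xi & G xi x) \/ g x = 0.
  have [|H] := pselect (exists2 xi, xi \in Xi & G xi x); first by left.
  by right; apply: g0 => xi xiX Gx; apply: H; exists xi.
have nQ x : ~ Q x -> s x = 0 /\ g x = 0.
  move=> Qx; split; first by rewrite /s /cap_height memNset.
  by apply: g0 => xi _ /GQ.
have gle x : `|g x| <= M0 + B + 1.
  have [[xi xiX Gx]|->] := gP x; last by rewrite normr0 !addr_ge0.
  rewrite (gG _ _ xiX Gx) -(subrKA xi0); apply: le_trans (ler_normD _ _) _.
  rewrite addrC; apply: lerD.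
    by apply: le_trans (ler_normB _ _) _; apply: lerD => //; exact: XiB.
  apply/normrV_leP => // i; rewrite !mxE.
  have [_ /(_ i) h1] := r1P _ (subr1 _ (GQ _ _ Gx).1).
  by apply: le_trans h1 _; rewrite ge_min lexx.
have mg i : measurable_fun setT (coor i \o g).
  rewrite (_ : _ \o _ = fun x => \sum_(xi <- undup Xi)
      ((fun y => partial i u y - xi ord0 i) \_ (G xi)) x); last first.
    apply/funext => x; rewrite /= /coor /g summxE; apply: eq_bigr => xi _.
    by rewrite patchE; case: ifP => _; rewrite ?mxE.
  apply: measurable_sum => xi; have mG : measurable (G xi) by exact: open_rV_measurable.
  have : measurable_fun (G xi) (fun y => partial i u y - xi ord0 i).
    apply: open_continuous_measurable_rV => // x; rewrite inE => /GQ[cx _].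
    have c1 : {for x, continuous (partial i u)} := cdu i x (mem_set (rW x cx)).
    have c2 : {for x, continuous (fun=> xi ord0 i)} by exact: cst_continuous.
    exact: (continuousB c1 c2).
  by rewrite measurable_restrictT.
have sG xi x : xi \in Xi -> G xi x -> s x = u x - dot xi x + (dot xi x0 - u x0 + eps).
  move=> xiX Gx; rewrite /s /cap_height mem_set; last exact: GQ Gx.
  have -> : h x = u x - u x0 - dot xi (x - x0).
    rewrite /h; congr (_ - _).
    have [z zX zE] := coneE (x - x0); rewrite zE.
    have [->//|zxi] := eqVneq z xi; have := Gx.2 _ zX zxi.
    by rewrite -zE ltNge cone_ge.
  by rewrite dotBr; ring.
have aeG : \forall x \ae mu, Q x -> exists2 xi, xi \in Xi & G xi x.
  have ae1 : \forall x \ae mu, h' x <> t.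
    apply: ae_null => //; have := mh' measurableT [set t] (measurable_set1 t).
    by rewrite setTI.
  have ae2 : \forall x \ae mu, forall a, a \in Xi -> forall b, b \in Xi -> a != b ->
      dot (a - b) x <> dot (a - b) x0.
    apply: filter_forall_seq => a _; apply: filter_forall_seq => b _.
    have [->|ab] := eqVneq a b; first exact: aeW.
    have ab0 : a - b != 0 by rewrite subr_eq0.
    have : \forall x \ae mu, ~ [set y | dot (a - b) y = dot (a - b) x0] x.
      apply: ae_null (leb_hyperplane0 _ ab0).
      have mdot : measurable_fun setT (dot (a - b)).
        by apply: continuous_rV_measurable; exact: continuous_dot.
      have := mdot measurableT [set dot (a - b) x0] (measurable_set1 _).
      by rewrite setTI.
    by apply: filterS.
  apply: filterS2 ae1 ae2 => x n1 n2 Qx.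
  have [xi xiX xiE] := coneE (x - x0); exists xi => //; split.
    split; first exact: Qball.
    have := Qx.2; rewrite /= le_eqVlt => /predU1P[h1|//].
    by case: n1; rewrite /h' patchE (mem_set (Qball _ Qx)) -h1 opprK.
  move=> z zX zxi; rewrite lt_neqAle -xiE cone_ge// andbT xiE; apply/eqP => h1.
  by apply: (n2 _ zX _ xiX zxi); rewrite !dotBl; move: h1; rewrite !dotBr; lra.
exists Q, s, g; split.
- split => //.
  + exists (L + d); first by rewrite addr_ge0// ltW.
    exact: (cap_height_lipschitz r0 d0 L0 h_le hL e1 e2).
  + by split => //; exists (M0 + B + 1).
  apply: filterS aeG => x H i.
  have [Qx|nQx] := pselect (Q x).
    have [xi xiX Gx] := H Qx; have Gnear : nbhs x (G xi) by exact: open_nbhs_nbhs.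
    have Wx := rW _ Qx.1; split.
      rewrite (gG _ _ xiX Gx) 2!mxE [in X in _ + X]mxE.
      apply: near_eq_is_derive (dv xi x i (dot xi x0 - u x0 + eps) Wx).
      by apply: filterS Gnear => y /(sG _ _ xiX).
    have c1 : {for x, continuous (partial i u)} := cdu i x (mem_set Wx).
    have c2 : {for x, continuous (fun=> xi ord0 i)} by exact: cst_continuous.
    have := continuousB c1 c2.
    apply: near_continuous; apply: filterS Gnear => y Gy.
    by rewrite /= /coor (gG _ _ xiX Gy) !mxE.
  have Nnear : nbhs x (~` Q).
    by apply: open_nbhs_nbhs; split => //; apply: closed_openC; exact: compact_rV_closed.
  split.
    rewrite (nQ x nQx).2 mxE; apply: (is_derive_away0 _ (compact_rV_closed cQ) nQx).
    by move=> y /nQ[].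
  apply: (@near_continuous (fun=> 0)); last exact: cst_continuous.
  by apply: filterS Nnear => y /nQ[_ gy]; rewrite /= /coor gy mxE.
- by move=> x [].
- exact: (cube_sub_cap r0 d0 L0 h_top hL e1).
- move=> x; split => //; rewrite ger0_norm; first exact: le_trans (s_le x) eps1.
  exact: cap_height_ge0.
apply: filterS aeG => x H Qx; have [xi xiX Gx] := H Qx.
by rewrite (gG _ _ xiX Gx) opprB addrC subrK.
Qed.

End construction.

End pyramid.

(** * Superposition of corrections with disjoint carriers *)

Section gluing.
Context {R : realType} {n : nat}.
Local Notation V := 'rV[R]_n.
Local Notation e_ i := (delta_mx ord0 i : V).
Local Notation mu := (@leb R n).
Context (Omega : set V) (oO : open Omega) (Ooo : (mu Omega < +oo)%E).
Let mO : measurable Omega. Proof. exact: open_rV_measurable. Qed.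

Lemma eventually_constant_measurable (h_ : nat -> V -> R) (h : V -> R) :
  (forall k, measurable_fun setT (h_ k)) ->
  (forall x, exists N, forall k, (N <= k)%N -> h_ k x = h x) ->
  measurable_fun setT h.
Proof.
move=> mh hh; apply: (measurable_fun_cvg mh) => x _; have [N HN] := hh x.
by apply: cvg_near_cst; exists N => // k /= /HN ->.
Qed.

Lemma eventually_constant_L1 (h_ : nat -> V -> R) (h : V -> R) (M : R) :
  (forall k, measurable_fun setT (h_ k)) ->
  (forall k x, `|h_ k x| <= M) -> (forall k x, ~ Omega x -> h_ k x = 0) ->
  (forall x, exists N, forall k, (N <= k)%N -> h_ k x = h x) ->
  forall e : R, 0 < e -> exists N, forall k, (N <= k)%N ->
    (\int[mu]_(x in Omega) `|(h x - h_ k x)%:E| < e%:E)%E.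
Proof.
move=> mh hM h0 hh e e0; have mh' := eventually_constant_measurable mh hh.
have M0 : 0 <= M by exact: le_trans (hM 0%N 0).
have [|||_ H _] := @Rdominated_convergence _ _ R mu h_ h (fun x => M * \1_Omega x) mh mh'.
- exact: integrable_cst_indic.
- move=> k x; rewrite indicE; have [Ox|nOx] := pselect (Omega x).
    by rewrite mem_set// mulr1.
  by rewrite h0// normr0 memNset// mulr0.
- apply: aeW => x; have [N HN] := hh x.
  by apply: cvg_near_cst; exists N => // k /= /HN ->.
have [N HN] := cvge0_lt H e0; exists N => k Nk; apply: le_lt_trans (HN k Nk).
have mhk : measurable_fun setT (fun x => (h_ k x - h x)%R) by apply: measurable_funB.
have -> : (\int[mu]_(x in Omega) `|(h x - h_ k x)%:E| =
    \int[mu]_(x in Omega) `|(h_ k x - h x)%:E|)%E.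
  by apply: eq_integral => x _; rewrite !abse_EFin distrC.
apply: ge0_subset_integral => //.
by apply: measurableT_comp => //; exact/measurable_EFinP.
Qed.


Section series.
Context (Q_ : nat -> set V) (s_ : nat -> V -> R) (g_ : nat -> V -> V) (M : R).
Hypothesis QO : forall j, Q_ j `<=` Omega.
Hypothesis tQ : trivIset setT Q_.
Hypothesis sg : forall j, lipschitz_grad (Q_ j) (s_ j) (g_ j).
Hypothesis sgM : forall j x, `|s_ j x| <= M /\ `|g_ j x| <= M.

(** The partial sums are Lipschitz with compact carrier in [Omega], hence belong
    to W_0^{1,1}. They are bounded together with their gradients and are
    eventually constant at each point, so they converge in W^{1,1}. *)
Lemma lipschitz_grad_series : exists s g, [/\ W11_grad Omega s g, in_W11_0 Omega s g,
  measurable_fun setT s /\ (forall i, measurable_fun setT (coor i \o g)),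
  forall x, `|s x| <= M /\ `|g x| <= M &
  (forall j x, Q_ j x -> g x = g_ j x) /\
  (forall x, (forall j, ~ Q_ j x) -> g x = 0)].
Proof.
have M0 : 0 <= M by exact: le_trans (sgM 0%N 0).1.
have /choice[idx idxP] : forall x, exists j, forall j', Q_ j' x -> Q_ j x.
  move=> x; have [[j Qj]|H] := pselect (exists j, Q_ j x); first by exists j.
  by exists 0%N => j Qj; case: H; exists j.
have idxE j x : Q_ j x -> idx x = j.
  by move=> Qj; apply: (tQ (i := idx x) (j := j)) => //; exists x; split => //; exact: idxP Qj.
have s0 j x : ~ Q_ j x -> s_ j x = 0 /\ g_ j x = 0 by have [_ H _ _ _] := sg j; exact: H.
pose s x := s_ (idx x) x; pose g x := g_ (idx x) x.
pose S N x := \sum_(j < N) s_ j x; pose G N x := \sum_(j < N) g_ j x.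
(* at each point, at most one term of these sums is nonzero *)
have SE N x : S N x = if (idx x < N)%N then s x else 0.
  rewrite /S (eq_bigr (fun j : 'I_N => if j == idx x :> nat then s x else 0)).
    by rewrite -big_mkcond; exact: (big_ord1_eq +%R (fun=> _)). 
  move=> j _; case: eqP => [->//|jx]; apply: (s0 j x _).1.
  by move=> /idxE; exact/nesym.
have GE N x : G N x = if (idx x < N)%N then g x else 0.
  rewrite /G (eq_bigr (fun j : 'I_N => if j == idx x :> nat then g x else 0)).
    by rewrite -big_mkcond; exact: (big_ord1_eq +%R (fun=> _)). 
  move=> j _; case: eqP => [->//|jx]; apply: (s0 j x _).2.
  by move=> /idxE; exact/nesym.
have SG N : exists2 K, K `<=` Omega & lipschitz_grad K (S N) (G N).
  elim: N => [|N [K KO H]].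
    exists set0; first by [].
    have -> : S 0%N = fun=> 0 by apply/funext => x; rewrite /S big_ord0.
    have -> : G 0%N = fun=> 0 by apply/funext => x; rewrite /G big_ord0.
    exact: lipschitz_grad0.
  exists (K `|` Q_ N); first by move=> x [/KO//|/QO].
  have -> : S N.+1 = fun x => S N x + s_ N x by apply/funext => x; rewrite /S big_ord_recr.
  have -> : G N.+1 = fun x => G N x + g_ N x by apply/funext => x; rewrite /G big_ord_recr.
  exact: lipschitz_gradD.
have SGO N x : ~ Omega x -> S N x = 0 /\ G N x = 0.
  by have [K KO [_ H _ _ _]] := SG N => Ox; apply: H => /KO.
have sM x : `|s x| <= M /\ `|g x| <= M by exact: sgM.
have SM N x : `|S N x| <= M.
  by rewrite SE; case: ifP => _; rewrite ?normr0//; case: (sM x).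
have GM N x i : `|coor i (G N x)| <= M.
  rewrite GE; case: ifP => _; last by rewrite /coor mxE normr0.
  by apply: le_trans (sM x).2; exact: le_coord_norm.
have mS N : measurable_fun setT (S N).
  have [K _ [_ _ [L L0 HL] _ _]] := SG N.
  by apply: continuous_rV_measurable; exact: lip_continuous HL.
have mG N i : measurable_fun setT (coor i \o G N) by have [K _ [_ _ _ [H _] _]] := SG N.
have Ss x : exists N, forall k, (N <= k)%N -> S k x = s x.
  by exists (idx x).+1 => k xk; rewrite SE xk.
have Gg i x : exists N, forall k, (N <= k)%N -> (coor i \o G k) x = (coor i \o g) x.
  by exists (idx x).+1 => k xk; rewrite /= GE xk.
have ms : measurable_fun setT s := eventually_constant_measurable mS Ss.
have mg i : measurable_fun setT (coor i \o g) := eventually_constant_measurable (mG ^~ i) (Gg i).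
have lim e : 0 < e -> exists N, (W11_dist Omega s g (S N) (G N) < e%:E)%E.
  move=> e0; pose d := e / n.+2%:R; have d0 : 0 < d by rewrite divr_gt0.
  have [N1 H1] := eventually_constant_L1 mS SM (fun k x h => (SGO k x h).1) Ss d0.
  have /choice[N2 H2] : forall i : 'I_n, exists N, forall k, (N <= k)%N ->
      (\int[mu]_(x in Omega) `|(coor i (g x) - coor i (G k x))%:E| < d%:E)%E.
    move=> i; apply: (eventually_constant_L1 (mG ^~ i) (fun k x => GM k x i) _ (Gg i) d0).
    by move=> k x Ox; rewrite /= (SGO k x Ox).2 /coor mxE.
  pose N := maxn N1 (\max_i N2 i); exists N.
  apply: le_lt_trans (_ : (d%:E + \sum_(i < n) d%:E < _)%E).
    rewrite /W11_dist; apply: leeD; first by apply: ltW; apply: H1; exact: leq_maxl.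
    apply: lee_sum => i _; apply: ltW; apply: H2.
    by apply: leq_trans (leq_maxr _ _); exact: leq_bigmax.
  rewrite sumEFin -EFinD lte_fin sumr_const card_ord -mulrS.
  rewrite -mulr_natl /d mulrCA gtr_pMr// ltr_pdivrMr// mul1r ltr_nat//.
have is_ : mu.-integrable Omega (EFin \o s).
  apply: measurable_bounded_integrable => //; first exact: measurable_funTS.
  by apply: (@bounded_onW _ _ _ _ M) => x _; case: (sM x).
have ig i : mu.-integrable Omega (EFin \o (coor i \o g)).
  apply: measurable_bounded_integrable => //; first exact: measurable_funTS.
  apply: (@bounded_onW _ _ _ _ M) => x _; apply: le_trans (sM x).2.
  exact: le_coord_norm.
have W N : W11_grad Omega (S N) (G N) /\ in_W11_0 Omega (S N) (G N).
  have [K KO H] := SG N.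
  by split; [exact: (lipschitz_grad_W11 oO H)|exact: (lipschitz_grad_W11_0 oO KO H)].
have Wsg : W11_grad Omega s g.
  by apply: (W11_grad_limit oO) => // e /lim[N HN]; exists (S N), (G N); split => //; case: (W N).
exists s, g; split => //.
- apply: in_W11_0_limit => // e /lim[N HN]; exists (S N), (G N).
  by have [h1 h2] := W N.
- split => [j x Qj|x H]; first by rewrite /g (idxE _ _ Qj).
  by rewrite /g (s0 _ _ (H _)).2.
Qed.

End series.

End gluing.

(** * Pushing a gradient into a prescribed set *)

Section perturbation.
Context {R : realType} {n : nat}.
Local Notation V := 'rV[R]_n.
Local Notation mu := (@leb R n).
Context (Omega W : set V) (u : V -> R) (P : set V) (B M0 : R).
Hypothesis oO : open Omega.
Hypothesis Ooo : (mu Omega < +oo)%E.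
Hypothesis oW : open W.
Hypothesis WO : W `<=` Omega.
Hypothesis C1u : class_C 1 W u.
Hypothesis n0 : (0 < n)%N.
Hypothesis PB : forall xi, P xi -> `|xi| <= B.

(** The points around which [pyramid_exists] provides pyramids occupying a
    proportion of the cubes that depends on [d] only. *)
Definition pushable (d : R) : set V := [set x | W x /\ `|gradient u x| < M0 /\
  exists Xi d', d < d' /\ (forall xi, xi \in Xi -> P xi) /\ spans Xi (gradient u x) d'].

(** The gradient is continuous on [W], and being surrounded by a finite set with
    some margin is an open condition. *)
Lemma open_pushable (d : R) : open (pushable d).
Proof.
rewrite openE => x [Wx [gx [Xi [d' [dd' [XiP sX]]]]]].
pose eta := Num.min ((M0 - `|gradient u x|) / 2) ((d' - d) / 2 / n%:R).
have n0' : 0 < n%:R :> R by rewrite ltr0n.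
have eta0 : 0 < eta by rewrite lt_min !divr_gt0// subr_gt0.
have e1 : eta <= (M0 - `|gradient u x|) / 2 by rewrite ge_min lexx.
have e2 : n%:R * eta <= (d' - d) / 2.
  by rewrite mulrC -ler_pdivlMr// ge_min lexx orbT.
have := gradient_near oW C1u Wx eta0; apply: filterS => y [Wy gy].
split => //; split.
  have : `|gradient u y| <= `|gradient u y - gradient u x| + `|gradient u x|.
    by rewrite -{1}(subrK (gradient u x) (gradient u y)); exact: ler_normD.
  lra.
exists Xi, ((d + d') / 2); split; first lra; split => // v v0.
have [xi xiX xiP] := sX _ v0; exists xi => //.
have : n%:R * `|gradient u y - gradient u x| * `|v| <= (d' - d) / 2 * `|v|.
  by apply: ler_wpM2r => //; apply: le_trans e2; exact: ler_wpM2l.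
have := ler_norm (dot (gradient u y - gradient u x) v).
have := le_norm_dot (gradient u y - gradient u x) v.
move: xiP; rewrite !dotBl.
have -> : (d + d') / 2 * `|v| = d' * `|v| - (d' - d) / 2 * `|v| by field.
lra.
Qed.

Let U := \bigcup_k pushable (k.+1%:R^-1).

(** Pyramids form a family of compact sets to which [exhaustion_cover] applies;
    the corrections that they carry are added up by [lipschitz_grad_series]. *)
Lemma gradient_push : exists s g, [/\ W11_grad Omega s g, in_W11_0 Omega s g,
  measurable_fun setT s /\ (forall i, measurable_fun setT (coor i \o g)),
  exists M, forall x, `|s x| <= M /\ `|g x| <= M &
  \forall x \ae mu, if x \in U then P (gradient u x - g x) else g x = 0].
Proof.
pose M := `|M0| + `|B| + 1.
pose good Q (sg : (V -> R) * (V -> V)) := [/\ lipschitz_grad Q sg.1 sg.2,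
   forall x, `|sg.1 x| <= M /\ `|sg.2 x| <= M &
   \forall x \ae mu, Q x -> P (gradient u x - sg.2 x)].
pose QQ : set (set V) := [set Q | exists sg, good Q sg].
have QQc Q : QQ Q -> compact Q by move=> [sg [[]]].
have M00 : 0 <= M by rewrite !addr_ge0.
have QQ0 : QQ set0.
  exists (fun=> 0, fun=> 0); split => /=; last exact: aeW.
    exact: lipschitz_grad0.
  by move=> x; rewrite !normr0.
have QQU Q Q' : QQ Q -> QQ Q' -> Q `&` Q' = set0 -> QQ (Q `|` Q').
  move=> [[s g] [/= sg sM sP]] [[s' g'] [/= sg' sM' sP']] QQ'.
  have [_ out _ _ _] := sg; have [_ out' _ _ _] := sg'.
  have in1 x : Q x -> s' x = 0 /\ g' x = 0.
    by move=> Qx; apply: out' => Qx'; have : (Q `&` Q') x by []; rewrite QQ'.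
  have in2 x : Q' x -> s x = 0 /\ g x = 0.
    by move=> Qx; apply: out => Qx'; have : (Q `&` Q') x by []; rewrite QQ'.
  exists (fun x => s x + s' x, fun x => g x + g' x); split => /=.
  - exact: lipschitz_gradD.
  - move=> x; have [Qx|nQ] := pselect (Q x).
      by have [-> ->] := in1 _ Qx; rewrite !addr0.
    by have [-> ->] := out _ nQ; rewrite !add0r.
  apply: filterS2 sP sP' => x h h' [Qx|Qx].
    by rewrite (in1 _ Qx).2 addr0; exact: h.
  by rewrite (in2 _ Qx).2 add0r; exact: h'.
have oU : open U by apply: bigcup_open => k _; exact: open_pushable.
have UO : U `<=` Omega by move=> x [k _ [Wx _]]; exact: WO.
have Uoo : (mu U < +oo)%E.
  by apply: le_lt_trans Ooo; apply: le_measure => //; rewrite inE; exact: open_rV_measurable.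
(* absolute values: nothing is assumed on the signs of [B] and [M0] *)
pose c_ k := pyramid_ratio (n := n) (k.+1%:R^-1) `|B| `|M0| : R.
have k0 (k : nat) : 0 < k.+1%:R^-1 :> R by rewrite invr_gt0.
have c_gt0 k : 0 < c_ k.
  rewrite /c_ /pyramid_ratio; have := k0 k; move: (k.+1%:R^-1) => d d0.
  rewrite divr_gt0//; first by rewrite divr_gt0.
  apply: ltr_wpDl => //; apply: addr_ge0; first by rewrite divr_ge0// ltW.
  by rewrite mulr_ge0// addr_ge0.
have fine k : fine_cover QQ (pushable k.+1%:R^-1) (c_ k).
  move=> x [Wx [gx [Xi [d [dk [XiP sX]]]]]].
  have XiB xi : xi \in Xi -> `|xi| <= `|B|.
    by move=> /XiP/PB h; apply: le_trans h _; exact: ler_norm.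
  have sk : spans Xi (gradient u x) k.+1%:R^-1.
    move=> y y0; have [xi xiX h] := sX _ y0; exists xi => //.
    by apply: le_trans h; apply: ler_wpM2r => //; exact: ltW.
  have gM : `|gradient u x| <= `|M0| by apply: le_trans (ltW gx) _; exact: ler_norm.
  have [r0 r00 H] := pyramid_exists oW C1u Wx (k0 k) XiB sk gM n0.
  exists r0 => // r /H[Q [s [g [h1 h2 h3 h4 h5]]]]; exists Q; split => //.
  exists (s, g); split => //= [y|].
    have [h6 h7] := h4 y; split => //; apply: le_trans h6 _.
    by rewrite lerDr addr_ge0.
  by apply: filterS h5 => y h Qy; apply: XiP; exact: h.
have [Q_ [QQ_ QU tQ QUn]] :=
  @exhaustion_cover _ _ QQ QQc QQ0 QQU U _ c_ oU Uoo (fun k => @open_pushable _) erefl c_gt0 fine.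
have /choice[sg sgP] : forall j, exists sg, good (Q_ j) sg by [].
have [|s [g [h1 h2 h3 h4 [h5 h6]]]] := @lipschitz_grad_series _ _ Omega oO Ooo Q_
  (fun j => (sg j).1) (fun j => (sg j).2) M _ tQ (fun j => let: And3 h _ _ := sgP j in h)
  (fun j => let: And3 _ h _ := sgP j in h).
  by move=> j; exact: subset_trans (QU j) UO.
exists s, g; split => //; first by exists M.
have ae1 : \forall x \ae mu, ~ (U `\` \bigcup_j Q_ j) x.
  apply: ae_null => //; apply: measurableD; first exact: open_rV_measurable.
  by apply: bigcup_measurable => j _; apply: compact_rV_measurable; exact: QQc.
have ae2 : \forall x \ae mu, forall j, Q_ j x -> P (gradient u x - (sg j).2 x).
  by apply: ae_foralln => j; have [] := sgP j.
apply: filterS2 ae1 ae2 => x n1 n2; case: ifPn => [|/negP]; rewrite inE => Ux.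
  have [[j _ Qj]|nQ] := pselect ((\bigcup_j Q_ j) x); last by case: n1.
  by rewrite (h5 _ _ Qj); exact: n2.
by apply: h6 => j /QU.
Qed.

End perturbation.

(** * Existence of a solution *)

Section supremal.
Context {R : realType} {n : nat}.
Local Notation V := 'rV[R]_n.
Local Notation mu := (@leb R n).
Context (Omega : set V) (f : V -> R).
Hypothesis n0 : (0 < n)%N.
Hypothesis oO : open Omega.
Hypothesis Ooo : (mu Omega < +oo)%E.
Hypothesis f_cont : continuous f.
Hypothesis f_coercive : forall c : R, bounded_set [set x | f x <= c].
Local Notation F := (lslc (EFin \o f)).

Lemma le_energy (u : V -> R) : (energy F Omega u <= energy (EFin \o f) Omega u)%E.
Proof.
apply: le_ess_sup; apply: aeW => x; rewrite /patch; case: ifP => // _.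
exact: lslc_le.
Qed.

Lemma energy_leP (G : V -> \bar R) (u : V -> R) (m : \bar R) :
  (energy G Omega u <= m)%E <->
  \forall x \ae mu, Omega x -> (G (grad Omega u x) <= m)%E.
Proof.
split=> [/ess_supP|H]; last apply/ess_supP; last first.
  by apply: filterS H => x H; rewrite /patch; case: ifPn; [rewrite inE|rewrite /= leNye].
by apply: filterS => x; rewrite /patch => H Ox; move: H; rewrite mem_set.
Qed.

Lemma Lpoo_gradient_bounded (u : V -> R) : W1 +oo%E Omega u ->
  exists M : R, \forall x \ae mu, Omega x -> `|grad Omega u x| <= M.
Proof.
move=> [_ [k [wk Lk]]].
have /choice[M MP] : forall i : 'I_n, exists M : R, \forall x \ae mu, Omega x -> `|coor i (k x)| <= M.
  by move=> i; have [_ [M HM]] := Lpoo_bounded oO (Lk i); exists M.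
exists (\sum_i `|M i|).
have ae1 : \forall x \ae mu, forall i, Omega x -> `|coor i (k x)| <= M i by exact: filter_forall.
apply: filterS2 ae1 (grad_ae oO wk) => x h1 h2 Ox; rewrite (h2 Ox).
apply/normrV_leP => [|i]; first exact: sumr_ge0.
apply: le_trans (h1 i Ox) _; rewrite (bigD1 i)//=.
by apply: le_trans (ler_norm _) _; rewrite lerDl sumr_ge0.
Qed.

Lemma C1piec_gradient (u : V -> R) : C1piec Omega u -> exists W : set V,
  [/\ open W, W `<=` Omega, class_C 1 W u &
      \forall x \ae mu, Omega x -> W x /\ grad Omega u x = gradient u x].
Proof.
move=> [[_ [k [wk _]]] [omega [oo _ o0 C1]]].
pose W := \bigcup_h omega h.
have oW : open W by apply: bigcup_open => h _; case: (oo h).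
have WO : W `<=` Omega by move=> x [h _ /(oo h).2].
have C1W : class_C 1 W u.
  split=> [x|i]; first by rewrite inE => -[h _ xh]; have [c _] := C1 h; exact: (c x (mem_set xh)).
  split=> [x [h _ xh]|]; first by have [_ /(_ i)[d _]] := C1 h; exact: d.
  split=> // x; rewrite inE => -[h _ xh]; have [_ /(_ i)[_ [c _]]] := C1 h.
  exact: (c x (mem_set xh)).
exists W; split => //.
have wg : weak_gradient Omega u (grad Omega u) by apply: grad_weak; exists k.
have ae1 : \forall x \ae mu, ~ (Omega `\` W) x.
  by apply: ae_null o0; apply: measurableD; exact: open_rV_measurable.
apply: filterS2 ae1 (class_C1_weak_gradient oO oW WO C1W wg) => x h1 h2 Ox.
have Wx : W x by apply: contrapT => nW; apply: h1.
by split => //; exact: h2.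
Qed.

Hypothesis lslc_const : let A := [set xi | (F xi < (f xi)%:E)%E] in
  forall xi eta, A xi -> connected_component A xi eta -> F eta = F xi.

(** Where the gradient of [u] is surrounded by points at which [f <= m],
    pyramids bring it to such points. At almost all other points of [Omega] it
    already satisfies [f <= m], because of [lslc_const_span]. *)
Lemma relaxation_correction (u : V -> R) (m : R) : C1piec Omega u ->
  (energy F Omega u <= m%:E)%E ->
  exists s g, [/\ W11_grad Omega s g, in_W11_0 Omega s g,
  measurable_fun setT s /\ (forall i, measurable_fun setT (coor i \o g)),
  exists M, forall x, `|s x| <= M /\ `|g x| <= M &
  \forall x \ae mu, Omega x -> f (grad Omega u x - g x) <= m].
Proof.
move=> C1u /energy_leP Fm; have [W [oW WO C1W aeW_]] := C1piec_gradient C1u.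
have [M0 aeM] := Lpoo_gradient_bounded C1u.1.
pose P := [set xi | f xi <= m].
have [B PB] : exists B, forall xi, P xi -> `|xi| <= B.
  by have [B [_ HB]] := f_coercive m; exists (B + 1) => xi; apply: HB; rewrite ltrDl.
have [s [g [h1 h2 h3 h4 h5]]] := gradient_push (M0 + 1) oO Ooo oW WO C1W n0 PB.
exists s, g; split => //.
have ae1 : \forall x \ae mu, Omega x -> [/\ W x, grad Omega u x = gradient u x,
    `|gradient u x| < M0 + 1 & (F (gradient u x) <= m%:E)%E].
  apply: filterS3 aeW_ aeM Fm => x hW hM hF Ox; have [Wx <-] := hW Ox.
  by split => //; [rewrite (le_lt_trans (hM Ox))// ltrDl|exact: hF].
apply: filterS2 ae1 h5 => x h hg Ox; have [Wx -> gM hF] := h Ox.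
move: hg; case: ifPn => [//|/negP nU ->].
rewrite subr0 leNgt; apply/negP => mf; apply: nU; rewrite inE.
have [Xi [d [d0 XiP sX]]] := lslc_const_span f_cont f_coercive lslc_const hF mf.
have [k] := ltr_add_invr d0; rewrite add0r => kd.
by exists k => //; split => //; split => //; exists Xi, d.
Qed.

End supremal.

Theorem theorem4p5 (R : realType) (n : nat) (Omega : set 'rV[R]_n)
    (f : 'rV[R]_n -> R) (gamma : R -> R) (u0 : 'rV[R]_n -> R)
    (n_gt0 : (0 < n)%N)
    (Omega_open : open Omega)
    (Omega_bounded : bounded_set Omega)
    (Omega_lipschitz : lipschitz_boundary Omega)
    (f_cont : continuous f)
    (gamma_ge0 : forall t, 0 <= t -> 0 <= gamma t)
    (gamma_cont : {within `[0, +oo[, continuous gamma})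
    (gamma_incr : {in `[0, +oo[ &, {homo gamma : s t / s <= t}})
    (gamma_lim : gamma t @[t --> +oo] --> +oo)
    (f_ge : forall xi, gamma (enorm xi) <= f xi)
    (u0_W : W1 +oo%E Omega u0)
    (Plc_solution : exists2 ubar : 'rV[R]_n -> R,
       solution (lslc (EFin \o f)) Omega u0 ubar & C1piec Omega ubar)
    (lslc_const : let A := [set xi | (lslc (EFin \o f) xi < (f xi)%:E)%E] in
       forall xi eta, A xi -> connected_component A xi eta ->
         lslc (EFin \o f) eta = lslc (EFin \o f) xi) :
  exists u : 'rV[R]_n -> R, solution (EFin \o f) Omega u0 u.
Proof.
have Ooo : (leb n Omega < +oo)%E.
  by apply: bounded_leb_lty => //; exact: open_rV_measurable.
have f_coercive (c : R) : bounded_set [set x | f x <= c].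
  have /cvgryPgt/(_ c)[T [_ HT]] := gamma_lim.
  exists T; split; first exact: num_real.
  move=> M TM x /= fx; have e0 : 0 <= enorm x by exact: sqrtr_ge0.
  apply: le_trans (ltW TM); apply: le_trans (_ : enorm x <= _).
    by apply: norm_le_sqdot => //; rewrite sqr_sqrtr// dot_ge0.
  by rewrite leNgt; apply/negP => /HT; rewrite ltNge (le_trans (f_ge x) fx).
have f_ge0 xi : 0 <= f xi by apply: le_trans (f_ge xi); apply: gamma_ge0; exact: sqrtr_ge0.
have [ubar [adm_ubar inf_ubar] C1ubar] := Plc_solution.
suff [u adm_u uu] : exists2 u, admissible Omega u0 u &
    (energy (EFin \o f) Omega u <= energy (lslc (EFin \o f)) Omega ubar)%E.
  exists u; split => //; apply/eqP; rewrite eq_le; apply/andP; split; last first.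
    by apply: ereal_inf_lbound; exists u.
  apply: le_trans uu _; rewrite inf_ubar; apply: le_ereal_inf_tmp => _ [v adm_v <-].
  by apply: le_trans (le_energy _ _ _); apply: ereal_inf_lbound; exists v.
(* the infimum is [+oo] or, when [Omega] is negligible, [-oo]; otherwise finite *)
case mE : (energy (lslc (EFin \o f)) Omega ubar) => [m| |]; last 2 first.
- by exists ubar => //; rewrite leey.
- exists ubar => //.
  have /energy_leP H : (energy (lslc (EFin \o f)) Omega ubar <= -oo)%E by rewrite mE.
  apply/energy_leP; apply: filterS H => x H /H.
  have : (0%:E <= lslc (EFin \o f) (grad Omega ubar x))%E by exact: lslc_ge_cst.
  by move=> h1 h2; have := le_trans h1 h2.
have Em : (energy (lslc (EFin \o f)) Omega ubar <= m%:E)%E by rewrite mE.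
have [s [g [Wsg sg0 [ms mg] [M sgM] fm]]] :=
  relaxation_correction n_gt0 Omega_open Ooo f_cont f_coercive lslc_const C1ubar Em.
have [w Ww ubarE] := adm_ubar.
have [_ [Lw [k [wk Lk]]]] := Ww.
have Wwk : W11_grad Omega w k.
  split => //; first exact: Lpoo_Lp1.
  by move=> i; exact: Lpoo_Lp1.
have [wk0 _] := (W10_inftyP Omega_open Wwk).1 Ww.
have sMae : \forall x \ae leb n, Omega x -> `|s x| <= M.
  by apply: aeW => x _; case: (sgM x).
have gMae i : \forall x \ae leb n, Omega x -> `|(coor i \o g) x| <= M.
  by apply: aeW => x _; apply: le_trans (sgM x).2; exact: le_coord_norm.
have Wws := W11_gradB Omega_open Wwk Wsg.
exists (u0 \+ (fun x => w x - s x)).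
  exists (fun x => w x - s x) => //; apply/(W10_inftyP Omega_open Wws); split.
    exact: in_W11_0B.
  split; first by apply: LpooB => //; apply: bounded_Lpoo sMae => //; exact: measurable_funTS.
  exists (fun x => k x - g x); split; first by case: Wws.
  move=> i; rewrite (_ : _ \o _ = fun x => (coor i \o k) x - (coor i \o g) x).
    by apply: LpooB => //; apply: bounded_Lpoo (gMae i) => //; exact: measurable_funTS.
  by apply/funext => x; rewrite /= /coor !mxE.
apply/energy_leP.
have [Lu [ku [wku _]]] := C1ubar.1.
have [is_ _ wsg] := Wsg.
have lu : locally_integrable_on Omega ubar by apply: integrable_locally => //; exact: Lpoo_Lp1.
have ls : locally_integrable_on Omega s by exact: integrable_locally.
have wd := weak_gradientB Omega_open lu ls wku wsg.
have -> : u0 \+ (fun x => w x - s x) = fun x => ubar x - s x.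
  by apply/funext => x; rewrite -ubarE /= addrA.
apply: filterS3 fm (grad_ae Omega_open wku) (grad_ae Omega_open wd) => x h1 h2 h3 Ox.
by rewrite (h3 Ox) /= -(h2 Ox) lee_fin; exact: h1.
Qed.
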